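(* Consider the periodic initial boundary value problem $$u_{xt}+uu_{xx}-\lambda u_x^2=I(t),\quad u(x,0)=u_0(x),\quad I(t)=-(\lambda+1)\int_0^1u_x^2\,dx,\quad u(0,t)=u(1,t),\ u_x(0,t)=u_x(1,t),$$ for $x\in[0,1]$, $t>0$, where, for some $q>0$ and $C_1<0$, $u_0'(\alpha)\sim M_0+C_1|\alpha-\overline\alpha_i|^q$ near every $\overline\alpha_i$. Then: 1. If $q>0$ and $\lambda\in[0,q/2]$, solutions exist globally in time. More particularly, they vanish as $t\uparrow t_*=+\infty$ for $\lambda\in(0,q/2)$ but converge to a nontrivial steady state if $\lambda=q/2$. 2. If $q>0$ and $\lambda\in(q/2,q)$, there exists a finite $t_*>0$ such that $M(t)\to+\infty$ and $m(t)\to-\infty$ as $t\uparrow t_*$. Moreover, $\lim_{t\uparrow t_*}u_x(\gamma(\alpha,t),t)=-\infty$ for $\alpha\notin\bigcup_{i,j}\{\overline\alpha_i\}\cup\{\underline\alpha_j\}$ (two-sided, everywhere blow-up). 3. For $q\in(0,1/2)$ and $\lambda>1$ such that $q\ne\frac1n$ and $\lambda\ne\frac{q}{1-nq}$ for all $n\in\mathbb{N}$, there is a finite $t_*>0$ such that only the maximum blows up, $M(t)\to+\infty$, as $t\uparrow t_*$ (one-sided, discrete blow-up). Further, if $\frac12<\lambda<\frac{q}{1-q}$ for $q\in(1/3,1/2)$, a two-sided, everywhere blow-up (in the sense described in part 2) occurs at a finite $t_*>0$. 4. Suppose $q\in(1/2,1)$. Then for $q<\lambda<\frac{q}{1-q}$,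 there exists a finite $t_*>0$ such that, as $t\uparrow t_*$, two-sided, everywhere blow-up (in the sense described in part 2) develops. If instead $\lambda>\frac{q}{1-q}$, only the maximum diverges, $M(t)\to+\infty$, as $t\uparrow t_*<+\infty$. 5. For $\lambda>q>1$, there is a finite $t_*>0$ such that $u_x$ undergoes a two-sided, everywhere blow-up (in the sense described in part 2) as $t\uparrow t_*$.
   Context: $\mathbb{N}=\{1,2,\dots\}$. Standing assumptions on the data: $u_0$ is periodic, $u_0'$ is bounded and at least continuous a.e. on $(0,1)$ (so $\int_0^1u_0'=0$); $M_0>0>m_0$ are the greatest and least values of $u_0'$, attained at finitely many points $\overline\alpha_i$ and $\underline\alpha_j$ of $[0,1]$ respectively (and $u_0'$ is bounded away from these values off any neighbourhood of these points). Neighbourhoods are periodic. $u_0'(\alpha)\sim M_0+C_1|\alpha-\overline\alpha_i|^q$ near $\overline\alpha_i$ means $M_0-u_0'(\alpha)$ is asymptotically equivalent (ratio $\to1$) to $|C_1||\alpha-\overline\alpha_i|^q$ as $\alpha\to\overline\alpha_i$. Solutions are understood along characteristics $\gamma$, $\dot\gamma(\alpha,t)=u(\gamma(\alpha,t),t)$, $\gamma(\alpha,0)=\alpha$. For $\lambda\ne0$ put $\mathcal{J}(\alpha,t)=1-\lambda\eta(t)u_0'(\alpha)$, $\bar{\mathcal{K}}_i(t)=\int_0^1\mathcal{J}(\alpha,t)^{-i-1/\lambda}d\alpha$, where $\dot\eta=\bar{\mathcal{K}}_0^{-2\lambda}$, $\eta(0)=0$. The solution is given by $$\gamma_\alpha=\frac{\mathcal{J}(\alpha,t)^{-1/\lambda}}{\bar{\mathcal{K}}_0(t)},\qquad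 u_x(\gamma(\alpha,t),t)=\frac{1}{\lambda\eta(t)\bar{\mathcal{K}}_0(t)^{2\lambda}}\left(\frac{1}{\mathcal{J}(\alpha,t)}-\frac{\bar{\mathcal{K}}_1(t)}{\bar{\mathcal{K}}_0(t)}\right)$$ (with value $u_0'(\alpha)$ at $t=0$) as long as $\eta(t)<\eta_*$, where, for $\lambda>0$, $\eta_*=\frac1{\lambda M_0}$. It is defined for $t\in[0,t_* )$ with $$t_*=\lim_{\eta\uparrow\eta_*}\int_0^\eta\left(\int_0^1(1-\lambda\mu u_0'(\alpha))^{-1/\lambda}d\alpha\right)^{2\lambda}d\mu\in(0,+\infty].$$ For $\lambda=0$ the corresponding solution is $\gamma_\alpha=e^{tu_0'(\alpha)}/\int_0^1e^{tu_0'}$, $u_x(\gamma(\alpha,t),t)=u_0'(\alpha)-\int_0^1u_0'e^{tu_0'}/\int_0^1e^{tu_0'}$. $M(t)=\sup_\alpha u_x(\gamma(\alpha,t),t)$ and $m(t)=\inf_\alpha u_x(\gamma(\alpha,t),t)$; one has $M(t)=u_x(\gamma(\overline\alpha_i,t),t)$, $m(t)=u_x(\gamma(\underline\alpha_j,t),t)$. ''Vanish'' means $u_x(\gamma(\alpha,t),t)\to0$ for every $\alpha$; ''converge to a nontrivial steady state'' means that $u_x(\gamma(\alpha,t),t)$ has a finite limit as $t\to\infty$ for every $\alpha$, the limit not being identically zero. ''Only the maximum diverges'' (one-sided, discrete blow-up) means that divergence occurs (to $+\infty$) only at the finitely many labels $\alpha=\overline\alpha_i$, while $u_x(\gamma(\alpha,t),t)$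 stays bounded as $t\uparrow t_*$ for every other $\alpha$ and $m(t)$ does not diverge. *)

(* Defs.v *)
From HB Require Import structures.
From mathcomp Require Import all_boot all_order all_algebra.
From mathcomp Require Import all_classical all_reals all_analysis.

Set Implicit Arguments.
Unset Strict Implicit.
Unset Printing Implicit Defensive.

Import Order.TTheory GRing.Theory Num.Theory.
Import numFieldNormedType.Exports.

Local Open Scope classical_set_scope.
Local Open Scope ring_scope.

Notation leb := (@lebesgue_measure _) (only parsing).

(* Spatial derivatives are only continuous a.e., so "f is the derivative of F"
   is read in the absolutely continuous sense; F' = f then holds classically at
   every point of continuity of f. *)
Definition primitive01 (R : realType) (F f : R -> R) : Prop :=
  forall x : R, 0 <= x <= 1 ->
    F x = F 0 + \int[leb]_(y in `[0%R, x]) f y.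

(* The arguments a of [0, 1] with f a = v; for v = M0 (resp. m0) these are the
   points \overline\alpha_i (resp. \underline\alpha_j). *)
Definition attained_at (R : realType) (f : R -> R) (v : R) : set R :=
  [set a | 0 <= a <= 1 /\ f a = v].

(* f stays at distance >= d from v off the e-neighbourhood of its v-points.
   As b ranges over R and f is 1-periodic, the neighbourhoods are periodic. *)
Definition bounded_away (R : realType) (f : R -> R) (v : R) : Prop :=
  forall e : R, 0 < e -> exists2 d : R, 0 < d &
    forall a : R, (forall b : R, f b = v -> e <= `|a - b|) -> d <= `|f a - v|.

(* [du0] is u_0'. Its boundedness is contained in [id_max] and [id_min], and
   its zero mean in [id_per] and [id_prim]. *)
Record initial_data (R : realType) (u0 du0 : R -> R) (M0 m0 : R) : Prop := {
  id_per : forall x : R, u0 (x + 1) = u0 x;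
  id_dper : forall x : R, du0 (x + 1) = du0 x;
  id_prim : primitive01 u0 du0;
  id_cont : {ae (@lebesgue_measure R), forall x : R,
               0 < x < 1 -> {for x, continuous du0}};
  id_sign : m0 < 0 < M0;
  id_max : forall x : R, du0 x <= M0;
  id_min : forall x : R, m0 <= du0 x;
  id_max_att : attained_at du0 M0 !=set0;
  id_min_att : attained_at du0 m0 !=set0;
  id_max_fin : finite_set (attained_at du0 M0);
  id_min_fin : finite_set (attained_at du0 m0);
  id_max_away : bounded_away du0 M0;
  id_min_away : bounded_away du0 m0 }.

(* u_0'(a) ~ M0 + C1 |a - b|^q near every maximum point b. *)
Definition max_profile (R : realType) (du0 : R -> R) (M0 q C1 : R) : Prop :=
  forall b : R, attained_at du0 M0 b ->
    (M0 - du0 a) / (`|C1| * `|a - b| `^ q) @[a --> b^'] --> (1 : R).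

Definition Jac (R : realType) (lam : R) (du0 : R -> R) (e a : R) : R :=
  1 - lam * e * du0 a.

(* \bar K_i as a function of the value e of eta. *)
Definition Kbar (R : realType) (lam : R) (du0 : R -> R) (i : nat) (e : R) : R :=
  \int[leb]_(a in `[0%R, 1%R]) (Jac lam du0 e a `^ (- i%:R - lam^-1)).

Definition eta_star (R : realType) (lam M0 : R) : R := (lam * M0)^-1.

(* t_*; the formula for [eta_star] is the one valid for lam > 0. *)
Definition tstar (R : realType) (lam : R) (du0 : R -> R) (M0 : R) : \bar R :=
  if lam == 0 then +oo%E else
  lim ((\int[leb]_(s in `[0%R, e]) (Kbar lam du0 0 s `^ (2 * lam)))%:E
         @[e --> (eta_star lam M0)^'-]).

(* y' = dy on (0, T), and y takes its initial value continuously. *)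
Definition evolves (R : realType) (T : \bar R) (y dy : R -> R) : Prop :=
  y t @[t --> 0^'+] --> y 0 /\
  forall t : R, 0 < t -> (t%:E < T)%E -> is_derive t 1 y (dy t).

(* The initial boundary value problem on [0, T), for u, u_x and the
   characteristics g = \gamma. The combination u_xt + u u_xx of the equation is
   the derivative of u_x along characteristics. *)
Record ibvp_solution (R : realType) (lam : R) (u0 du0 : R -> R) (T : \bar R)
    (u ux g : R -> R -> R) : Prop := {
  sol_per : forall x t : R, 0 <= t -> (t%:E < T)%E -> u (x + 1) t = u x t;
  sol_dper : forall x t : R, 0 <= t -> (t%:E < T)%E -> ux (x + 1) t = ux x t;
  sol_bnd : forall t : R, 0 <= t -> (t%:E < T)%E ->
    exists B : R, forall x : R, `|ux x t| <= B;
  sol_prim : forall t : R, 0 <= t -> (t%:E < T)%E ->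
    primitive01 (u ^~ t) (ux ^~ t);
  sol_init : forall x : R, u x 0 = u0 x;
  sol_dinit : forall x : R, ux x 0 = du0 x;
  sol_char0 : forall a : R, g a 0 = a;
  sol_char : forall a : R, evolves T (g a) (fun t => u (g a t) t);
  sol_pde : forall a : R, evolves T (fun t => ux (g a t) t)
    (fun t => lam * ux (g a t) t ^+ 2
              - (lam + 1) * \int[leb]_(x in `[0%R, 1%R]) (ux x t ^+ 2)) }.

Definition eta_ode (R : realType) (lam : R) (du0 : R -> R) (M0 : R)
    (eta : R -> R) : Prop :=
  [/\ eta 0 = 0,
      forall t : R, 0 <= t -> (t%:E < tstar lam du0 M0)%E ->
        0 <= eta t < eta_star lam M0 &
      evolves (tstar lam du0 M0) eta
        (fun t => Kbar lam du0 0 (eta t) `^ (- (2 * lam)))].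

(* \gamma_\alpha and u_x o \gamma for lam != 0. *)
Definition ga_formula (R : realType) (lam : R) (du0 eta : R -> R)
    (a t : R) : R :=
  Jac lam du0 (eta t) a `^ (- lam^-1) / Kbar lam du0 0 (eta t).

Definition ux_formula (R : realType) (lam : R) (du0 eta : R -> R)
    (a t : R) : R :=
  if t == 0 then du0 a else
  (lam * eta t * Kbar lam du0 0 (eta t) `^ (2 * lam))^-1
  * ((Jac lam du0 (eta t) a)^-1
     - Kbar lam du0 1 (eta t) / Kbar lam du0 0 (eta t)).

(* \gamma_\alpha and u_x o \gamma for lam = 0. *)
Definition ga_formula0 (R : realType) (du0 : R -> R) (a t : R) : R :=
  expR (t * du0 a) / \int[leb]_(b in `[0%R, 1%R]) expR (t * du0 b).

Definition ux_formula0 (R : realType) (du0 : R -> R) (a t : R) : R :=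
  du0 a - (\int[leb]_(b in `[0%R, 1%R]) (du0 b * expR (t * du0 b)))
          / \int[leb]_(b in `[0%R, 1%R]) expR (t * du0 b).

Definition represented_by (R : realType) (T : \bar R) (ux g : R -> R -> R)
    (ga w : R -> R -> R) : Prop :=
  forall t : R, 0 <= t -> (t%:E < T)%E ->
    [/\ forall a : R, g (a + 1) t = g a t + 1,
        primitive01 (g ^~ t) (ga ^~ t) &
        forall a : R, ux (g a t) t = w a t].

(* The solution of the problem on its interval of definition [0, t_* [: it solves
   the problem and is given by the representation formulae. *)
Definition the_solution (R : realType) (lam : R) (u0 du0 : R -> R) (M0 : R)
    (u ux g : R -> R -> R) : Prop :=
  ibvp_solution lam u0 du0 (tstar lam du0 M0) u ux g /\
  if lam == 0 then
    represented_by (tstar lam du0 M0) ux g (ga_formula0 du0) (ux_formula0 du0)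
  else
    exists2 eta : R -> R, eta_ode lam du0 M0 eta &
      represented_by (tstar lam du0 M0) ux g
        (ga_formula lam du0 eta) (ux_formula lam du0 eta).

(* The solution exists on [0, t_* [ and U(a, t) = u_x(\gamma(a, t), t) satisfies
   P. (The representation determines U on [0, t_* [, while u and \gamma are only
   determined up to a time-dependent translation in space.) *)
Definition solution_satisfies (R : realType) (lam : R) (u0 du0 : R -> R)
    (M0 : R) (P : \bar R -> (R -> R -> R) -> Prop) : Prop :=
  (exists u ux g : R -> R -> R, the_solution lam u0 du0 M0 u ux g) /\
  forall u ux g : R -> R -> R, the_solution lam u0 du0 M0 u ux g ->
    P (tstar lam du0 M0) (fun a t => ux (g a t) t).

Definition maxU (R : realType) (U : R -> R -> R) (t : R) : R :=
  sup [set U a t | a in `[0%R, 1%R]].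

Definition minU (R : realType) (U : R -> R -> R) (t : R) : R :=
  inf [set U a t | a in `[0%R, 1%R]].

Definition vanishes (R : realType) (U : R -> R -> R) : Prop :=
  forall a : R, 0 <= a <= 1 -> U a t @[t --> +oo] --> (0 : R).

Definition nontrivial_steady_state (R : realType) (U : R -> R -> R) : Prop :=
  exists Uinf : R -> R,
    (forall a : R, 0 <= a <= 1 -> U a t @[t --> +oo] --> Uinf a) /\
    (exists2 a : R, 0 <= a <= 1 & Uinf a != 0).

Definition two_sided_blowup (R : realType) (du0 : R -> R) (M0 m0 : R)
    (T : \bar R) (U : R -> R -> R) : Prop :=
  exists ts : R, [/\ 0 < ts, T = ts%:E,
    maxU U t @[t --> ts^'-] --> +oo,
    minU U t @[t --> ts^'-] --> -oo &
    forall a : R, 0 <= a <= 1 ->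
      ~ (attained_at du0 M0 `|` attained_at du0 m0) a ->
      U a t @[t --> ts^'-] --> -oo].

Definition one_sided_blowup (R : realType) (du0 : R -> R) (M0 : R)
    (T : \bar R) (U : R -> R -> R) : Prop :=
  exists ts : R, [/\ 0 < ts /\ T = ts%:E,
    maxU U t @[t --> ts^'-] --> +oo,
    forall a : R, attained_at du0 M0 a -> U a t @[t --> ts^'-] --> +oo,
    forall a : R, 0 <= a <= 1 -> ~ attained_at du0 M0 a ->
      exists B : R, \forall t \near ts^'-, `|U a t| <= B &
    exists B : R, \forall t \near ts^'-, `|minU U t| <= B].

(* Main.v *)
Require Import Defs.
From HB Require Import structures.
From mathcomp Require Import all_boot all_order all_algebra.
From mathcomp Require Import all_classical all_reals all_analysis.
From mathcomp Require Import measurable_realfun.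
From mathcomp Require Import ring lra.

Set Implicit Arguments.
Unset Strict Implicit.
Unset Printing Implicit Defensive.

Import Order.TTheory GRing.Theory Num.Theory.
Import numFieldNormedType.Exports.
Import HBNNSimple.

Local Open Scope classical_set_scope.
Local Open Scope ring_scope.

(** For [lam > 0] put [s = 1 / lam], [D a = M0 - u0' a] and
    [x = 1 / (lam eta) - M0]. Then [J = lam eta (x + D)], and [x] decreases to [0]
    as [eta] increases to [eta_*]. With [Q_s x] the integral of [(x + D)^(-s)]
    over [[0, 1]], the representation formula becomes
    [u_x = Q_s^(- 2 lam) (1 / (x + D) - Q_(s+1) / Q_s)] (ux_formula_resvel), so
    that only the size of two integrals as [x] tends to [0] matters.

    Near a maximum point [D] behaves like [|C1| |a - b|^q], and the substitution
    [a - b = (x / |C1|)^(1/q) y] shows that [x^(s - 1/q) Q_s] tends to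
    [N I_s] if [q s > 1], where [I_s] is the integral of [(1 + y^q)^(-s)] over the
    half-line and [N > 0] does not depend on [s] (qint_cvg); if [q s < 1] then
    [Q_s] is bounded (qint_bounded). This leaves three regimes.
    - [lam < q]: both integrals are singular, and
      [u_x = x^(1 - 2 lam / q) W] where [W] tends to a positive multiple of
      [1_{D = 0} - I_(s+1) / I_s] (resvel_factor). As [I_(s+1) < I_s] (mint1_gap),
      this limit is positive at the maximum points and negative elsewhere. The
      sign of [1 - 2 lam / q] makes [u_x] vanish, converge or blow up.
    - [lam > q] and [q (s + 1) > 1], that is [lam (1 - q) < q]: [Q_s] stays
      between two positive constants, and [Q_(s+1)] tends to infinity more slowly
      than [1 / x]. Hence [1 / x] wins at the maximum points, and the mean
      [Q_(s+1) / Q_s] wins elsewhere (resvel_max_blowup, resvel_min_blowup).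
    - [q (s + 1) < 1], that is [lam (1 - q) > q]: both integrals are bounded and
      only the term [1 / x] at [D = 0] diverges (resvel_bounded).

    The lifespan is the integral of [dt / d eta = (lam eta)^(-2) Q_s^(2 lam)] up to
    [eta_*]; as [x] is of the order of [eta_* - eta], this rate is of the order of
    [(eta_* - eta)^(- (2 - 2 lam / q))] for [lam < q] and bounded for [lam > q], so
    the lifespan is infinite for [lam <= q / 2] (tstar_pinfty) and finite in the
    other cases (tstar_finite). Any solution [eta] of the differential equation
    inverts this clock (tclock_eta), therefore [x] tends to [0] at the end of the
    lifespan.

    Existence is a verification. The characteristics are cumulative functions of
    the density [gamma_a], hence bi-Lipschitz and invertible, which defines [u_x]
    in space; a change of variables (change_of_variables) moves all spatial
    integrals to labels, where differentiation under the integral gives the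
    equation (flow_ibvp). The case [lam = 0] is the same computation with an
    exponential kernel. Since [u0'] is only continuous almost everywhere, it is
    replaced by a Borel version wherever measurability is needed
    (bounded_borel_version). *)

(** * Integrals of functions known almost everywhere *)

(** The integral of a nonnegative function is a supremum over simple functions
    below it, so the comparison holds without any measurability: a simple
    function below f may be set to 0 on the exceptional null set, which puts it
    below g and does not change its integral. *)
Lemma ge0_le_integral_ae d (T : measurableType d) (R : realType)
    (mu : {measure set T -> \bar R}) (D : set T) (f g : T -> \bar R) :
  (forall x, 0 <= f x)%E -> (forall x, 0 <= g x)%E ->
  {ae mu, forall x, D x -> (f x <= g x)%E} ->
  (\int[mu]_(x in D) f x <= \int[mu]_(x in D) g x)%E.
Proof.
move=> f0 g0 [N [mN muN Nfg]].
have fg x : D x -> ~ N x -> (f x <= g x)%E.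
  by move=> Dx Nx; apply: contrapT => h; apply: Nx; apply: Nfg => /= /(_ Dx).
rewrite !ge0_integralE//; apply: ge_ereal_sup => _ [h /= hf <-].
pose h' := proj_nnsfun h (measurableC mN).
have h'E x : h' x = h x * \1_(~` N) x by [].
apply: le_ereal_sup_tmp; exists (sintegral mu h').
  exists h' => // x; rewrite h'E indicE.
  have [xN|xN] := boolP (x \in ~` N); last first.
    by rewrite mulr0 patchE; case: ifPn.
  rewrite mulr1; apply: (le_trans (hf x)); rewrite !patchE.
  by case: ifPn => // xD; apply: fg; [exact/set_mem|move/set_mem: xN].
rewrite -!integralT_nnsfun; apply: ae_ge0_le_integral => //.
- by move=> x _; rewrite lee_fin.
- exact/measurable_EFinP.
- by move=> x _; rewrite lee_fin.
- exact/measurable_EFinP.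
exists N; split => // x /= h1; apply: contrapT => Nx; apply: h1 => _.
by rewrite lee_fin -[leRHS]/(h' x) h'E indicE mem_set// mulr1.
Qed.

Lemma ae_eq_integral_any d (T : measurableType d) (R : realType)
    (mu : {measure set T -> \bar R}) (D : set T) (f g : T -> \bar R) :
  ae_eq mu D f g -> (\int[mu]_(x in D) f x = \int[mu]_(x in D) g x)%E.
Proof.
have main (h k : T -> \bar R) : (forall x, 0 <= h x)%E -> (forall x, 0 <= k x)%E ->
    ae_eq mu D h k -> (\int[mu]_(x in D) h x = \int[mu]_(x in D) k x)%E.
  move=> h0 k0 hk; apply/eqP; rewrite eq_le; apply/andP; split;
    apply: ge0_le_integral_ae => //; apply: filterS hk => x /[apply] -> //.
move=> fg; rewrite integralE [RHS]integralE; congr (_ - _)%E;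
  apply: main => //; apply: filterS fg => x /[apply] e; by rewrite ?funeposE ?funenegE e.
Qed.

(** A function that is only continuous almost everywhere need not be
    measurable; this lemma still allows to replace it under the integral. *)
Lemma ae_eq_Rintegral_any d (T : measurableType d) (R : realType)
    (mu : {measure set T -> \bar R}) (D : set T) (f g : T -> R) :
  ae_eq mu D f g -> \int[mu]_(x in D) f x = \int[mu]_(x in D) g x.
Proof.
move=> fg; rewrite /Rintegral (@ae_eq_integral_any _ _ _ _ _ _ (EFin \o g))//.
by apply: filterS fg => x /[apply] /= ->.
Qed.

Lemma ae_neq (R : realType) (a : R) : {ae (@lebesgue_measure R), forall x, x <> a}.
Proof.
exists [set a]; split; [exact: measurable_set1|exact: lebesgue_measure_set1|].
by move=> x /= /contrapT.
Qed.

(** h is the restriction of f to the points of ]0, 1[ outside a measurable null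
    set containing the discontinuities; f is continuous, hence measurable, on
    that set. The last clause transfers to h every two-sided bound on f by
    numbers of opposite sign. *)
Lemma borel_version (R : realType) (f : R -> R) :
  {ae (@lebesgue_measure R), forall x : R, 0 < x < 1 -> {for x, continuous f}} ->
  exists h : R -> R, [/\ measurable_fun setT h,
    {ae (@lebesgue_measure R), forall x, `[0%R, 1%R]%classic x -> h x = f x} &
    forall x, h x = f x \/ h x = 0].
Proof.
move=> [N [mN N0 Nf]].
pose A : set R := `]0, 1[ `\` N.
have mA : measurable A by apply: measurableD.
exists (f \_ A); split.
- apply/measurable_restrict => //; rewrite setTI; apply: subspace_continuous_measurable_fun => //.
  apply: continuous_in_subspaceT => x /set_mem [/=]; rewrite in_itv/= => x01 Nx.
  by apply: contrapT => h; apply: Nx; apply: Nf => /= /(_ x01).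
- have NN : {ae (@lebesgue_measure R), forall x, ~ N x}.
    by exists N; split => // x /= /contrapT.
  have FF := ae_filter_ringOfSetsType (@lebesgue_measure R).
  apply: filterS3 (ae_neq 0) (ae_neq 1) NN => x x0 x1 Nx /=.
  rewrite in_itv/= => /andP[x0' x1']; rewrite patchE mem_set//; split => //=.
  by rewrite in_itv/= !lt_neqAle x0' x1' !andbT; apply/andP; split; apply/eqP => // /esym.
- move=> x; rewrite patchE; case: ifPn => _; [by left|by right].
Qed.

Lemma bounded_borel_version (R : realType) (u0 du0 : R -> R) (M0 m0 : R) :
  initial_data u0 du0 M0 m0 -> exists h : R -> R, [/\ measurable_fun setT h,
    {ae (@lebesgue_measure R), forall x, `[0%R, 1%R]%classic x -> h x = du0 x} &
    forall x, m0 <= h x <= M0].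
Proof.
move=> hdata; have [h [mh hd h0]] := borel_version (id_cont hdata).
exists h; split => // x; have [->|->] := h0 x.
  by rewrite (id_min hdata) (id_max hdata).
by have /andP[/ltW-> /ltW->] := id_sign hdata.
Qed.

Lemma bounded_integrable (R : realType) (f : R -> R) (C a b : R) (ba bb : bool) :
  measurable_fun setT f -> (forall x, `|f x| <= C) ->
  (@lebesgue_measure R).-integrable [set` Interval (BSide ba a) (BSide bb b)] (EFin \o f).
Proof.
move=> mf fC; apply: measurable_bounded_integrable => //.
- rewrite /= lebesgue_measure_itv/=; case: ifP => // _; exact: ltry.
- exact: measurable_funTS.
- exists C; split; first exact: num_real.
  by move=> x Cx y _; apply: le_trans (fC y) (ltW Cx).
Qed.

(** * Change of variables along a cumulative function *)

Section Cumulative.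
Variables (R : realType) (g : R -> R) (c C : R).
Hypothesis mg : measurable_fun setT g.
Hypothesis c_gt0 : 0 < c.
Hypothesis g_bnd : forall x, c <= g x <= C.

Lemma integrable_itv_g (a b : R) (ba bb : bool) :
  (@lebesgue_measure R).-integrable [set` Interval (BSide ba a) (BSide bb b)] (EFin \o g).
Proof.
apply: (@bounded_integrable _ _ C) => // x.
have /andP[c1 c2] := g_bnd x.
by rewrite ger0_norm// (le_trans _ c1)// ltW.
Qed.

(** The signed form makes the primitive of g from 0 monotone on the whole line,
    so that its inverse is total and the pushforward statement below can be
    made for the Lebesgue measure of R. *)
Definition cumul a : R :=
  \int[leb]_(x in `]0%R, a]) g x - \int[leb]_(x in `]a, 0%R]) g x.

Lemma integral_oc_cat (a b x : R) : a <= x -> x <= b ->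
  \int[leb]_(x in `]a, b]) g x =
  \int[leb]_(x in `]a, x]) g x + \int[leb]_(x in `]x, b]) g x.
Proof.
move=> ax xb; rewrite -(@Rintegral_itvB _ g (BRight a) (BRight b) x) ?bnd_simp//.
  by rewrite subrKC.
exact: integrable_itv_g.
Qed.

Lemma integral_oc_empty (a b : R) : b <= a -> \int[leb]_(x in `]a, b]) g x = 0.
Proof. by move=> ba; rewrite set_itv_ge ?Rintegral_set0// bnd_simp -leNgt. Qed.

Lemma cumulB a b : a <= b -> cumul b - cumul a = \int[leb]_(x in `]a, b]) g x.
Proof.
move=> ab; rewrite /cumul; have [a0|a0] := leP 0 a.
  rewrite [X in _ - X - _]integral_oc_empty ?(le_trans a0)//.
  rewrite [X in _ - (_ - X)]integral_oc_empty//.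
  by rewrite (integral_oc_cat a0 ab); lra.
have [b0|b0] := leP 0 b.
  rewrite [X in _ - X - _]integral_oc_empty//.
  rewrite [X in _ - (X - _)]integral_oc_empty ?ltW//.
  by rewrite (integral_oc_cat (ltW a0) b0); lra.
rewrite [X in X - _ - _]integral_oc_empty ?ltW//.
rewrite [X in _ - (X - _)]integral_oc_empty ?ltW//.
by rewrite (integral_oc_cat ab (ltW b0)); lra.
Qed.

Lemma cumul0 : cumul 0 = 0.
Proof. by rewrite /cumul subrr. Qed.

Lemma cumul_ge0 a : 0 <= a -> cumul a = \int[leb]_(x in `[0%R, a]) g x.
Proof.
move=> a0; have := cumulB a0; rewrite cumul0 subr0 => ->.
by rewrite Rintegral_itv_obnd_cbnd//; exact: integrable_itv_g.
Qed.

Lemma integral_oc_bnd a b : a <= b ->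
  c * (b - a) <= \int[leb]_(x in `]a, b]) g x <= C * (b - a).
Proof.
move=> ab.
have E k : \int[leb]_(x in `]a, b]) k = k * (b - a).
  rewrite Rintegral_cst//; congr (_ * _); rewrite /= lebesgue_measure_itv/= lte_fin.
  by move: ab; rewrite le_eqVlt => /predU1P[->|->//]; rewrite ltxx subrr.
have Ik k : (@lebesgue_measure R).-integrable `]a, b] (EFin \o (fun=> k)).
  by apply: (@bounded_integrable _ _ `|k|).
by rewrite -!E; apply/andP; split; apply: le_Rintegral => //; try exact: integrable_itv_g;
  move=> x _; have /andP[] := g_bnd x.
Qed.

(** As g lies between two positive constants, its primitive is bi-Lipschitz;
    monotonicity, continuity and surjectivity all come from this estimate. *)
Lemma cumul_bnd a b : a <= b -> c * (b - a) <= cumul b - cumul a <= C * (b - a).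
Proof. by move=> ab; rewrite cumulB//; exact: integral_oc_bnd. Qed.

Lemma cumul_lt : {mono cumul : a b / a < b}.
Proof.
apply/leW_mono/le_mono => a b ab.
have /andP[h _] := cumul_bnd (ltW ab).
by rewrite -subr_gt0; apply: lt_le_trans h; rewrite mulr_gt0// subr_gt0.
Qed.

Lemma cumul_le : {mono cumul : a b / a <= b}.
Proof.
by move=> a b; rewrite !leNgt cumul_lt.
Qed.

Lemma cumul_inj : injective cumul.
Proof. exact: (inc_inj cumul_le). Qed.

Lemma cumul_continuous : continuous cumul.
Proof.
move=> a; apply/cvgrPdist_lt => e e0.
have C0 : 0 < C by have /andP[h1 h2] := g_bnd 0; apply: lt_le_trans c_gt0 (le_trans h1 h2).
near=> b.
have ab : `|a - b| < e / C.
  by near: b; exists (e / C); rewrite /= ?divr_gt0.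
have L x y : x <= y -> y - x < e / C -> `|cumul y - cumul x| < e.
  move=> xy xye; have /andP[h1 h2] := cumul_bnd xy.
  rewrite ger0_norm ?subr_ge0 ?cumul_le//; apply: le_lt_trans h2 _.
  by rewrite mulrC -ltr_pdivlMr.
have [ba|/ltW ab'] := leP b a.
  by apply: L => //; rewrite ger0_norm ?subr_ge0 in ab.
by rewrite distrC; apply: L => //; rewrite distrC ger0_norm ?subr_ge0 in ab.
Unshelve. all: by end_near. Qed.

Lemma cumul_surj y : exists a, cumul a = y.
Proof.
(* Since cumul grows at rate at least c, it passes |y| before |y| / c. *)
pose r := `|y| / c.
have r0 : 0 <= r by rewrite divr_ge0// ltW.
have h1 : y <= cumul r.
  have /andP[h _] := cumul_bnd r0; rewrite cumul0 !subr0 in h.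
  by apply: le_trans h; rewrite /r mulrC divfK ?gt_eqF// ler_norm.
have h2 : cumul (- r) <= y.
  have nr : - r <= 0 by rewrite oppr_le0.
  have /andP[h _] := cumul_bnd nr; rewrite cumul0 !sub0r opprK in h.
  rewrite lerNr in h; apply: le_trans h _.
  by rewrite /r mulrC divfK ?gt_eqF// lerNl -normrN ler_norm.
have rr : - r <= r by rewrite ge0_cp.
have [||x _ <-] := @IVT R cumul (- r) r y rr; last by exists x.
  exact/continuous_subspaceT/cumul_continuous.
by rewrite ge_min h2 le_max h1 orbT.
Qed.

Definition cinv y := xget 0 [set a | cumul a = y].

Lemma cinvK : cancel cinv cumul.
Proof. by move=> y; have [a ay] := cumul_surj y; apply: (@xgetPex _ 0 [set a | cumul a = y]); exists a. Qed.

Lemma cumulK : cancel cumul cinv.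
Proof. by move=> a; apply: cumul_inj; rewrite cinvK. Qed.

Lemma cinv_le : {mono cinv : a b / a <= b}.
Proof. by move=> a b; rewrite -cumul_le !cinvK. Qed.

Lemma measurable_cinv : measurable_fun [set: R] cinv.
Proof. by apply: nondecreasing_measurable => // a b ab; rewrite cinv_le. Qed.

Definition dens (A : set (measurableTypeR R)) : \bar R :=
  \int[leb]_(x in A) (g x)%:E.

Let g_ge0 x : 0 <= g x.
Proof. by have /andP[h _] := g_bnd x; apply: le_trans h; exact: ltW. Qed.

Let dens0 : dens set0 = 0%E. Proof. exact: integral_set0. Qed.

Let dens_ge0 A : (0 <= dens A)%E.
Proof. by apply: integral_ge0 => x _; rewrite lee_fin. Qed.

Let dens_sigma_additive : semi_sigma_additive dens.
Proof.
move=> /= A mA tA mUA; rewrite /dens/= ge0_integral_bigcup//=; last first.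
- by move=> x _; rewrite lee_fin.
- exact/measurable_funTS/measurable_EFinP.
apply: is_cvg_ereal_nneg_natsum_cond => n _ _; exact: dens_ge0.
Qed.

HB.instance Definition _ := isMeasure.Build _ _ _
  dens dens0 dens_ge0 dens_sigma_additive.

Lemma measurable_cumul : measurable_fun [set: measurableTypeR R] (cumul : measurableTypeR R -> measurableTypeR R).
Proof. by apply: nondecreasing_measurable => // a b ab; rewrite cumul_le. Qed.

(** A measure that gives each interval its length is the Lebesgue measure, and
    the g-mass of the preimage of ]a, b] is cumul (cinv b) - cumul (cinv a). *)
Lemma pushforward_dens A : measurable A ->
  lebesgue_measure A = pushforward dens (cumul : measurableTypeR R -> measurableTypeR R) A.
Proof.
move=> mA; apply: lebesgue_measure_unique => //; first exact: measurable_cumul.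
move=> mcum _ [[a b]] _ <-.
rewrite /= lebesgue_measure_itv/= lte_fin.
rewrite /pushforward /dens /=.
have -> : cumul @^-1` `]a, b] = `]cinv a, cinv b]%classic.
  by apply/seteqP; split => x /=; rewrite !in_itv/= -[cinv a < x]cumul_lt -[x <= cinv b]cumul_le !cinvK.
case: ltP => ab; last first.
  by rewrite set_itv_ge ?integral_set0// bnd_simp -leNgt cinv_le.
have cab : cinv a <= cinv b by rewrite cinv_le ltW.
have := cumulB cab.
rewrite !cinvK -EFinB => ->; rewrite /Rintegral fineK//.
by apply: integrable_fin_num => //; exact: integrable_itv_g.
Qed.

(** Integration against a density: the identity holds for simple functions and
    passes to increasing limits on both sides. *)
Lemma ge0_integral_dens (D : set (measurableTypeR R)) (f : measurableTypeR R -> \bar R) :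
  measurable D -> measurable_fun D f -> (forall x, 0 <= f x)%E ->
  (\int[dens]_(x in D) f x = \int[leb]_(x in D) (f x * (g x)%:E))%E.
Proof.
move=> mD mf f0; pose h := nnsfun_approx mD mf.
have fE x : D x -> (h n x)%:E @[n --> \oo] --> f x.
  by move=> Dx; exact: cvg_nnsfun_approx.
transitivity (limn (fun n => \int[dens]_(x in D) (h n x)%:E))%E.
  rewrite -monotone_convergence//.
  - by apply: eq_integral => x /set_mem Dx; apply/esym/cvg_lim => //; exact: fE.
  - move=> n; apply/measurable_EFinP.
    by apply: (measurable_funS measurableT) => //; exact/measurable_funP.
  - by move=> n x _; rewrite lee_fin.
  - by move=> x _ m n mn; rewrite lee_fin; exact/lefP/nd_nnsfun_approx.
transitivity (limn (fun n => \int[leb]_(x in D) ((h n x)%:E * (g x)%:E)))%E; last first.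
  rewrite -monotone_convergence//.
  - apply: eq_integral => x /set_mem Dx; apply/cvg_lim => //.
    by apply: cvgeZr => //; exact: fE.
  - move=> n; apply: emeasurable_funM; apply/measurable_EFinP;
      apply: (measurable_funS measurableT) => //; exact/measurable_funP.
  - by move=> n x _; rewrite mule_ge0 ?lee_fin.
  - by move=> x _ m n mn; rewrite lee_wpmul2r ?lee_fin//; exact/lefP/nd_nnsfun_approx.
congr (limn _); apply/funext => n.
have mr r : measurable_fun D (fun x => (r * \1_(h n @^-1` [set r]) x)%:E).
  by apply/measurable_funTS/measurable_EFinP; exact: measurable_funM.
under eq_integral do rewrite fimfunE -fsumEFin//.
rewrite ge0_integral_fsum//; last by move=> m y Dy; exact: nnfun_muleindic_ge0.
under [RHS]eq_integral => x xD.
  rewrite fimfunE -fsumEFin// ge0_mule_fsuml; last by move=> y; exact: nnfun_muleindic_ge0.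
  over.
rewrite ge0_integral_fsum//; last 2 first.
- move=> y; apply: emeasurable_funM => //; exact/measurable_funTS/measurable_EFinP.
- by move=> m y Dy; rewrite mule_ge0 ?lee_fin// -lee_fin nnfun_muleindic_ge0.
apply: eq_fsbigr => r _.
have [r0|r0] := ltP r 0.
  rewrite preimage_nnfun0//; rewrite !integral0_eq// => x _; by rewrite indic0 mulr0 ?mul0e.
under eq_integral do rewrite EFinM.
under [RHS]eq_integral do rewrite EFinM -muleA.
have mi : measurable (h n @^-1` [set r]) by [].
have mi' : measurable_fun D (fun x => (\1_(h n @^-1` [set r]) x)%:E : \bar R).
  by apply/measurable_funTS/measurable_EFinP.
rewrite !ge0_integralZl//=; last 2 first.
- by apply: emeasurable_funM => //; exact/measurable_funTS/measurable_EFinP.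
- by move=> x _; rewrite mule_ge0 ?lee_fin.
congr (_ * _)%E; rewrite integral_indic//= /dens setIC integral_mkcondr.
apply: eq_integral => x _; rewrite patchE indicE.
by case: ifPn => _; rewrite ?mul1e ?mul0e.
Qed.

Lemma ge0_change_of_variables (a : R) (w : R -> R) :
  measurable_fun setT w -> (forall x, 0 <= w x) -> 0 <= a ->
  (\int[leb]_(y in `[0%R, cumul a]) (w (cinv y))%:E =
   \int[leb]_(x in `[0%R, a]) (w x * g x)%:E)%E.
Proof.
move=> mw w0 a0.
have mwc : measurable_fun setT (fun y => (w (cinv y))%:E : \bar R).
  by apply/measurable_EFinP; apply: measurableT_comp => //; exact: measurable_cinv.
have preim : cumul @^-1` `[0, cumul a] = `[0, a]%classic.
  apply/seteqP; split => x /=; by rewrite !in_itv/= -[0 <= x]cumul_le -[x <= a]cumul_le cumul0.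
transitivity (\int[pushforward dens (cumul : measurableTypeR R -> measurableTypeR R)]_(y in `[0%R, cumul a]) (w (cinv y))%:E)%E.
  apply: eq_measure_integral => [|mc A mA _]; [exact: measurable_cumul|exact: pushforward_dens].
rewrite ge0_integral_pushforward//=; last 3 first.
- exact: measurable_cumul.
- exact: measurable_funTS.
- by move=> y _; rewrite lee_fin.
rewrite preim; under eq_integral do rewrite /= cumulK.
by rewrite ge0_integral_dens//; apply/measurable_funTS/measurable_EFinP.
Qed.

Lemma integrable_mul (a b : R) (ba bb : bool) (w : R -> R) (B : R) :
  measurable_fun setT w -> (forall x, `|w x| <= B) ->
  (@lebesgue_measure R).-integrable [set` Interval (BSide ba a) (BSide bb b)]
     (EFin \o (fun x => w x * g x)).
Proof.
move=> mw wB; apply: (@bounded_integrable _ _ (B * C)); first exact: measurable_funM.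
move=> x; rewrite normrM ler_pM// ger0_norm//; by have /andP[] := g_bnd x.
Qed.

Lemma bounded_change_of_variables (a : R) (w : R -> R) (B : R) :
  measurable_fun setT w -> (forall x, `|w x| <= B) -> 0 <= a ->
  \int[leb]_(y in `[0%R, cumul a]) w (cinv y) =
  \int[leb]_(x in `[0%R, a]) (w x * g x).
Proof.
move=> mw wB a0.
have mwc : measurable_fun setT (fun y => w (cinv y)).
  by apply: measurableT_comp => //; exact: measurable_cinv.
have E1 : \int[leb]_(y in `[0%R, cumul a]) (w (cinv y) + B) =
  \int[leb]_(x in `[0%R, a]) ((w x + B) * g x).
  rewrite /Rintegral (@ge0_change_of_variables _ (fun x => w x + B))//.
    exact: measurable_funD.
  by move=> x; have := wB x; rewrite ler_norml => /andP[]; lra.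
have E2 : \int[leb]_(x in `[0%R, a]) ((w x + B) * g x) =
   \int[leb]_(x in `[0%R, a]) (w x * g x) + \int[leb]_(x in `[0%R, a]) (B * g x).
  under eq_Rintegral do rewrite mulrDl.
  rewrite RintegralD//; first exact: integrable_mul wB.
  exact: (@integrable_mul _ _ _ _ (fun=> B) `|B|).
have E3 : \int[leb]_(y in `[0%R, cumul a]) (w (cinv y) + B) =
  \int[leb]_(y in `[0%R, cumul a]) w (cinv y) + B * cumul a.
  rewrite RintegralD//.
  - congr (_ + _); rewrite Rintegral_cst//; congr (_ * _).
    rewrite /= lebesgue_measure_itv/= lte_fin.
    have : 0 <= cumul a by rewrite -cumul0 cumul_le.
    by rewrite le_eqVlt => /predU1P[<-|->]; rewrite ?ltxx//= subr0.
  - exact: (@bounded_integrable _ _ B).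
  - exact: (@bounded_integrable _ _ `|B|).
have E4 : \int[leb]_(x in `[0%R, a]) (B * g x) = B * cumul a.
  rewrite cumul_ge0// RintegralZl//; exact: integrable_itv_g.
by move: E1; rewrite E2 E3 E4 => /addIr.
Qed.

(** The left-hand integrand w o cinv is not assumed measurable: it is compared
    with its Borel version wh o cinv, and the exceptional set stays null because
    the pushforward of g dx by cumul is the Lebesgue measure. *)
Lemma change_of_variables (a : R) (w wh : R -> R) (B : R) :
  measurable_fun setT wh -> (forall x, `|wh x| <= B) -> 0 <= a ->
  {ae @lebesgue_measure R, forall x, `[0%R, a]%classic x -> wh x = w x} ->
  \int[leb]_(y in `[0%R, cumul a]) w (cinv y) =
  \int[leb]_(x in `[0%R, a]) (wh x * g x).
Proof.
move=> mw wB a0 [N [mN N0 Nw]]; rewrite -(bounded_change_of_variables mw wB a0).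
apply: ae_eq_Rintegral_any; exists (cinv @^-1` N); split.
- by rewrite -[X in measurable X]setTI; apply: measurable_cinv.
- apply: (etrans (pushforward_dens _)).
    by rewrite -[X in measurable X]setTI; apply: measurable_cinv.
  rewrite /pushforward -comp_preimage (_ : cinv \o cumul = id); last first.
    by apply/funext => x; exact: cumulK.
  rewrite preimage_id /dens null_set_integral//; exact/measurable_funTS/measurable_EFinP.
- move=> y /= h; apply: Nw => /= h'; apply: h.
  rewrite in_itv/= => /andP[y0 ya]; apply/esym/h'.
  by rewrite in_itv/= -[0 <= cinv y]cumul_le -[cinv y <= a]cumul_le cinvK cumul0 y0.
Qed.

End Cumulative.

(** * The kernel, its integrals and their derivatives *)

Section RealDerivatives.
Variable R : realType.
Implicit Types (f g : R -> R) (x a b : R).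

Lemma der_eq f x a b : is_derive x 1 f a -> a = b -> is_derive x 1 f b.
Proof. by move=> ? <-. Qed.

Lemma der_cst (k x : R) : is_derive x 1 (fun=> k) 0.
Proof. exact: is_derive_cst. Qed.

Lemma der_id (x : R) : is_derive x 1 (fun t => t) 1.
Proof. exact: is_derive_id. Qed.

Lemma derD f g x a b : is_derive x 1 f a -> is_derive x 1 g b ->
  is_derive x 1 (fun t => f t + g t) (a + b).
Proof. by move=> fa gb; apply: is_deriveD. Qed.

Lemma derN f x a : is_derive x 1 f a -> is_derive x 1 (fun t => - f t) (- a).
Proof. by move=> fa; apply: is_deriveN. Qed.

Lemma derB f g x a b : is_derive x 1 f a -> is_derive x 1 g b ->
  is_derive x 1 (fun t => f t - g t) (a - b).
Proof. by move=> fa gb; apply: derD => //; apply: derN. Qed.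

Lemma derM f g x a b : is_derive x 1 f a -> is_derive x 1 g b ->
  is_derive x 1 (fun t => f t * g t) (a * g x + f x * b).
Proof.
move=> fa gb; apply: (der_eq (is_deriveM fa gb)).
by rewrite /GRing.scale/= addrC; congr (_ + _); rewrite mulrC.
Qed.

Lemma derV f x a : is_derive x 1 f a -> f x != 0 ->
  is_derive x 1 (fun t => (f t)^-1) (- a / (f x) ^+ 2).
Proof.
move=> fa fx; apply: (der_eq (is_deriveV fx fa)).
by rewrite /GRing.scale/= mulNr mulrC mulNr.
Qed.

Lemma der_comp (f g : R -> R) x a b : is_derive (g x) 1 f a -> is_derive x 1 g b ->
  is_derive x 1 (fun t => f (g t)) (a * b).
Proof. exact: is_derive1_comp. Qed.

Lemma der_near f g x a : (\forall t \near x, f t = g t) ->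
  is_derive x 1 f a -> is_derive x 1 g a.
Proof.
move=> fg [df fa]; constructor.
  exact: near_eq_derivable df.
by rewrite -fa; apply: near_eq_derive; apply: filterS fg => ? ->.
Qed.

Lemma der_continuous f x a : is_derive x 1 f a -> {for x, continuous f}.
Proof. by move=> [df _]; apply/differentiable_continuous/derivable1_diffP. Qed.
End RealDerivatives.

Section Kernel.
Variables (R : realType) (lam m M : R).
Hypothesis lam_ge0 : 0 <= lam.
Hypothesis m_lt0 : m < 0.
Hypothesis M_gt0 : 0 < M.

(** With e the value of eta (and of t itself when lam = 0), jphi e (u0' a) is the
    unnormalised Jacobian gamma_a, and jrat e v is its logarithmic derivative in
    e. As jrat solves r' = lam r^2 for every lam >= 0, the two families of
    representation formulae are treated by the same computation. *)
Definition jphi (e v : R) : R :=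
  if lam == 0 then expR (e * v) else (1 - lam * e * v) `^ (- lam^-1).

Definition jrat (e v : R) : R := v / (1 - lam * e * v).

Definition jdom (e : R) : Prop := 0 < 1 - lam * e * M /\ 0 < 1 - lam * e * m.

Lemma jac_ge (k e v : R) : k <= 1 - lam * e * M -> k <= 1 - lam * e * m ->
  m <= v <= M -> k <= 1 - lam * e * v.
Proof.
move=> h1 h2 /andP[mv vM]; have [le0|le0] := leP 0 (lam * e).
  by have := ler_wpM2l le0 vM; lra.
by have := ler_wnM2l (ltW le0) mv; lra.
Qed.

Lemma jac_gt0 (e v : R) : jdom e -> m <= v <= M -> 0 < 1 - lam * e * v.
Proof.
move=> [h1 h2] hv; pose k : R := Num.min (1 - lam * e * M) (1 - lam * e * m).
have k0 : 0 < k by rewrite lt_min h1.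
by apply: lt_le_trans k0 (jac_ge _ _ hv); rewrite ge_min lexx ?orbT.
Qed.

Lemma der_jac (e v : R) : is_derive e 1 (fun e => 1 - lam * e * v) (- (lam * v)).
Proof.
have D := derB (der_cst 1 e) (derM (derM (der_cst lam e) (der_id e)) (der_cst v e)).
by apply: (der_eq D); rewrite /=; ring.
Qed.

Lemma der_jphi e v : jdom e -> m <= v <= M ->
  is_derive e 1 (jphi ^~ v) (jrat e v * jphi e v).
Proof.
move=> de hv; rewrite /jphi; case: ifPn => l0.
  have D := @der_comp _ expR (fun e => e * v) e _ _ (is_derive_expR _) (derM (der_id e) (der_cst v e)).
  by apply: (der_eq D); rewrite /jrat (eqP l0) /=; field.
have J0 := jac_gt0 de hv.
have D := @der_comp _ (@powR R ^~ (- lam^-1)) _ e _ _ (is_derive1_powR (- lam^-1) J0) (der_jac e v).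
apply: (der_eq D); rewrite powRB ?(gt_eqF J0) ?implybT// powRr1 ?ltW// /jrat; field.
by rewrite l0 gt_eqF.
Qed.

Lemma der_jrat e v : jdom e -> m <= v <= M ->
  is_derive e 1 (jrat ^~ v) (lam * jrat e v ^+ 2).
Proof.
move=> de hv; have J0 := jac_gt0 de hv.
have D := derM (der_cst v e) (derV (der_jac e v) (lt0r_neq0 J0)).
by apply: (der_eq D); rewrite /jrat /=; field; rewrite gt_eqF.
Qed.

(** Bounds that are uniform for e' near e and for all values v in [m, M] of the
    datum; they provide the domination needed to differentiate under the
    integral. *)
Lemma kernel_bounds e : jdom e -> exists c B d : R, [/\ 0 < c, 0 < d &
  forall e' v, `|e' - e| < d -> m <= v <= M ->
    [/\ jdom e', c <= jphi e' v <= B & `|jrat e' v| <= B]].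
Proof.
move=> de.
pose k : R := Num.min (1 - lam * e * M) (1 - lam * e * m) / 2.
have k0 : 0 < k by rewrite divr_gt0// lt_min; apply/andP.
have cont v : {for e, continuous (fun e => 1 - lam * e * v)}.
  exact: der_continuous (der_jac e v).
have kM : k < 1 - lam * e * M.
  by rewrite /k ltr_pdivrMr// gt_min; apply/orP; left; case: de => ? ?; lra.
have km : k < 1 - lam * e * m.
  by rewrite /k ltr_pdivrMr// gt_min; apply/orP; right; case: de => ? ?; lra.
have : \forall e' \near e, k < 1 - lam * e' * M /\ k < 1 - lam * e' * m.
  by apply: filterI; [apply: (cvgr_gt _ (cont M)) | apply: (cvgr_gt _ (cont m))].
move=> [d /= d0 hd].
(* Since |e' v| <= E V, the number K bounds 1 - lam e' v from above and k
   bounds it from below. *)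
pose V : R := M - m; pose E : R := `|e| + d; pose K : R := 1 + lam * E * V.
have V0 : 0 < V by rewrite subr_gt0 (lt_trans m_lt0).
have E0 : 0 < E by rewrite ltr_wpDl.
have K1 : 1 <= K by rewrite lerDl !mulr_ge0// ltW.
have vV v : m <= v <= M -> `|v| <= V by move: (m_lt0) (M_gt0); rewrite /V ler_norml => ? ? /andP[? ?]; lra.
pose c := Num.min (expR (- (E * V))) (expR (- lam^-1 * ln K)).
pose B := expR (E * V) + expR (- lam^-1 * ln k) + V / k.
exists c, B, d; split => //; first by rewrite lt_min !expR_gt0.
move=> e' v ee hv.
have [h1 h2] : k < 1 - lam * e' * M /\ k < 1 - lam * e' * m by apply: hd; rewrite /= distrC.
have de' : jdom e' by split; apply: lt_trans k0 _.
have kJ : k <= 1 - lam * e' * v by apply: jac_ge => //; exact: ltW.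
have J0 := jac_gt0 de' hv.
have eE : `|e'| <= E.
  by rewrite -(subrK e e') (le_trans (ler_normD _ _))// addrC /E lerD2l ltW.
have evEV : `|e' * v| <= E * V by rewrite normrM ler_pM// vV.
have JK : 1 - lam * e' * v <= K.
  rewrite lerD2l -mulrA -mulrN -mulrA ler_wpM2l//.
  by apply: le_trans evEV; rewrite -normrN ler_norm.
have Vk : 0 < V / k by rewrite divr_gt0.
split => //.
  have -> : jphi e' v = expR (if lam == 0 then e' * v else - lam^-1 * ln (1 - lam * e' * v)).
    by rewrite /jphi; case: ifP => // _; rewrite /powR gt_eqF.
  move: evEV; rewrite ler_norml => /andP[ev1 ev2].
  have P1 := expR_gt0 (E * V); have P2 := expR_gt0 (- lam^-1 * ln k).
  rewrite /c ge_min !ler_expR; case: ifPn => l0.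
    rewrite ev1 /=; apply: (@le_trans _ _ (expR (E * V))); first by rewrite ler_expR.
    by rewrite /B; lra.
  have li : 0 < lam^-1 by rewrite invr_gt0 lt_def l0.
  have L x y : 0 < x -> x <= y -> - lam^-1 * ln y <= - lam^-1 * ln x.
    move=> x0 xy; rewrite !mulNr lerN2 ler_pM2l// ler_ln ?posrE//.
    exact: lt_le_trans xy.
  rewrite [X in _ || X]L// orbT/=.
  apply: (@le_trans _ _ (expR (- lam^-1 * ln k))); last by rewrite /B; lra.
  by rewrite ler_expR L.
rewrite /jrat normrM normfV (gtr0_norm J0).
apply: (@le_trans _ _ (V / k)).
  by rewrite ler_pM ?invr_ge0 ?vV ?(ltW J0)// lef_pV2 ?posrE.
by rewrite /B lerDr addr_ge0// ltW// expR_gt0.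
Qed.

End Kernel.

Lemma der_under_integral (R : realType) (m M : R) (h : R -> R) (P P' : R -> R -> R)
    (e0 d B a : R) :
  0 < d -> (forall x, m <= h x <= M) ->
  (forall e, `|e - e0| < d -> measurable_fun setT (fun x => P e (h x))) ->
  (forall e v, `|e - e0| < d -> m <= v <= M ->
     [/\ is_derive e 1 (P ^~ v) (P' e v), `|P e v| <= B & `|P' e v| <= B]) ->
  is_derive e0 1 (fun e => \int[leb]_(x in `[0%R, a]) P e (h x))
    (\int[leb]_(x in `[0%R, a]) P' e0 (h x)).
Proof.
move=> d0 hmM mP hP.
have ball0 : `|e0 - e0| < d by rewrite subrr normr0.
have B0 : 0 <= B.
  by have [_ _ h2] := hP e0 (h 0) ball0 (hmM 0); apply: le_trans h2.
pose f e x := P e (h x).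
have I x : `]e0 - d, e0 + d[%classic x -> `|x - e0| < d.
  by rewrite /= in_itv/= ltr_distl.
have Ie0 : `]e0 - d, e0 + d[%classic e0.
  by rewrite /= in_itv/= ltrBlDr ltrDl d0.
have mI : measurable (`[0, a]%classic : set (measurableTypeR R)) by [].
have intf x : `]e0 - d, e0 + d[%classic x ->
    (@lebesgue_measure R).-integrable `[0, a] (EFin \o f x).
  move=> /I xd; apply: (@bounded_integrable _ _ B); first exact: mP.
  by move=> y; have [] := hP x (h y) xd (hmM y).
have derf x y : `]e0 - d, e0 + d[%classic x -> `[0, a]%classic y -> derivable (f ^~ y) x 1.
  by move=> /I xd _; have [[]] := hP x (h y) xd (hmM y).
have d1E x y : `|x - e0| < d -> partial1of2 f x y = P' x (h y).
  by move=> xd; rewrite partial1of2E; have [[_ <-]] := hP x (h y) xd (hmM y).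
have intG : (@lebesgue_measure R).-integrable `[0, a] (EFin \o (fun=> B)).
  by apply: (@bounded_integrable _ _ `|B|).
have Gub x y : `]e0 - d, e0 + d[%classic x -> `[0, a]%classic y -> `|partial1of2 f x y| <= B.
  by move=> /I xd _; rewrite d1E//; have [] := hP x (h y) xd (hmM y).
split.
  exact: (@derivable_under_integral R _ _ lebesgue_measure f _ mI e0 _ _ Ie0 intf derf (fun=> B) (fun=> B0) intG Gub).
rewrite -derive1E (@differentiation_under_integral R _ _ lebesgue_measure f _ mI e0 _ _ Ie0 intf derf (fun=> B) (fun=> B0) intG Gub).
by apply: eq_Rintegral => x _; rewrite d1E.
Qed.

Section KernelIntegrals.
Variables (R : realType) (lam m M : R) (h : R -> R).
Hypothesis lam_ge0 : 0 <= lam.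
Hypothesis m_lt0 : m < 0.
Hypothesis M_gt0 : 0 < M.
Hypothesis mh : measurable_fun setT h.
Hypothesis hmM : forall x, m <= h x <= M.

Local Notation phi := (jphi lam).
Local Notation rr := (jrat lam).
Local Notation dom := (jdom lam m M).

Lemma measurable_jphi e : measurable_fun setT (fun x => phi e (h x)).
Proof.
rewrite /jphi; case: (lam == 0).
  apply: measurableT_comp; first exact: measurable_expR.
  exact: measurable_funM.
have := @measurable_powR R (- lam^-1) => mp.
apply: (measurableT_comp mp).
by apply: measurable_funB => //; exact: measurable_funM.
Qed.

Lemma measurable_jrat e : dom e -> measurable_fun setT (fun x => rr e (h x)).
Proof.
move=> de.
(* The inverse is written as a power, whose measurability is available on the
   whole line. *)
rewrite (_ : (fun x => _) = (fun x => h x * (1 - lam * e * h x) `^ (-1))); last first.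
  by apply/funext => x; rewrite powR_inv1// ltW// (jac_gt0 de).
apply: measurable_funM => //; apply: (measurableT_comp (measurable_powR _)).
by apply: measurable_funB => //; exact: measurable_funM.
Qed.

(** Each of these is the derivative in e of the preceding one; the factor lam + 1
    in the last comes from (jrat jphi)' = lam jrat^2 jphi + jrat^2 jphi. *)
Definition kint0 (a e : R) : R := \int[leb]_(x in `[0%R, a]) phi e (h x).
Definition kint1 (a e : R) : R :=
  \int[leb]_(x in `[0%R, a]) (rr e (h x) * phi e (h x)).
Definition kint2 (a e : R) : R :=
  \int[leb]_(x in `[0%R, a]) ((lam + 1) * (rr e (h x) ^+ 2 * phi e (h x))).

Lemma der_kint0 a e : dom e -> is_derive e 1 (kint0 a) (kint1 a e).
Proof.
move=> de; have [c [B [d [c0 d0 hB]]]] := kernel_bounds lam_ge0 m_lt0 M_gt0 de.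
apply: (@der_under_integral R m M h phi (fun e v => rr e v * phi e v) e d (B + B * B)) => //.
  by move=> e' _; exact: measurable_jphi.
move=> e' v ed hv; have [de' /andP[h1 h2] h3] := hB e' v ed hv.
have h4 : `|phi e' v| <= B by rewrite ger0_norm// (le_trans (ltW c0) h1).
have B0 : 0 <= B by apply: le_trans h3.
split.
- exact: (der_jphi de').
- by apply: (le_trans h4); rewrite lerDl mulr_ge0.
- by rewrite normrM (@le_trans _ _ (B * B)) ?ler_pM// lerDr.
Qed.

Lemma der_kint1 a e : dom e -> is_derive e 1 (kint1 a) (kint2 a e).
Proof.
move=> de; have [c [B [d [c0 d0 hB]]]] := kernel_bounds lam_ge0 m_lt0 M_gt0 de.
apply: (@der_under_integral R m M h (fun e v => rr e v * phi e v)
   (fun e v => (lam + 1) * (rr e v ^+ 2 * phi e v)) e d (B * B + (lam + 1) * (B ^+ 2 * B))) => //.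
  move=> e' ed; have [de' _ _] := hB e' (h 0) ed (hmM 0).
  by apply: measurable_funM; [exact: measurable_jrat|exact: measurable_jphi].
move=> e' v ed hv; have [de' /andP[h1 h2] h3] := hB e' v ed hv.
have h4 : `|phi e' v| <= B by rewrite ger0_norm// (le_trans (ltW c0) h1).
have B0 : 0 <= B by apply: le_trans h3.
have l1 : 0 <= lam + 1 by rewrite addr_ge0.
split.
- have D := derM (der_jrat de' hv) (der_jphi de' hv).
  by apply: (der_eq D); ring.
- by rewrite normrM (@le_trans _ _ (B * B)) ?ler_pM// lerDl !mulr_ge0// exprn_ge0.
- rewrite normrM (ger0_norm l1) normrM normrX (@le_trans _ _ ((lam + 1) * (B ^+ 2 * B)))//.
    by rewrite ler_pM ?mulr_ge0 ?exprn_ge0// ler_pM ?exprn_ge0// lerXn2r ?nnegrE.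
  by rewrite lerDr mulr_ge0.
Qed.

Lemma jdom0 : dom 0.
Proof. by rewrite /jdom !mulr0 !mul0r subr0. Qed.

Lemma kint0_gt0 a e : 0 < a -> dom e -> 0 < kint0 a e.
Proof.
move=> a0 de; have [c [B [d [c0 d0 hB]]]] := kernel_bounds lam_ge0 m_lt0 M_gt0 de.
have ed : `|e - e| < d by rewrite subrr normr0.
have H x := hB e (h x) ed (hmM x).
have H1 x : c <= phi e (h x) <= B by have [] := H x.
have := cumul_lt (measurable_jphi e) c0 H1 0 a.
by rewrite a0 cumul0 (cumul_ge0 (measurable_jphi e) c0 H1 (ltW a0)) => ->.
Qed.

Lemma kint0_at0 a : 0 <= a -> kint0 a 0 = a.
Proof.
move=> a0; rewrite (_ : kint0 a 0 = \int[leb]_(x in `[0%R, a]) 1); last first.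
  apply: eq_Rintegral => x _; rewrite /jphi; case: ifP => _.
    by rewrite mul0r expR0.
  by rewrite mulr0 mul0r subr0 powR1.
rewrite Rintegral_cst// mul1r /= lebesgue_measure_itv/= lte_fin.
by move: a0; rewrite le_eqVlt => /predU1P[<-|->]; rewrite ?ltxx//= subr0.
Qed.

Lemma kint1_at0 a : kint1 a 0 = \int[leb]_(x in `[0%R, a]) h x.
Proof.
apply: eq_Rintegral => x _; rewrite /jphi /jrat; case: ifP => _.
  by rewrite mul0r expR0 mulr0 mul0r subr0 divr1 mulr1.
by rewrite mulr0 mul0r subr0 powR1 divr1 mulr1.
Qed.

End KernelIntegrals.

Section KernelIntegralsLinear.
Variables (R : realType) (lam m M : R) (h : R -> R).
Hypothesis lam_ge0 : 0 <= lam.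
Hypothesis m_lt0 : m < 0.
Hypothesis M_gt0 : 0 < M.
Hypothesis mh : measurable_fun setT h.
Hypothesis hmM : forall x, m <= h x <= M.

Local Notation phi := (jphi lam).
Local Notation rr := (jrat lam).
Local Notation dom := (jdom lam m M).
Local Notation F0 := (kint0 lam h).
Local Notation F1 := (kint1 lam h).
Local Notation F2 := (kint2 lam h).

Lemma kernel_bounds_at e : dom e -> exists c B : R, [/\ 0 < c, 0 <= B,
  forall x, c <= phi e (h x) <= B & forall x, `|rr e (h x)| <= B].
Proof.
move=> de; have [c [B [d [c0 d0 hB]]]] := kernel_bounds lam_ge0 m_lt0 M_gt0 de.
have ed : `|e - e| < d by rewrite subrr normr0.
have H x := hB e (h x) ed (hmM x).
exists c, B; split => //; try by move=> x; have [] := H x.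
by have [_ _] := H 0; apply: le_trans.
Qed.

Lemma int_kernel e a (n : nat) : dom e ->
  (@lebesgue_measure R).-integrable `[0%R, a] (EFin \o (fun x => rr e (h x) ^+ n * phi e (h x))).
Proof.
move=> de; have [c [B [c0 B0 h1 h2]]] := kernel_bounds_at de.
apply: (@bounded_integrable _ _ (B ^+ n * B)).
  apply: measurable_funM; last exact: measurable_jphi.
  by apply: measurable_funX; exact: (measurable_jrat mh hmM de).
move=> x; rewrite normrM normrX ler_pM ?exprn_ge0//.
  by rewrite lerXn2r ?nnegrE.
by have /andP[? ?] := h1 x; rewrite ger0_norm// (le_trans (ltW c0)).
Qed.

Lemma int_kernelZ e a (n : nat) (k : R) : dom e ->
  (@lebesgue_measure R).-integrable `[0%R, a] (EFin \o (fun x => k * (rr e (h x) ^+ n * phi e (h x)))).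
Proof.
move=> de; have := integrableZl _ k (int_kernel a n de).
by move=> /(_ _) H; apply: H.
Qed.

Lemma integral_linear e a p q : dom e ->
  \int[leb]_(x in `[0%R, a]) ((p * rr e (h x) + q) * phi e (h x)) =
  p * F1 a e + q * F0 a e.
Proof.
move=> de.
transitivity (\int[leb]_(x in `[0%R, a]) (p * (rr e (h x) ^+ 1 * phi e (h x)) + q * (rr e (h x) ^+ 0 * phi e (h x)))).
  by apply: eq_Rintegral => x _; ring.
rewrite RintegralD//; [|exact: int_kernelZ..].
rewrite RintegralZl//; last exact: int_kernel.
rewrite RintegralZl//; last exact: int_kernel.
by congr (_ * _ + _ * _);
  apply: eq_Rintegral => x _; rewrite ?expr1 ?expr0 ?mul1r.
Qed.

(** The mean of u_x^2 is the mean of such a square, which is how the second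
    derivative kint2 of the normalising integral enters the equation. *)
Lemma integral_square e a p q : dom e ->
  (lam + 1) * \int[leb]_(x in `[0%R, a]) ((p * rr e (h x) + q) ^+ 2 * phi e (h x)) =
  p ^+ 2 * F2 a e + (lam + 1) * (2 * p * q * F1 a e + q ^+ 2 * F0 a e).
Proof.
move=> de.
transitivity ((lam + 1) * \int[leb]_(x in `[0%R, a]) (p ^+ 2 * (rr e (h x) ^+ 2 * phi e (h x)) +
    (p * (2 * q) * rr e (h x) + q ^+ 2) * phi e (h x))).
  by congr (_ * _); apply: eq_Rintegral => x _; ring.
rewrite RintegralD//; last 2 first.
- exact: int_kernelZ.
- rewrite (_ : (fun x => _) = (fun x => (p * (2 * q)) * (rr e (h x) ^+ 1 * phi e (h x)) +
     q ^+ 2 * (rr e (h x) ^+ 0 * phi e (h x)))); last first.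
    by apply/funext => x; ring.
  by have := integrableD _ (int_kernelZ a 1 (p * (2 * q)) de) (int_kernelZ a 0 (q ^+ 2) de); apply.
rewrite integral_linear// RintegralZl//; last exact: int_kernel.
by rewrite /kint2 RintegralZl//; [ring|exact: int_kernel].
Qed.

End KernelIntegralsLinear.

(** * The flow defined by the representation formulae *)

Section FractionalPart.
Variable R : realType.
Implicit Type x : R.

Definition ipart (x : R) : R := (Num.floor x)%:~R.
Definition fpart (x : R) : R := x - ipart x.

Lemma fpart_bnd x : 0 <= fpart x < 1.
Proof.
have /andP[h1 h2] := floor_itv x; rewrite /fpart /ipart subr_ge0 h1/= ltrBlDl.
by rewrite intrD in h2.
Qed.

Lemma ipart_fpart x : ipart x + fpart x = x.
Proof. by rewrite /fpart subrKC. Qed.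

Lemma ipart_add (n : int) r : 0 <= r < 1 -> ipart (n%:~R + r) = n%:~R.
Proof.
move=> /andP[r0 r1]; congr (_%:~R); apply: floor_def.
by rewrite lerDl r0 intrD ltrD2l.
Qed.

Lemma fpart_add (n : int) r : 0 <= r < 1 -> fpart (n%:~R + r) = r.
Proof. by move=> r01; rewrite /fpart ipart_add// addrC addKr. Qed.

Lemma ipartE x r : 0 <= r < 1 -> ipart (ipart x + r) = ipart x.
Proof. exact: ipart_add. Qed.

Lemma fpartE x r : 0 <= r < 1 -> fpart (ipart x + r) = r.
Proof. exact: fpart_add. Qed.

Lemma ipartD1 x : ipart (x + 1) = ipart x + 1.
Proof.
have -> : x + 1 = (Num.floor x + 1)%:~R + fpart x.
  by rewrite intrD -{1}(ipart_fpart x) /ipart; ring.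
by rewrite ipart_add ?fpart_bnd// intrD.
Qed.

Lemma fpartD1 x : fpart (x + 1) = fpart x.
Proof. by rewrite /fpart ipartD1; ring. Qed.

Lemma fpart_id x : 0 <= x < 1 -> fpart x = x.
Proof. by move=> hx; have := fpart_add 0 hx; rewrite add0r. Qed.

Lemma ipart0 x : 0 <= x < 1 -> ipart x = 0.
Proof. by move=> hx; have := ipart_add 0 hx; rewrite add0r. Qed.

Lemma fpart0 : fpart 0 = 0 :> R.
Proof. by rewrite fpart_id// lexx ltr01. Qed.

Lemma fpart1 : fpart 1 = 0 :> R.
Proof. by rewrite -[1]add0r fpartD1 fpart_id// lexx ltr01. Qed.

Lemma ipart1 : ipart 1 = 1 :> R.
Proof. by rewrite -[1]add0r ipartD1 ipart0 ?add0r// lexx ltr01. Qed.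

Lemma periodic_add_int (f : R -> R) : (forall x, f (x + 1) = f x) ->
  forall (n : int) x, f (n%:~R + x) = f x.
Proof.
move=> f1; have fn (n : nat) x : f (n%:R + x) = f x.
  elim: n => [|n IH]; first by rewrite add0r.
  by rewrite -natr1 addrAC f1.
case=> n x; first exact: fn.
by rewrite NegzE mulrNz -(fn n.+1 (_ + _)); congr f; rewrite -pmulrn; ring.
Qed.

Lemma periodic_fpart (f : R -> R) : (forall x, f (x + 1) = f x) ->
  forall x, f (fpart x) = f x.
Proof. by move=> f1 x; rewrite -{2}(ipart_fpart x) /ipart periodic_add_int. Qed.
End FractionalPart.

Lemma near_lt_ereal (R : realType) (T : \bar R) (t : R) : 0 < t -> (t%:E < T)%E ->
  \forall s \near t, 0 < s /\ (s%:E < T)%E.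
Proof.
move=> t0 tT; apply: filterI; first exact: lt_nbhsr.
move: T tT => [r| |]//; last by move=> _; near=> s; rewrite ltry.
rewrite lte_fin => tr; near=> s; rewrite lte_fin; near: s.
exact: lt_nbhsl.
Unshelve. all: by end_near. Qed.

Lemma near_right_lt_ereal (R : realType) (T : \bar R) : (0 < T)%E ->
  \forall s \near (0 : R)^'+, (s%:E < T)%E.
Proof.
move: T => [r| |]//; last by move=> _; near=> s; rewrite ltry.
rewrite lte_fin => tr; near=> s; rewrite lte_fin; near: s.
exact: nbhs_right_lt.
Unshelve. all: by end_near. Qed.

Lemma Rintegral_itv0 (R : realType) (f : R -> R) (a : R) : \int[leb]_(x in `[a, a]) f x = 0.
Proof. by rewrite set_itv1 Rintegral_set1. Qed.

Section FlowConstruction.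
Variables (R : realType) (lam m M : R) (u0 du0 h eta : R -> R) (T : \bar R).
Hypothesis lam_ge0 : 0 <= lam.
Hypothesis m_lt0 : m < 0.
Hypothesis M_gt0 : 0 < M.
Hypothesis mh : measurable_fun setT h.
Hypothesis hmM : forall x, m <= h x <= M.
Hypothesis du0mM : forall x, m <= du0 x <= M.
Hypothesis hdu0 : {ae (@lebesgue_measure R), forall x, `[0%R, 1%R]%classic x -> h x = du0 x}.
Hypothesis u0_per : forall x, u0 (x + 1) = u0 x.
Hypothesis du0_per : forall x, du0 (x + 1) = du0 x.
Hypothesis u0_prim : primitive01 u0 du0.

Local Notation phi := (jphi lam).
Local Notation rr := (jrat lam).
Local Notation dom := (jdom lam m M).
Local Notation F0 := (kint0 lam h).
Local Notation F1 := (kint1 lam h).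
Local Notation F2 := (kint2 lam h).
Local Notation K := (kint0 lam h 1).
Local Notation L := (fun e => kint1 lam h 1 e / kint0 lam h 1 e).

Hypothesis T_gt0 : (0 < T)%E.
Hypothesis eta0 : eta 0 = 0.
Hypothesis eta_dom : forall t, 0 <= t -> (t%:E < T)%E -> dom (eta t).
Hypothesis eta_evolves : evolves T eta (fun t => K (eta t) `^ (- (2 * lam))).

(** flow_strain du0 (eta t) a is u_x at time t on the characteristic starting at
    a. On each unit cell the flow map is the cumulative function of
    flow_density, so its inverse flow_label exists and u_x is determined as a
    function of space. The velocity is pinned down by u(0, t) = 0 for t > 0,
    which makes integers fixed points of the flow. *)
Definition flow_scale (e : R) : R := K e `^ (- (2 * lam)).
Definition flow_density (e x : R) : R := phi e (h x) / K e.
Definition flow_strain (v : R -> R) (e x : R) : R := flow_scale e * (rr e (v x) - L e).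
Definition flow_char (a t : R) : R := ipart a + F0 (fpart a) (eta t) / K (eta t).
Definition flow_label (x t : R) : R := ipart x + cinv (flow_density (eta t)) (fpart x).
Definition flow_ux (x t : R) : R := flow_strain du0 (eta t) (flow_label x t).
Definition flow_u (x t : R) : R :=
  if t == 0 then u0 x else \int[leb]_(y in `[0%R, fpart x]) flow_ux y t.

Lemma K_gt0 e : dom e -> 0 < K e.
Proof. by move=> de; exact: (kint0_gt0 lam_ge0 m_lt0 M_gt0 mh hmM ltr01 de). Qed.

Lemma flow_density_bounds e : dom e -> exists c C : R, 0 < c /\ forall x, c <= flow_density e x <= C.
Proof.
move=> de; have [c [B [c0 B0 h1 h2]]] := kernel_bounds_at lam_ge0 m_lt0 M_gt0 hmM de.
exists (c / K e), (B / K e); split; first by rewrite divr_gt0// K_gt0.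
by move=> x; rewrite /flow_density !ler_pM2r ?invr_gt0 ?K_gt0.
Qed.

Lemma measurable_flow_density e : measurable_fun setT (flow_density e).
Proof.
by apply: measurable_funM => //; exact: measurable_jphi.
Qed.

Lemma cumul_flow_density a e : dom e -> 0 <= a -> cumul (flow_density e) a = F0 a e / K e.
Proof.
move=> de a0; have [c [C [c0 hC]]] := flow_density_bounds de.
rewrite (cumul_ge0 (measurable_flow_density e) c0 hC a0) /flow_density.
have := @integral_linear _ lam m M h lam_ge0 m_lt0 M_gt0 mh hmM e a 0 ((K e)^-1) de.
rewrite mul0r add0r [RHS]mulrC => <-.
by apply: eq_Rintegral => x _; rewrite mul0r add0r mulrC.
Qed.

Lemma cumul_flow_density1 e : dom e -> cumul (flow_density e) 1 = 1.
Proof. by move=> de; rewrite cumul_flow_density// divff// gt_eqF// K_gt0. Qed.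

Lemma flow_density_int_strain e a : dom e ->
  \int[leb]_(x in `[0%R, a]) (flow_strain h e x * flow_density e x) =
  flow_scale e * (F1 a e / K e - L e * (F0 a e / K e)).
Proof.
move=> de.
have := @integral_linear _ lam m M h lam_ge0 m_lt0 M_gt0 mh hmM e a (flow_scale e / K e) (- flow_scale e * L e / K e) de.
set I := (X in X = _ -> _) => E.
transitivity I; first by apply: eq_Rintegral => x _; rewrite /flow_strain /flow_density; ring.
by rewrite E; ring.
Qed.

Lemma flow_density_int_strain_sq e : dom e ->
  (lam + 1) * \int[leb]_(x in `[0%R, 1%R]) (flow_strain h e x ^+ 2 * flow_density e x) =
  flow_scale e ^+ 2 * (F2 1 e / K e - (lam + 1) * L e ^+ 2).
Proof.
move=> de; have K0 := K_gt0 de.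
have E : \int[leb]_(x in `[0%R, 1%R]) (flow_strain h e x ^+ 2 * flow_density e x) =
   (K e)^-1 * \int[leb]_(x in `[0%R, 1%R]) ((flow_scale e * rr e (h x) + - (flow_scale e * L e)) ^+ 2 * phi e (h x)).
  rewrite -RintegralZl//; last first.
    have [c [B [c0 B0 h1 h2]]] := kernel_bounds_at lam_ge0 m_lt0 M_gt0 hmM de.
    apply: (@bounded_integrable _ _ ((`|flow_scale e| * B + `|flow_scale e * L e|) ^+ 2 * B)).
      apply: measurable_funM; last exact: measurable_jphi.
      apply: measurable_funX; apply: measurable_funD => //.
      by apply: measurable_funM => //; exact: (measurable_jrat mh hmM de).
    move=> x; rewrite normrM normrX ler_pM ?exprn_ge0//.
      rewrite lerXn2r ?nnegrE ?addr_ge0 ?mulr_ge0//.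
      by rewrite (le_trans (ler_normD _ _))// normrN lerD2r normrM ler_wpM2l.
    by have /andP[? ?] := h1 x; rewrite ger0_norm// (le_trans (ltW c0)).
  by apply: eq_Rintegral => x _; rewrite /flow_strain /flow_density; ring.
rewrite E mulrCA (integral_square lam_ge0 m_lt0 M_gt0 mh hmM _ _ _ de).
by field; rewrite gt_eqF.
Qed.

Lemma flow_scale_ge0 e : 0 <= flow_scale e. Proof. exact: powR_ge0. Qed.

Lemma flow_strain_bounded e (v : R -> R) : dom e -> (forall x, m <= v x <= M) ->
  exists B : R, forall x, `|flow_strain v e x| <= B.
Proof.
move=> de vmM; have [c [B [d [c0 d0 hB]]]] := kernel_bounds lam_ge0 m_lt0 M_gt0 de.
have ed : `|e - e| < d by rewrite subrr normr0.
exists (flow_scale e * (B + `|L e|)) => x; have [_ _ h1] := hB e (v x) ed (vmM x).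
rewrite normrM (ger0_norm (flow_scale_ge0 e)) ler_wpM2l ?flow_scale_ge0//.
by rewrite (le_trans (ler_normB _ _))// lerD2r.
Qed.

Lemma measurable_flow_strain e : dom e -> measurable_fun setT (flow_strain h e).
Proof.
move=> de; apply: measurable_funM => //; apply: measurable_funB => //.
exact: (measurable_jrat mh hmM de).
Qed.

Lemma ae_flow_strain e a : a <= 1 -> {ae (@lebesgue_measure R), forall x,
  `[0%R, a]%classic x -> flow_strain h e x = flow_strain du0 e x}.
Proof.
move=> a1; have FF := ae_filter_ringOfSetsType (@lebesgue_measure R).
apply: filterS hdu0 => x hx; rewrite /= in_itv/= => /andP[x0 xa].
by rewrite /flow_strain hx//= in_itv/= x0 (le_trans xa).
Qed.

Lemma cinv_flow_density0 e : dom e -> cinv (flow_density e) 0 = 0.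
Proof.
move=> de; have [c [C [c0 hC]]] := flow_density_bounds de.
by rewrite -{1}(cumul0 (flow_density e)) (cumulK (measurable_flow_density e) c0 hC).
Qed.

Lemma cinv_flow_density1 e : dom e -> cinv (flow_density e) 1 = 1.
Proof.
move=> de; have [c [C [c0 hC]]] := flow_density_bounds de.
by rewrite -{1}(cumul_flow_density1 de) (cumulK (measurable_flow_density e) c0 hC).
Qed.

Lemma cinv_flow_density_itv e x : dom e -> 0 <= x <= 1 -> 0 <= cinv (flow_density e) x <= 1.
Proof.
move=> de /andP[x0 x1]; have [c [C [c0 hC]]] := flow_density_bounds de.
have le := cinv_le (measurable_flow_density e) c0 hC.
have := le 0 x; rewrite cinv_flow_density0// x0 => ->.
by have := le x 1; rewrite cinv_flow_density1// x1 => ->.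
Qed.

Lemma flow_label_unit x t : dom (eta t) -> 0 <= x <= 1 ->
  flow_label x t = cinv (flow_density (eta t)) x.
Proof.
move=> de /andP[x0]; rewrite le_eqVlt => /predU1P[->|x1].
  by rewrite /flow_label ipart1 fpart1 cinv_flow_density0// cinv_flow_density1// addr0.
by rewrite /flow_label ipart0 ?fpart_id ?x0// add0r.
Qed.

Lemma char_fpart_bnd a t : dom (eta t) -> 0 <= F0 (fpart a) (eta t) / K (eta t) < 1.
Proof.
move=> de; have [c [C [c0 hC]]] := flow_density_bounds de.
have /andP[f0 f1] := fpart_bnd a.
rewrite -cumul_flow_density//.
have := cumul_le (measurable_flow_density _) c0 hC 0 (fpart a); rewrite cumul0 f0 => ->.
by have := cumul_lt (measurable_flow_density _) c0 hC (fpart a) 1; rewrite cumul_flow_density1// f1 => ->.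
Qed.

Lemma flow_labelK a t : dom (eta t) -> flow_label (flow_char a t) t = a.
Proof.
move=> de; have [c [C [c0 hC]]] := flow_density_bounds de.
have /andP[f0 f1] := fpart_bnd a.
rewrite /flow_label /flow_char ipartE ?char_fpart_bnd// fpartE ?char_fpart_bnd//.
by rewrite -cumul_flow_density// (cumulK (measurable_flow_density _) c0 hC) ipart_fpart.
Qed.

Lemma flow_ux_char a t : dom (eta t) -> flow_ux (flow_char a t) t = flow_strain du0 (eta t) a.
Proof. by move=> de; rewrite /flow_ux flow_labelK. Qed.

(** The change of variables y = gamma(a, t) turns a spatial integral of u_x into
    an integral over labels, where the kernel integrals evaluate it. *)
Lemma flow_ux_integral (x t : R) : dom (eta t) -> 0 <= x <= 1 ->
  let a := cinv (flow_density (eta t)) x in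
  \int[leb]_(y in `[0%R, x]) flow_ux y t =
  flow_scale (eta t) * (F1 a (eta t) / K (eta t) - L (eta t) * (F0 a (eta t) / K (eta t))).
Proof.
move=> de x01 a; have [c [C [c0 hC]]] := flow_density_bounds de.
have /andP[a0 a1] : 0 <= a <= 1 by exact: cinv_flow_density_itv.
have [B hB] := flow_strain_bounded de hmM.
rewrite -(flow_density_int_strain a de).
rewrite -(change_of_variables (measurable_flow_density _) c0 hC (measurable_flow_strain de) hB a0 (ae_flow_strain _ a1)).
rewrite /a (cinvK (measurable_flow_density _) c0 hC); apply: eq_Rintegral => y.
rewrite inE/= in_itv/= => /andP[y0 yx].
rewrite /flow_ux flow_label_unit// y0 (le_trans yx)//.
by case/andP: x01.
Qed.

Lemma flow_ux_sq_integral (t : R) : dom (eta t) ->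
  (lam + 1) * \int[leb]_(y in `[0%R, 1%R]) (flow_ux y t ^+ 2) =
  flow_scale (eta t) ^+ 2 * (F2 1 (eta t) / K (eta t) - (lam + 1) * L (eta t) ^+ 2).
Proof.
move=> de; have [c [C [c0 hC]]] := flow_density_bounds de.
have [B hB] := flow_strain_bounded de hmM.
rewrite -(flow_density_int_strain_sq de); congr (_ * _).
have hB2 x : `|flow_strain h (eta t) x ^+ 2| <= B ^+ 2.
  rewrite normrX lerXn2r ?nnegrE// (le_trans _ (hB 0))//.
have ae2 : {ae (@lebesgue_measure R), forall x,
    `[0%R, 1%R]%classic x -> flow_strain h (eta t) x ^+ 2 = flow_strain du0 (eta t) x ^+ 2}.
  have FF := ae_filter_ringOfSetsType (@lebesgue_measure R).
  by apply: filterS (ae_flow_strain (eta t) (lexx 1)) => x hx x01; rewrite hx.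
have m2 : measurable_fun setT (fun x => flow_strain h (eta t) x ^+ 2).
  by apply: measurable_funX; exact: measurable_flow_strain.
rewrite -(change_of_variables (measurable_flow_density _) c0 hC m2 hB2 ler01 ae2).
rewrite (cumul_flow_density1 de); apply: eq_Rintegral => y.
by rewrite inE/= in_itv/= => y01; rewrite /flow_ux flow_label_unit.
Qed.

Lemma K_at0 : K 0 = 1. Proof. by rewrite kint0_at0. Qed.

(** This is the zero mean of u0', a consequence of the periodicity of u0. *)
Lemma L_at0 : L 0 = 0.
Proof.
rewrite /= kint1_at0 (_ : \int[leb]_(x in `[0%R, 1%R]) h x = 0) ?mul0r//.
rewrite (ae_eq_Rintegral_any hdu0).
have := u0_prim (x := 1); rewrite ler01 lexx => /(_ isT).
have -> : u0 1 = u0 0 by rewrite -[1]add0r u0_per.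
by rewrite -{1}[u0 0]addr0 => /addrI/esym.
Qed.

Lemma flow_strain_at0 a : flow_strain du0 0 a = du0 a.
Proof.
rewrite /flow_strain L_at0 /flow_scale K_at0 powR1 mul1r subr0 /jrat.
by rewrite mulr0 mul0r subr0 divr1.
Qed.

Lemma flow_char_at0 a : flow_char a 0 = a.
Proof.
by rewrite /flow_char eta0 K_at0 divr1 kint0_at0 ?ipart_fpart//; case/andP: (fpart_bnd a).
Qed.

Lemma flow_label_at0 x : flow_label x 0 = x.
Proof. by rewrite -{1}(flow_char_at0 x) flow_labelK// eta0; exact: jdom0. Qed.

Lemma flow_labelD1 x t : flow_label (x + 1) t = flow_label x t + 1.
Proof. by rewrite /flow_label ipartD1 fpartD1; ring. Qed.

Lemma cvg_eta0 (f : R -> R) : {for 0, continuous f} -> f (eta t) @[t --> 0^'+] --> f 0.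
Proof.
move=> cf; have [c0 _] := eta_evolves.
apply: (@cvg_comp _ _ _ eta f _ (nbhs (eta 0))); first exact: c0.
by rewrite eta0; exact: cf.
Qed.

Let dK0 a e : dom e -> is_derive e 1 (F0 a) (F1 a e).
Proof. exact: der_kint0. Qed.

Let dK1 a e : dom e -> is_derive e 1 (F1 a) (F2 a e).
Proof. exact: der_kint1. Qed.

Lemma der_L e : dom e -> is_derive e 1 L (F2 1 e / K e - L e ^+ 2).
Proof.
move=> de; have K0 := K_gt0 de.
have D := derM (dK1 1 de) (derV (dK0 1 de) (lt0r_neq0 K0)).
by apply: (der_eq D); field; rewrite gt_eqF.
Qed.

Lemma der_flow_scale e : dom e -> is_derive e 1 flow_scale (- (2 * lam) * flow_scale e * L e).
Proof.
move=> de; have K0 := K_gt0 de.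
have D := @der_comp _ (@powR R ^~ (- (2 * lam))) _ e _ _ (is_derive1_powR (- (2 * lam)) K0) (dK0 1 de).
apply: (der_eq D).
rewrite powRB ?(gt_eqF K0) ?implybT// powRr1 ?ltW// /flow_scale.
by rewrite /=; field; rewrite gt_eqF.
Qed.

Lemma der_flow_strain a e : dom e -> is_derive e 1 (fun e => flow_strain du0 e a)
  (- (2 * lam) * flow_scale e * L e * (rr e (du0 a) - L e) +
   flow_scale e * (lam * rr e (du0 a) ^+ 2 - (F2 1 e / K e - L e ^+ 2))).
Proof.
move=> de.
exact: (derM (der_flow_scale de) (derB (der_jrat de (du0mM a)) (der_L de))).
Qed.

(** All the fields reduce to algebra once the spatial integrals are rewritten over
    labels: with kappa = K^(-2 lam) = d eta / dt and w = kappa (r - L), the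
    derivative of w in eta is
    kappa (lam r^2 - 2 lam L r + (2 lam + 1) L^2 - K''/K), and lam + 1 times the
    mean of (r - L)^2 is K''/K - (lam + 1) L^2. *)
Lemma flow_ibvp : ibvp_solution lam u0 du0 T flow_u flow_ux flow_char.
Proof.
split.
- move=> x t t0 tT; rewrite /flow_u; case: ifP => _; first exact: u0_per.
  by rewrite fpartD1.
- move=> x t t0 tT; rewrite /flow_ux flow_labelD1 /flow_strain.
  by rewrite du0_per.
- move=> t t0 tT; have [B hB] := flow_strain_bounded (eta_dom t0 tT) du0mM.
  by exists B => x; exact: hB.
- move=> t t0 tT x x01; have de := eta_dom t0 tT; rewrite /flow_u; case: ifP => [/eqP t00|_].
    rewrite (u0_prim x01); congr (_ + _); apply: eq_Rintegral => y _.
    by rewrite t00 /flow_ux flow_label_at0 eta0 flow_strain_at0.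
  rewrite fpart0 Rintegral_itv0 add0r.
  case/andP: x01 => x0; rewrite le_eqVlt => /predU1P[->|x1].
    rewrite fpart1 Rintegral_itv0 flow_ux_integral ?ler01 ?lexx// cinv_flow_density1//.
    by rewrite divff ?gt_eqF ?K_gt0// mulr1 subrr mulr0.
  by rewrite fpart_id// x0.
- by move=> x; rewrite /flow_u eqxx.
- by move=> x; rewrite /flow_ux flow_label_at0 eta0 flow_strain_at0.
- exact: flow_char_at0.
- move=> a; split.
    rewrite /flow_char eta0; apply: cvgD; first exact: cvg_cst.
    apply: (cvg_eta0 (f := fun e => F0 (fpart a) e / K e)).
    apply: der_continuous.
    have d0 := jdom0 lam m M.
    exact: (derM (dK0 (fpart a) d0) (derV (dK0 1 d0) (lt0r_neq0 (K_gt0 d0)))).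
  move=> t t0 tT; have de := eta_dom (ltW t0) tT; have K0 := K_gt0 de.
  have De : is_derive t 1 eta (flow_scale (eta t)) by have [_] := eta_evolves; apply.
  have D := derD (der_cst (ipart a) t) (derM (der_comp (dK0 (fpart a) de) De)
    (derV (der_comp (dK0 1 de) De) (lt0r_neq0 K0))).
  apply: (der_eq D).
  rewrite /flow_u gt_eqF// /flow_char fpartE ?char_fpart_bnd//.
  have /andP[f0 f1] := fpart_bnd a.
  have [c [C [c0 hC]]] := flow_density_bounds de.
  rewrite flow_ux_integral//; last by have /andP[-> /ltW->] := char_fpart_bnd a de.
  rewrite -cumul_flow_density// (cumulK (measurable_flow_density _) c0 hC).
  by field; rewrite gt_eqF.
- move=> a; split.
    have d0 := jdom0 lam m M.
    rewrite flow_ux_char ?eta0//.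
    apply: cvg_trans (cvg_eta0 (der_continuous (der_flow_strain a d0))).
    apply: near_eq_cvg; near=> t; rewrite flow_ux_char//; apply: eta_dom.
      by apply: ltW; near: t; exact: nbhs_right_gt.
    near: t; exact: near_right_lt_ereal.
  move=> t t0 tT; have de := eta_dom (ltW t0) tT; have K0 := K_gt0 de.
  have De : is_derive t 1 eta (flow_scale (eta t)) by have [_] := eta_evolves; apply.
  rewrite flow_ux_sq_integral// flow_ux_char//.
  apply: (@der_near _ (fun t => flow_strain du0 (eta t) a)).
    near=> s; rewrite flow_ux_char//.
    have [s0 sT] : 0 < s /\ (s%:E < T)%E by near: s; exact: near_lt_ereal.
    by apply: eta_dom => //; exact: ltW.
  apply: (der_eq (der_comp (der_flow_strain a de) De)).
  by rewrite /flow_strain; field; rewrite gt_eqF.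
Unshelve. all: by end_near. Qed.

Lemma flow_represented : represented_by T flow_ux flow_char
  (fun a t => phi (eta t) (du0 a) / K (eta t)) (fun a t => flow_strain du0 (eta t) a).
Proof.
move=> t t0 tT; have de := eta_dom t0 tT; split.
- by move=> a; rewrite /flow_char ipartD1 fpartD1; ring.
- move=> x x01.
  have E : flow_char 0 t = 0.
    rewrite /flow_char ipart0 ?fpart_id ?lexx ?ltr01// add0r.
    by rewrite -cumul_flow_density// cumul0.
  have E2 : flow_char x t = F0 x (eta t) / K (eta t).
    case/andP: x01 => x0; rewrite le_eqVlt => /predU1P[->|x1].
      by rewrite /flow_char ipart1 fpart1 -cumul_flow_density// cumul0 addr0 divff// gt_eqF// K_gt0.
    by rewrite /flow_char ipart0 ?fpart_id ?x0// add0r.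
  have /andP[x0 x1] := x01.
  rewrite E E2 add0r -cumul_flow_density//.
  have [c [C [c0 hC]]] := flow_density_bounds de.
  rewrite (cumul_ge0 (measurable_flow_density _) c0 hC x0); apply: ae_eq_Rintegral_any.
  have FF := ae_filter_ringOfSetsType (@lebesgue_measure R).
  apply: filterS hdu0 => y hy; rewrite /= in_itv/= => /andP[y0 yx].
  by rewrite /flow_density hy//= in_itv/= y0 (le_trans yx).
- by move=> a; rewrite flow_ux_char.
Qed.

End FlowConstruction.

(** * Singular integrals of a power profile *)

Lemma Rintegral_FTC (R : realType) (F f : R -> R) (a b : R) : a <= b ->
  (forall y, a <= y <= b -> is_derive y 1 F (f y)) ->
  (forall y, a <= y <= b -> {for y, continuous f}) ->
  \int[leb]_(y in `[a, b]) f y = F b - F a.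
Proof.
rewrite le_eqVlt => /predU1P[<- _ _|ab dF cf]; first by rewrite Rintegral_itv0 subrr.
have cF y : a <= y <= b -> {for y, continuous F}.
  by move=> /dF; exact: der_continuous.
rewrite /Rintegral (@continuous_FTC2 _ _ F)//.
- apply: continuous_in_subspaceT => y /set_mem /=.
  by rewrite in_itv/=; exact: cf.
- split.
  + move=> y; rewrite in_itv/= => /andP[ay yb].
    by have [] : is_derive y 1 F (f y) by apply: dF; rewrite !ltW.
  + by apply: cvg_at_right_filter; apply: cF; rewrite lexx ltW.
  + by apply: cvg_at_left_filter; apply: cF; rewrite lexx ltW.
- move=> y; rewrite in_itv/= => /andP[ay yb]; rewrite derive1E.
  by have [_ ->] : is_derive y 1 F (f y) by apply: dF; rewrite !ltW.
Qed.

Section ModelKernel.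
Variables (R : realType) (q : R).
Hypothesis q_gt0 : 0 < q.

Definition absq (y : R) : R := `|y| `^ q.

Lemma absq_ge0 y : 0 <= absq y. Proof. exact: powR_ge0. Qed.

Lemma absq0 : absq 0 = 0. Proof. by rewrite /absq normr0 powR0// gt_eqF. Qed.

Lemma absq_gt0 y : y != 0 -> 0 < absq y.
Proof. by move=> y0; rewrite powR_gt0// normr_gt0. Qed.

Lemma absqM x y : absq (x * y) = absq x * absq y.
Proof. by rewrite /absq normrM powRM. Qed.

Lemma absq1 : absq 1 = 1.
Proof. by rewrite /absq normr1 powR1. Qed.

Lemma absq_le x y : `|x| <= `|y| -> absq x <= absq y.
Proof. by move=> xy; apply: ge0_ler_powR => //; rewrite ?nnegrE// ltW. Qed.

Lemma absqN y : absq (- y) = absq y.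
Proof. by rewrite /absq normrN. Qed.

Lemma absq_powR y : 0 < y -> absq (y `^ q^-1) = y.
Proof.
move=> y0; rewrite /absq ger0_norm ?powR_ge0// -powRrM mulVf ?gt_eqF//.
by rewrite powRr1// ltW.
Qed.

Lemma absq_continuous : continuous absq.
Proof.
move=> y; have [->|y0] := eqVneq y 0.
  apply/cvgrPdist_lt => e e0; rewrite absq0.
  near=> z; rewrite sub0r normrN ger0_norm ?absq_ge0//.
  have ze : `|z| < e `^ q^-1.
    near: z; exists (e `^ q^-1); rewrite /= ?powR_gt0// => z /=.
    by rewrite sub0r normrN.
  rewrite -(absq_powR e0) /absq; apply: gt0_ltr_powR; rewrite ?nnegrE//.
  by rewrite (ger0_norm (powR_ge0 _ _)).
apply: (@continuous_comp _ _ _ (fun y : R => `|y|) (@powR R ^~ q)).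
  exact: norm_continuous.
by apply: der_continuous; apply: is_derive1_powR; rewrite normr_gt0.
Unshelve. all: by end_near. Qed.

(** The integrand (x + D)^(-s) in which the profile D is replaced by its leading
    term c |y|^q at a zero. *)
Definition mker (s x c y : R) : R := (x + c * absq y) `^ (- s).

Lemma mker_base x c y : 0 < x -> 0 <= c -> 0 < x + c * absq y.
Proof. by move=> x0 c0; rewrite ltr_pwDl// mulr_ge0// absq_ge0. Qed.

Lemma mker_continuous s x c : 0 < x -> 0 <= c -> continuous (mker s x c).
Proof.
move=> x0 c0 y.
apply: (@continuous_comp _ _ _ (fun y => x + c * absq y) (@powR R ^~ (- s))).
  apply: cvgD; first exact: cvg_cst.
  by apply: cvgM; [exact: cvg_cst|exact: absq_continuous].
by apply: der_continuous; apply: is_derive1_powR; exact: mker_base.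
Qed.

Lemma powR_le_neg (s a b : R) : 0 <= s -> 0 < a -> a <= b -> b `^ (- s) <= a `^ (- s).
Proof.
move=> s0 a0 ab; rewrite !powRN lef_pV2 ?posrE ?powR_gt0//; last exact: lt_le_trans ab.
by apply: ge0_ler_powR => //; rewrite nnegrE ltW// (lt_le_trans a0).
Qed.

Lemma mker_bnd s x c y : 0 <= s -> 0 < x -> 0 <= c -> 0 <= mker s x c y <= x `^ (- s).
Proof.
move=> s0 x0 c0; rewrite powR_ge0/=; apply: powR_le_neg => //.
by rewrite lerDl mulr_ge0// absq_ge0.
Qed.

Lemma measurable_mker s x c : 0 < x -> 0 <= c -> measurable_fun setT (mker s x c).
Proof. by move=> x0 c0; apply: continuous_measurable_fun; exact: mker_continuous. Qed.

Lemma integrable_mker s x c (a b : R) (ba bb : bool) : 0 <= s -> 0 < x -> 0 <= c ->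
  (@lebesgue_measure R).-integrable [set` Interval (BSide ba a) (BSide bb b)] (EFin \o mker s x c).
Proof.
move=> s0 x0 c0; apply: (@bounded_integrable _ _ (x `^ (- s))); first exact: measurable_mker.
by move=> y; have /andP[h1 h2] := mker_bnd y s0 x0 c0; rewrite ger0_norm.
Qed.

Definition mint (s x c l : R) : R := \int[leb]_(r in `[0%R, l]) mker s x c r.

(** The substitution r = (x / c)^(1/q) y exhibits the singular power of x: what
    remains is a fixed integral up to a bound that tends to infinity. *)
Lemma mint_scale s x c l : 0 <= s -> 0 < x -> 0 < c -> 0 <= l ->
  mint s x c l = x `^ (q^-1 - s) * c `^ (- q^-1) * mint s 1 1 (l * (c / x) `^ q^-1).
Proof.
move=> s0 x0 c0 l0; pose k := (c / x) `^ q^-1.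
have k0 : 0 < k by rewrite powR_gt0// divr_gt0.
have mk : measurable_fun setT ((fun=> k) : R -> R) by [].
have kb (y : R) : k <= (fun=> k) y <= k by rewrite lexx.
have ck y : cumul (fun=> k) y = k * y.
  have pos z : 0 <= z -> cumul (fun=> k) z = k * z.
    move=> z0; rewrite (cumul_ge0 mk k0 kb z0) Rintegral_cst//=.
    rewrite lebesgue_measure_itv/= lte_fin; congr (_ * _).
    by move: z0; rewrite le_eqVlt => /predU1P[<-|->]; rewrite ?ltxx//= subr0.
  have [y0|/ltW y0] := leP 0 y; first exact: pos.
  have := cumul_bnd mk k0 kb y0; rewrite cumul0 !sub0r -eq_le => /eqP.
  by rewrite mulrN => /oppr_inj.
have cinvk y : cinv (fun=> k) y = y / k.
  by rewrite -{1}(mulrVK (unitf_gt0 k0) y) mulrC -ck (cumulK mk k0 kb).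
pose w y := mker s 1 1 (k * y).
have mw : measurable_fun setT w.
  apply: continuous_measurable_fun => y.
  apply: (@continuous_comp _ _ _ (fun y => k * y) (mker s 1 1)).
    by apply: cvgM; [exact: cvg_cst|exact: cvg_id].
  exact: mker_continuous.
have wB y : `|w y| <= 1 `^ (- s).
  by have /andP[h1 h2] := mker_bnd (k * y) s0 ltr01 ler01; rewrite ger0_norm.
have := bounded_change_of_variables mk k0 kb mw wB l0.
rewrite ck [k * l]mulrC => E.
have -> : mint s 1 1 (l * k) = \int[leb]_(y in `[0%R, l * k]) w (cinv (fun=> k) y).
  by apply: eq_Rintegral => y _; rewrite cinvk /w mulrC mulrVK// unitf_gt0.
rewrite E -RintegralZl//; last first.
  apply: (@bounded_integrable _ _ (1 `^ (- s) * k)); first exact: measurable_funM.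
  by move=> y; rewrite normrM (gtr0_norm k0) ler_pM2r.
apply: eq_Rintegral => y _; rewrite /w /mker absqM mul1r absq_powR ?divr_gt0//.
have -> : x + c * absq y = x * (1 + c / x * absq y) by field; rewrite gt_eqF.
rewrite powRM ?ltW//; last by rewrite ltr_pwDl// mulr_ge0 ?absq_ge0// divr_ge0// ltW.
have kE : k = c `^ q^-1 / x `^ q^-1.
  rewrite /k powRM ?invr_ge0 ?ltW//; congr (_ * _).
  by rewrite -[x^-1]powR_inv1 ?ltW// -powRrM mulN1r powRN.
rewrite kE powRB ?(gt_eqF x0) ?implybT// (powRN c) (powRN x).
by field; rewrite !gt_eqF// powR_gt0.
Qed.

Lemma mint_nondecreasing s x c : 0 <= s -> 0 < x -> 0 <= c ->
  nondecreasing_fun (mint s x c).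
Proof.
move=> s0 x0 c0 a b ab; rewrite /mint /Rintegral fine_le//.
- by apply: integrable_fin_num => //; exact: integrable_mker.
- by apply: integrable_fin_num => //; exact: integrable_mker.
- apply: ge0_subset_integral => //.
  + apply/measurable_funTS/measurable_EFinP; exact: measurable_mker.
  + by move=> y _; rewrite lee_fin powR_ge0.
  + by move=> y /=; rewrite !in_itv/= => /andP[-> /le_trans->].
Qed.

Lemma integral_powR_1 (a Y : R) : 1 <= Y -> a != 1 ->
  \int[leb]_(y in `[1%R, Y]) (y `^ (- a)) = (Y `^ (1 - a) - 1) / (1 - a).
Proof.
move=> Y1 a1; have a10 : 1 - a != 0 by rewrite subr_eq0 eq_sym.
pose F y : R := (1 - a)^-1 * y `^ (1 - a).
have dF (y : R) : 0 < y -> is_derive y 1 F (y `^ (- a)).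
  move=> y0; have D := derM (der_cst (1 - a)^-1 y) (is_derive1_powR (1 - a) y0).
  apply: (der_eq D); rewrite mul0r add0r mulKf//.
  by congr (_ `^ _); ring.
have pos (y : R) : 1 <= y <= Y -> 0 < y.
  by move=> /andP[y1 _]; apply: lt_le_trans y1.
have cf (y : R) : 1 <= y <= Y -> {for y, continuous (fun y : R => y `^ (- a))}.
  by move=> /pos y0; apply: der_continuous (is_derive1_powR _ y0).
rewrite (Rintegral_FTC Y1 (fun y hy => dF y (pos y hy)) cf).
by rewrite /F powR1; field.
Qed.

(** Beyond 1 the integrand is dominated by y^(- q s), which decides between
    convergence (1 < q s) and the growth Y^(1 - q s). *)
Lemma mint1_ge1 s Y : 0 <= s -> 1 <= Y ->
  mint s 1 1 Y <= 1 + \int[leb]_(y in `[1%R, Y]) (y `^ (- (q * s))).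
Proof.
move=> s0 Y1.
have I1 (a b : R) (ba bb : bool) := integrable_mker a b ba bb s0 ltr01 ler01.
have Y0 : 0 <= Y by apply: le_trans Y1.
have E : mint s 1 1 Y = mint s 1 1 1 + \int[leb]_(y in `[1%R, Y]) mker s 1 1 y.
  rewrite -(Rintegral_itv_obnd_cbnd (I1 1 Y false false)).
  rewrite -(@Rintegral_itvB _ (mker s 1 1) (BLeft 0) (BRight Y) 1 (I1 0 Y true false)) ?bnd_simp//.
  by rewrite subrKC.
have powc (y : R) : 0 < y -> {for y, continuous (fun y : R => y `^ (- (q * s)))}.
  by move=> y0; apply: der_continuous (is_derive1_powR _ y0).
rewrite E lerD//.
  have E1 : \int[leb]_(y in `[0%R, 1%R]) 1 = (1 : R).
    by rewrite Rintegral_cst// mul1r /= lebesgue_measure_itv/= lte_fin ltr01/= subr0.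
  rewrite -[X in _ <= X]E1.
  apply: le_Rintegral; [by []|exact: I1| |].
    by apply: (@bounded_integrable _ _ 1) => // y; rewrite normr1.
  move=> y _; have /andP[_] := mker_bnd y s0 ltr01 ler01.
  by rewrite powR1.
apply: le_Rintegral; [by []|exact: I1| |].
  apply: continuous_compact_integrable; first exact: segment_compact.
  apply: continuous_in_subspaceT => y /set_mem /=.
  by rewrite in_itv/= => /andP[y1 _]; apply: powc; apply: lt_le_trans y1.
move=> y /=; rewrite in_itv/= => /andP[y1 _]; have y0 : 0 < y by apply: lt_le_trans y1.
rewrite /mker mul1r -mulrN powRrM; apply: powR_le_neg => //; first exact: powR_gt0.
by rewrite /absq gtr0_norm// lerDr.
Qed.

Lemma Rintegral_lower (f : R -> R) (a b a' b' k B : R) :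
  measurable_fun setT f -> (forall y, 0 <= f y <= B) -> a <= a' -> a' <= b' -> b' <= b ->
  (forall y, a' <= y <= b' -> k <= f y) ->
  k * (b' - a') <= \int[leb]_(y in `[a, b]) f y.
Proof.
move=> mf f0 aa ab bb kf.
have fi (c d : R) (bc bd : bool) : (@lebesgue_measure R).-integrable
    [set` Interval (BSide bc c) (BSide bd d)] (EFin \o f).
  by apply: (@bounded_integrable _ _ B) => // y; have /andP[h1 h2] := f0 y; rewrite ger0_norm.
apply: (@le_trans _ _ (\int[leb]_(y in `[a', b']) f y)); last first.
  rewrite /Rintegral fine_le//.
  - by apply: integrable_fin_num => //; exact: fi.
  - by apply: integrable_fin_num => //; exact: fi.
  - apply: ge0_subset_integral => //.
    + exact/measurable_funTS/measurable_EFinP.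
    + by move=> y _; rewrite lee_fin; have /andP[] := f0 y.
    + move=> y /=; rewrite !in_itv/= => /andP[h1 h2].
      by rewrite (le_trans aa h1) (le_trans h2 bb).
have -> : k * (b' - a') = \int[leb]_(y in `[a', b']) k.
  rewrite Rintegral_cst// /= lebesgue_measure_itv/= lte_fin; congr (_ * _).
  by move: ab; rewrite le_eqVlt => /predU1P[->|->//]; rewrite ltxx subrr.
apply: le_Rintegral; [by []| |exact: fi|].
  by apply: (@bounded_integrable _ _ `|k|).
by move=> y /=; rewrite in_itv/=; exact: kf.
Qed.

(** The integrands differ by y^q / (1 + y^q)^(s + 1), bounded below on [1, 2]. The
    resulting strict inequality between the limits at infinity gives the
    two-sided blow-up its two signs. *)
Lemma mint1_gap s : 0 <= s -> exists2 k : R, 0 < k &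
  forall Y, 2 <= Y -> mint (s + 1) 1 1 Y + k <= mint s 1 1 Y.
Proof.
move=> s0; pose k : R := (1 + 2 `^ q) `^ (- (s + 1)).
have s1 : 0 <= s + 1 by rewrite addr_ge0.
have k0 : 0 < k by rewrite powR_gt0// ltr_wpDr// powR_ge0.
(* k is the least value on [1, 2] of (1 + y^q)^(- (s + 1)); the other factor
   of the difference is at least 1 there. *)
exists k => // Y Y2; rewrite addrC -lerBrDr /mint -RintegralB//; [|exact: integrable_mker..].
pose f y := mker s 1 1 y - mker (s + 1) 1 1 y.
have fE y : f y = mker (s + 1) 1 1 y * absq y.
  have b0 : 0 < 1 + absq y by rewrite -[absq y]mul1r mker_base.
  rewrite /f /mker !mul1r opprD powRB ?(gt_eqF b0) ?implybT// powRr1 ?ltW//.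
  by field; rewrite gt_eqF.
have -> : k = k * (2 - 1) by ring.
apply: (@Rintegral_lower f 0 Y 1 2 k 1) => //.
- by apply: measurable_funB; exact: measurable_mker.
- move=> y; rewrite {1}fE mulr_ge0 ?powR_ge0//= /f lerBlDr.
  have /andP[h1 h2] := mker_bnd y s0 ltr01 ler01; rewrite powR1 in h2.
  by apply: (le_trans h2); rewrite lerDl powR_ge0.
- by rewrite ler1n.
- move=> y /andP[y1 y2]; have y0 : 0 < y by apply: lt_le_trans y1.
  rewrite fE -[k]mulr1 ler_pM ?powR_ge0//; last first.
    by rewrite -absq1; apply: absq_le; rewrite normr1 gtr0_norm.
  rewrite /mker mul1r; apply: powR_le_neg => //; first by rewrite ltr_pwDl// absq_ge0.
  rewrite lerD2l /absq gtr0_norm//; by apply: ge0_ler_powR => //; rewrite ?nnegrE// ltW.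
Qed.

Lemma mint1_gt0 s : 0 <= s -> 0 < mint s 1 1 1.
Proof.
move=> s0; have k0 : 0 < (2 : R) `^ (- s) by rewrite powR_gt0.
apply: lt_le_trans k0 _; rewrite -[leLHS]mulr1 -[X in _ * X <= _]subr0.
apply: (@Rintegral_lower (mker s 1 1) 0 1 0 1 _ (1 `^ (- s))) => //.
- exact: measurable_mker.
- by move=> y; exact: mker_bnd.
- move=> y /andP[y0 y1]; apply: powR_le_neg => //; first exact: mker_base.
  rewrite mul1r; have : absq y <= absq 1 by apply: absq_le; rewrite normr1 ger0_norm.
  by rewrite absq1; lra.
Qed.

Lemma mint1_cvg s : 1 < q * s -> exists2 I : R, 0 < I &
  mint s 1 1 Y @[Y --> +oo] --> I.
Proof.
move=> qs; have s0 : 0 <= s.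
  rewrite leNgt; apply/negP => s0.
  by have := lt_trans qs (lt_trans (_ : q * s < 0) ltr01); rewrite pmulr_rlt0// ltxx => /(_ s0).
have nd := mint_nondecreasing s0 ltr01 ler01.
have ub : has_ubound (range (mint s 1 1)).
  exists (1 + (q * s - 1)^-1) => _ [Y _ <-].
  have YM : Y <= Num.max Y 1 by rewrite le_max lexx.
  have M1 : 1 <= Num.max Y 1 by rewrite le_max lexx orbT.
  apply: le_trans (nd _ _ YM) _; apply: le_trans (mint1_ge1 s0 M1) _.
  rewrite lerD2l integral_powR_1 ?gt_eqF// -[X in _ / X]opprB invrN mulrN -mulNr opprB.
  rewrite ler_piMl ?invr_ge0 ?subr_ge0 ?ltW//.
  by rewrite ltrBlDr ltrDl powR_gt0// (lt_le_trans ltr01).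
have cv := nondecreasing_cvgr nd ub.
exists (sup (range (mint s 1 1))) => //.
apply: lt_le_trans (mint1_gt0 s0) _.
by apply: ub_le_sup => //; exists 1.
Qed.

Lemma mint1_small s : 0 <= s -> q * s < 1 -> forall Y, 1 <= Y ->
  mint s 1 1 Y <= 1 + Y `^ (1 - q * s) / (1 - q * s).
Proof.
move=> s0 qs Y Y1; apply: le_trans (mint1_ge1 s0 Y1) _.
rewrite lerD2l integral_powR_1 ?lt_eqF// ler_wpM2r ?invr_ge0 ?subr_ge0 ?ltW//.
by rewrite ltrBlDr ltrDl.
Qed.

End ModelKernel.

Lemma continuous_primitive (R : realType) (f : R -> R) (A B : R) : continuous f ->
  exists P : R -> R, forall t, A < t < B -> is_derive t 1 P (f t).
Proof.
move=> cf; exists (fun t => \int[leb]_(y in `[A, t]) f y) => t /andP[At tB].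
have fi : (@lebesgue_measure R).-integrable `[A, B] (EFin \o f).
  apply: continuous_compact_integrable; first exact: segment_compact.
  exact: continuous_subspaceT.
have [d1 d2] := continuous_FTC1_closed tB fi At (cf t).
by constructor; [exact: d1|exact: (etrans (esym (derive1E _ _)) d2)].
Qed.

Section ModelAsymptotics.
Variables (R : realType) (q : R).
Hypothesis q_gt0 : 0 < q.

(** Seen from a zero b, the unit interval consists of a side of length b and one
    of length 1 - b. *)
Lemma mint_shift s x c b : 0 <= s -> 0 < x -> 0 <= c -> 0 <= b <= 1 ->
  \int[leb]_(a in `[0%R, 1%R]) mker q s x c (a - b) = mint q s x c b + mint q s x c (1 - b).
Proof.
move=> s0 x0 c0 /andP[b0 b1].
have ck := mker_continuous (s := s) q_gt0 x0 c0.
have cs : continuous (fun a => mker q s x c (a - b)).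
  move=> a; apply: (@continuous_comp _ _ _ (fun a => a - b) (mker q s x c)).
    by apply: cvgB; [exact: cvg_id|exact: cvg_cst].
  exact: ck.
have int (a a' : R) (ba ba' : bool) : (@lebesgue_measure R).-integrable
    [set` Interval (BSide ba a) (BSide ba' a')] (EFin \o (fun a => mker q s x c (a - b))).
  apply: (@bounded_integrable _ _ (x `^ (- s))); first exact: continuous_measurable_fun.
  by move=> y; have /andP[h1 h2] := mker_bnd q (y - b) s0 x0 c0; rewrite ger0_norm.
have -> : \int[leb]_(a in `[0%R, 1%R]) mker q s x c (a - b) =
   \int[leb]_(a in `[0%R, b]) mker q s x c (a - b) + \int[leb]_(a in `[b, 1%R]) mker q s x c (a - b).
  rewrite -(Rintegral_itv_obnd_cbnd (int b 1 false false)).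
  rewrite -(@Rintegral_itvB _ _ (BLeft 0) (BRight 1) b (int 0 1 true false)) ?bnd_simp//.
  by rewrite subrKC.
(* Both sides are differences of values of one primitive of the kernel,
   needed only for arguments between 0 and 1. *)
have [P dP] := continuous_primitive (-2) 2 ck.
have cst (y : R) (k : R) : is_derive y 1 (fun y => y - k) 1.
  by have D := derB (der_id y) (der_cst k y); apply: (der_eq D); rewrite subr0.
have cst' (y : R) (k : R) : is_derive y 1 (fun y => k - y) (-1).
  by have D := derB (der_cst k y) (der_id y); apply: (der_eq D); rewrite sub0r.
have mintP l : 0 <= l <= 1 -> mint q s x c l = P l - P 0.
  move=> /andP[l0 l1]; apply: Rintegral_FTC => // y /andP[y0 yl]; last exact: ck.
  by apply: dP; move: y0 yl l1; clear; move=> *; apply/andP; split; lra.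
have b01 : 0 <= 1 - b <= 1 by rewrite subr_ge0 b1 gerBl.
rewrite !mintP ?b0//.
congr (_ + _).
- have dF y : 0 <= y <= b -> is_derive y 1 (fun y => - P (b - y)) (mker q s x c (y - b)).
    move=> /andP[y0 yb].
    have h : -2 < b - y < 2 by move: y0 yb b1 b0; clear; move=> *; apply/andP; split; lra.
    have D := derN (@der_comp _ P (fun y => b - y) y _ _ (dP _ h) (cst' y b)).
    apply: (der_eq D); by rewrite mulrN1 opprK /mker -(absqN q (b - y)) opprB.
  by rewrite (Rintegral_FTC b0 dF) ?subrr ?subr0; [ring|move=> y _; exact: cs].
- have dF y : b <= y <= 1 -> is_derive y 1 (fun y => P (y - b)) (mker q s x c (y - b)).
    move=> /andP[y0 yb].
    have h : -2 < y - b < 2 by move: y0 yb b1 b0; clear; move=> *; apply/andP; split; lra.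
    by have D := @der_comp _ P (fun y => y - b) y _ _ (dP _ h) (cst y b); apply: (der_eq D); rewrite mulr1.
  by rewrite (Rintegral_FTC b1 dF) ?subrr//; move=> y _; exact: cs.
Qed.

Lemma mint_l0 s x c : mint q s x c 0 = 0.
Proof. by rewrite /mint Rintegral_itv0. Qed.

Lemma cvg_powR_right0_pinfty (p : R) : 0 < p -> x^-1 `^ p @[x --> (0 : R)^'+] --> +oo.
Proof.
move=> p0; apply/cvgryPge => A.
pose B := Num.max A 1; have B1 : 1 <= B by rewrite le_max lexx orbT.
have B0 : 0 < B by apply: lt_le_trans B1.
near=> x.
have x0 : 0 < x by near: x; exact: nbhs_right_gt.
apply: (@le_trans _ _ B); first by rewrite le_max lexx.
have -> : B = (B `^ p^-1) `^ p by rewrite -powRrM mulVf ?gt_eqF// powRr1// ltW.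
apply: ge0_ler_powR; rewrite ?nnegrE ?powR_ge0 ?invr_ge0 ?(ltW x0) ?(ltW p0)//.
rewrite -[leLHS]invrK lef_pV2 ?posrE ?invr_gt0 ?powR_gt0//.
by near: x; apply: nbhs_right_le; rewrite invr_gt0 powR_gt0.
Unshelve. all: by end_near. Qed.

Lemma mint_cvg s c l I : 0 <= s -> 0 < c -> 0 < l ->
  mint q s 1 1 Y @[Y --> +oo] --> I ->
  x `^ (s - q^-1) * mint q s x c l @[x --> 0^'+] --> c `^ (- q^-1) * I.
Proof.
move=> s0 c0 l0 cvI.
have cvY : l * (c / x) `^ q^-1 @[x --> 0^'+] --> +oo.
  have h := cvg_powR_right0_pinfty (p := q^-1).
  rewrite invr_gt0 in h; have {}h := h q_gt0.
  have k0 : 0 < l * c `^ q^-1 by rewrite mulr_gt0// powR_gt0.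
  apply: cvg_trans (gt0_cvgMry k0 h); apply: near_eq_cvg; near=> x.
  have x0 : 0 < x by near: x; exact: nbhs_right_gt.
  by rewrite powRM ?invr_ge0 ?ltW// mulrA.
apply: cvg_trans (cvgM (cvg_cst (c `^ (- q^-1))) (cvg_comp _ _ cvY cvI)).
apply: near_eq_cvg; near=> x.
have x0 : 0 < x by near: x; exact: nbhs_right_gt.
rewrite /= (mint_scale q_gt0 s0 x0 c0 (ltW l0)) !mulrA -powRD ?(gt_eqF x0) ?implybT//.
by rewrite addrA subrK subrr powRr0 mul1r.
Unshelve. all: by end_near. Qed.

(** The scaling factor x^(1/q - s) is compensated by the growth Y^(1 - q s) of the
    rescaled integral, with Y proportional to x^(- 1/q). *)
Lemma mint_bounded s c l : 0 <= s -> q * s < 1 -> 0 < c -> 0 <= l ->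
  exists C : R, forall x, 0 < x <= 1 -> mint q s x c l <= C.
Proof.
move=> s0 qs c0 l0.
pose p := 1 - q * s; have p0 : 0 < p by rewrite subr_gt0.
pose Z := (l * c `^ q^-1) `^ p.
exists (c `^ (- q^-1) * (1 + (1 + Z) / p)) => x /andP[x0 x1].
rewrite (mint_scale q_gt0 s0 x0 c0 l0).
pose Y := l * (c / x) `^ q^-1; pose W := Num.max Y 1.
have W1 : 1 <= W by rewrite le_max lexx orbT.
have YW : Y <= W by rewrite le_max lexx.
have Y0 : 0 <= Y by rewrite mulr_ge0// powR_ge0.
have h1 : mint q s 1 1 Y <= 1 + W `^ p / p.
  apply: le_trans (mint1_small q_gt0 s0 qs W1).
  exact: mint_nondecreasing.
have h2 : W `^ p <= 1 + Y `^ p.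
  rewrite /W maxEle; case: ifP => _; first by rewrite powR1 lerDl powR_ge0.
  by rewrite lerDr.
have YE : Y `^ p = Z * x `^ (- (q^-1 - s)).
  have kE : (c / x) `^ q^-1 = c `^ q^-1 * x `^ (- q^-1).
    rewrite powRM ?invr_ge0 ?ltW//; congr (_ * _).
    by rewrite -[x^-1]powR_inv1 ?ltW// -powRrM mulN1r.
  rewrite /Y kE mulrA powRM ?mulr_ge0 ?powR_ge0// -powRrM; congr (_ * _ `^ _).
  by rewrite /p; field; rewrite gt_eqF.
pose e := q^-1 - s.
have e0 : 0 <= e by rewrite subr_ge0 -[q^-1]mul1r ler_pdivlMr// mulrC ltW.
have xe1 : x `^ e <= 1.
  rewrite -(powRr0 x); apply: ger_powR => //; by rewrite x0.
have xe0 : 0 < x `^ e by rewrite powR_gt0.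
rewrite mulrAC [leLHS]mulrC -/e ler_wpM2l ?powR_ge0//.
apply: (@le_trans _ _ (x `^ e * (1 + (1 + Z * (x `^ e)^-1) / p))).
  rewrite ler_pM2l//; apply: (le_trans h1); rewrite lerD2l ler_pM2r ?invr_gt0//.
  by apply: (le_trans h2); rewrite YE powRN.
have -> : x `^ e * (1 + (1 + Z * (x `^ e)^-1) / p) = x `^ e * (1 + p^-1) + Z / p.
  by field; rewrite !gt_eqF.
have -> : 1 + (1 + Z) / p = (1 + p^-1) + Z / p by ring.
by rewrite lerD2r ler_piMl// addr_ge0// invr_ge0 ltW.
Qed.

End ModelAsymptotics.

(** * Singular integrals of a function with power-like zeros *)

Lemma squeeze_dist (R : realFieldType) (g gp gm y a b e : R) :
  `|gp - a| < e / 2 -> `|gm - b| < e / 2 -> `|g - gp| < e / 2 -> `|g - gm| < e / 2 ->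
  a <= y -> y <= b -> `|g - y| < e.
Proof.
rewrite !ltr_norml => /andP[? ?] /andP[? ?] /andP[? ?] /andP[? ?] ? ?.
by apply/andP; split; lra.
Qed.

Lemma half_le_of_add (R : realFieldType) (r X Y : R) : Y < r / 2 -> r <= X + Y -> r / 2 <= X.
Proof. lra. Qed.

Section Sandwich.
Variables (R : realType) (q c : R) (D : R -> R) (S : seq R).
Hypothesis q_gt0 : 0 < q.
Hypothesis c_gt0 : 0 < c.
Hypothesis S_uniq : uniq S.
Hypothesis S_itv : forall b, b \in S -> 0 <= b <= 1.
Hypothesis D_ge0 : forall a, 0 <= D a.
Hypothesis D_near : forall dl : R, 0 < dl < 1 -> exists2 rho : R, 0 < rho &
  forall b a, b \in S -> `|a - b| < rho ->
    (1 - dl) * c * absq q (a - b) <= D a <= (1 + dl) * c * absq q (a - b).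
Hypothesis D_away : forall rho : R, 0 < rho -> exists2 d : R, 0 < d &
  forall a, 0 <= a <= 1 -> (forall b, b \in S -> rho <= `|a - b|) -> d <= D a.

Lemma ler_sum_seq1 (F : R -> R) b : b \in S -> (forall y, 0 <= F y) ->
  F b <= \sum_(y <- S) F y.
Proof.
by move=> bS F0; rewrite (bigD1_seq b)//= lerDl sumr_ge0.
Qed.

Lemma ler_sum_const (F : R -> R) (P : pred R) (A : R) : 0 <= A ->
  (forall y, y \in S -> P y -> F y <= A) ->
  \sum_(y <- S | P y) F y <= (size S)%:R * A.
Proof.
move=> A0 FA; rewrite -sum1_size natr_sum mulr_suml.
rewrite big_mkcond /= big_seq [leRHS]big_seq; apply: ler_sum => y yS.
by rewrite mul1r; case: ifP => // /(FA y yS).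
Qed.

(** The error A does not depend on x: near one zero, D is squeezed by the power
    profile and the kernels at the other zeros are bounded, and far from all
    zeros everything is bounded. *)
Lemma sandwich s dl : 0 <= s -> 0 < dl < 1 -> exists A : R,
  forall x a, 0 < x -> 0 <= a <= 1 ->
    \sum_(b <- S) mker q s x ((1 + dl) * c) (a - b) - A <= (x + D a) `^ (- s) /\
    (x + D a) `^ (- s) <= \sum_(b <- S) mker q s x ((1 - dl) * c) (a - b) + A.
Proof.
move=> s0 dl01; have [rho rho0 near_] := D_near dl01.
move/andP: dl01 => [dl0 dl1].
have cm : 0 < (1 - dl) * c by rewrite mulr_gt0// subr_gt0.
have cp : 0 < (1 + dl) * c by rewrite mulr_gt0// addr_gt0.
have D0 b : b \in S -> D b = 0.
  move=> bS; have := near_ b b bS; rewrite subrr normr0 => /(_ rho0).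
  by rewrite absq0// !mulr0 => h; apply: le_anti; rewrite andbC.
have sep b b' : b \in S -> b' \in S -> b' != b -> rho <= `|b' - b|.
  move=> bS b'S bb; rewrite leNgt; apply/negP => h.
  have /andP[h1 _] := near_ b b' bS h; move: h1; rewrite (D0 _ b'S) leNgt.
  by rewrite mulr_gt0// absq_gt0// subr_eq0.
have r20 : 0 < rho / 2 by rewrite divr_gt0.
have [d d0 away] := D_away r20.
(* Two zeros are at distance at least rho, so a point within rho / 2 of one
   of them is at distance at least rho / 2 from the others, where the kernels
   are at most k^(- s). *)
pose k := (1 - dl) * c * absq q (rho / 2).
have k0 : 0 < k by rewrite mulr_gt0// absq_gt0// gt_eqF.
have far cc x y : (1 - dl) * c <= cc -> 0 < x -> rho / 2 <= `|y| -> mker q s x cc y <= k `^ (- s).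
  move=> hcc x0 hy; apply: powR_le_neg => //; apply: (@le_trans _ _ (cc * absq q y)).
    apply: ler_pM => //; first exact: ltW.
      exact: absq_ge0.
    by apply: absq_le => //; rewrite gtr0_norm.
  by rewrite lerDr ltW.
have ks0 : 0 <= k `^ (- s) by exact: powR_ge0.
have cmp : (1 - dl) * c <= (1 + dl) * c.
  by rewrite ler_pM2r// lerD2l (@le_trans _ _ 0)// ?oppr_le0 ltW.
exists ((size S)%:R * k `^ (- s) + d `^ (- s)) => x a x0 a01.
have ds0 : 0 <= d `^ (- s) by exact: powR_ge0.
have sS : 0 <= (size S)%:R * k `^ (- s) by rewrite mulr_ge0.
have [/hasP[b bS hb]|/hasPn hfar] := boolP (has (fun b => `|a - b| < rho / 2) S).
  have hb' : `|a - b| < rho by rewrite (lt_trans hb)// ltr_pdivrMr// ltr_pMr// ltr1n.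
  have /andP[h1 h2] := near_ b a bS hb'.
  split.
    rewrite lerBlDr (bigD1_seq b)//= lerD//.
      apply: powR_le_neg => //; first by rewrite ltr_wpDr// ?D_ge0.
      by rewrite lerD2l.
    apply: ler_wpDr => //; apply: ler_sum_const => // b' b'S bb'.
    apply: far => //.
    have := sep _ _ bS b'S bb' => hs.
    have : rho <= `|a - b'| + `|a - b|.
      apply: (le_trans hs); rewrite (_ : b' - b = (a - b) - (a - b')); last by ring.
      by rewrite [leRHS]addrC; exact: ler_normB.
    exact: half_le_of_add.
  apply: (@le_trans _ _ (mker q s x ((1 - dl) * c) (a - b))).
    apply: powR_le_neg => //; last by rewrite lerD2l.
    by rewrite ltr_wpDr// mulr_ge0 ?absq_ge0// ltW.
  apply: ler_wpDr; first exact: addr_ge0.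
  apply: (@ler_sum_seq1 (fun b => mker q s x ((1 - dl) * c) (a - b)) b bS) => y.
  exact: powR_ge0.
have hfar' b : b \in S -> rho / 2 <= `|a - b| by move=> /hfar; rewrite -leNgt.
have hd := away a a01 hfar'.
split.
  apply: (@le_trans _ _ 0); last exact: powR_ge0.
  rewrite subr_le0 ler_wpDr//; apply: ler_sum_const => // b bS _.
  by apply: far => //; exact: hfar'.
apply: (@le_trans _ _ (d `^ (- s))).
  by apply: powR_le_neg => //; rewrite (le_trans hd)// lerDr ltW.
by rewrite addrA lerDr addr_ge0// sumr_ge0// => y _; exact: powR_ge0.
Qed.

Variables (E : R -> R) (B : R).
Hypothesis mE : measurable_fun setT E.
Hypothesis E_bnd : forall a, 0 <= E a <= B.
Hypothesis ED : {ae (@lebesgue_measure R), forall a, `[0%R, 1%R]%classic a -> E a = D a}.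

Definition qint (s x : R) : R := \int[leb]_(a in `[0%R, 1%R]) (x + E a) `^ (- s).

Lemma measurable_qker s x : measurable_fun setT (fun a => (x + E a) `^ (- s)).
Proof.
by apply: (measurableT_comp (measurable_powR _)); exact: measurable_funD.
Qed.

Lemma integrable_qker s x (a b : R) (ba bb : bool) : 0 <= s -> 0 < x ->
  (@lebesgue_measure R).-integrable [set` Interval (BSide ba a) (BSide bb b)]
    (EFin \o (fun a => (x + E a) `^ (- s))).
Proof.
move=> s0 x0; apply: (@bounded_integrable _ _ (x `^ (- s))).
  exact: measurable_qker.
move=> y; rewrite ger0_norm ?powR_ge0//; apply: powR_le_neg => //.
by rewrite lerDl; have /andP[] := E_bnd y.
Qed.

Definition msum (s x c : R) (a : R) : R := \sum_(b <- S) mker q s x c (a - b).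

Lemma integrable_msum s x cc (a b : R) (ba bb : bool) : 0 <= s -> 0 < x -> 0 <= cc ->
  (@lebesgue_measure R).-integrable [set` Interval (BSide ba a) (BSide bb b)]
    (EFin \o msum s x cc).
Proof.
move=> s0 x0 c0; apply: (@bounded_integrable _ _ ((size S)%:R * x `^ (- s))).
  apply: measurable_sum => b'; apply: (measurableT_comp (measurable_mker q_gt0 s x0 c0)).
  exact: measurable_funB.
move=> y; rewrite ger0_norm; last by apply: sumr_ge0 => *; exact: powR_ge0.
apply: ler_sum_const => // [|b' _ _]; first exact: powR_ge0.
by have /andP[] := mker_bnd q (y - b') s0 x0 c0.
Qed.

Lemma integral_msum s x cc : 0 <= s -> 0 < x -> 0 <= cc ->
  \int[leb]_(a in `[0%R, 1%R]) msum s x cc a =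
  \sum_(b <- S) (mint q s x cc b + mint q s x cc (1 - b)).
Proof.
move=> s0 x0 c0; rewrite /msum; move: S_itv; elim: S => [|b0 S' IH] hS.
  rewrite big_nil; under eq_Rintegral do rewrite big_nil.
  by rewrite Rintegral_cst// mul0r.
rewrite big_cons -IH; last by move=> b bS; apply: hS; rewrite inE bS orbT.
rewrite -mint_shift ?hS ?mem_head//.
under eq_Rintegral do rewrite big_cons.
have mk (b : R) : measurable_fun setT (fun a : R => mker q s x cc (a - b)).
  by apply: (measurableT_comp (measurable_mker q_gt0 s x0 c0)); exact: measurable_funB.
have bk (b y : R) : 0 <= mker q s x cc (y - b) <= x `^ (- s) by exact: mker_bnd.
rewrite RintegralD//.
  apply: (@bounded_integrable _ _ (x `^ (- s))) => // y.
  by have /andP[h1 h2] := bk b0 y; rewrite ger0_norm.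
apply: (@bounded_integrable _ _ ((size S')%:R * x `^ (- s))); first exact: measurable_sum.
move=> y; rewrite ger0_norm; last by apply: sumr_ge0 => *; exact: powR_ge0.
rewrite -sum1_size natr_sum mulr_suml; apply: ler_sum => b' _; rewrite mul1r.
by have /andP[] := bk b' y.
Qed.

Lemma le_Rintegral_ae (f g : R -> R) : (forall a, 0 <= f a) -> (forall a, 0 <= g a) ->
  (@lebesgue_measure R).-integrable `[0%R, 1%R] (EFin \o f) ->
  (@lebesgue_measure R).-integrable `[0%R, 1%R] (EFin \o g) ->
  {ae (@lebesgue_measure R), forall a, `[0%R, 1%R]%classic a -> f a <= g a} ->
  \int[leb]_(a in `[0%R, 1%R]) f a <= \int[leb]_(a in `[0%R, 1%R]) g a.
Proof.
move=> f0 g0 fi gi fg; rewrite /Rintegral fine_le//.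
- exact: integrable_fin_num.
- exact: integrable_fin_num.
- have FF := ae_filter_ringOfSetsType (@lebesgue_measure R).
  by apply: ge0_le_integral_ae => //; apply: filterS fg => a fga /fga; rewrite lee_fin.
Qed.

Definition mtot (s x cc : R) : R := \sum_(b <- S) (mint q s x cc b + mint q s x cc (1 - b)).

Lemma qint_sandwich s dl : 0 <= s -> 0 < dl < 1 -> exists2 A : R, 0 <= A &
  forall x, 0 < x ->
    mtot s x ((1 + dl) * c) - A <= qint s x <= mtot s x ((1 - dl) * c) + A.
Proof.
move=> s0 dl01; have [A0 hA] := sandwich s0 dl01.
pose A := `|A0|; have AA : A0 <= A by exact: ler_norm.
have A_ge0 : 0 <= A by exact: normr_ge0.
exists A => // x x0.
move/andP: dl01 => [dl0 dl1].
have cm : 0 <= (1 - dl) * c by rewrite mulr_ge0// ?subr_ge0 ltW.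
have cp : 0 <= (1 + dl) * c by rewrite mulr_ge0// ?addr_ge0 ?ltW.
have Ai : (@lebesgue_measure R).-integrable `[0%R, 1%R] (EFin \o (fun=> A)).
  by apply: (@bounded_integrable _ _ `|A|).
have intA : \int[leb]_(_ in `[0%R, 1%R]) A = A.
  by rewrite Rintegral_cst//= lebesgue_measure_itv/= lte_fin ltr01/= subr0 mulr1.
have s_ge0 cc a : 0 <= msum s x cc a by apply: sumr_ge0 => *; exact: powR_ge0.
have FF := ae_filter_ringOfSetsType (@lebesgue_measure R).
have Dm : measurable (`[0%R, 1%R]%classic : set (measurableTypeR R)) by [].
apply/andP; split.
  rewrite lerBlDr /mtot -integral_msum// -[in leRHS]intA -RintegralD//; last exact: integrable_qker.
  apply: le_Rintegral_ae => //.
  - by move=> a; rewrite addr_ge0// powR_ge0.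
  - exact: integrable_msum.
  - by have := integrableD Dm (integrable_qker 0 1 true false s0 x0) Ai; apply.
  - apply: filterS ED => a EDa a01; rewrite EDa//.
    have [h1 _] := hA x a x0 a01.
    by rewrite -lerBlDr (le_trans _ h1)// lerD2l lerN2.
rewrite /mtot -integral_msum// -[in leRHS]intA -RintegralD//; last exact: integrable_msum.
apply: le_Rintegral_ae => //.
- by move=> a; exact: powR_ge0.
- by move=> a; rewrite addr_ge0.
- exact: integrable_qker.
- by have := integrableD Dm (integrable_msum 0 1 true false s0 x0 cm) Ai; apply.
- apply: filterS ED => a EDa a01; rewrite EDa//.
  have [_ h1] := hA x a x0 a01.
  by rewrite (le_trans h1)// lerD2l.
Qed.

(** A zero in the interior of the unit interval is approached from both sides,
    a zero at an endpoint from one side only. *)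
Definition nsides : R := \sum_(b <- S) ((0 < b)%R%:R + (b < 1)%R%:R).

Lemma nsides_gt0 b : b \in S -> 0 < nsides.
Proof.
move=> bS; apply: (@lt_le_trans _ _ ((0 < b)%R%:R + (b < 1)%R%:R)).
  have /andP[b0 b1] := S_itv bS.
  have [b0'|b0'] := ltP 0 b; first by rewrite ltr_pwDl ?ltr0n// ler0n.
  by rewrite add0r (le_lt_trans b0')// ltr0n.
by apply: (@ler_sum_seq1 (fun b => (0 < b)%R%:R + (b < 1)%R%:R)).
Qed.

Lemma mtot_cvg s cc I : 0 <= s -> 0 < cc ->
  mint q s 1 1 Y @[Y --> +oo] --> I ->
  x `^ (s - q^-1) * mtot s x cc @[x --> 0^'+] --> nsides * (cc `^ (- q^-1) * I).
Proof.
move=> s0 cc0 cvI; rewrite /mtot /nsides.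
have one l : 0 <= l -> x `^ (s - q^-1) * mint q s x cc l @[x --> 0^'+] -->
    (0 < l)%R%:R * (cc `^ (- q^-1) * I).
  rewrite le_eqVlt => /predU1P[<-|l0]; last by rewrite l0 mul1r; exact: mint_cvg.
  rewrite ltxx mul0r; under eq_fun do rewrite mint_l0 mulr0.
  exact: cvg_cst.
move: S_itv; elim: S => [|b S' IH] hS.
  rewrite big_nil mul0r; under eq_fun do rewrite big_nil mulr0.
  exact: cvg_cst.
have /andP[b0 b1] := hS b (mem_head _ _).
rewrite big_cons mulrDl; under eq_fun do rewrite big_cons mulrDr.
apply: cvgD; last by apply: IH => b' b'S; apply: hS; rewrite inE b'S orbT.
rewrite mulrDl; under eq_fun do rewrite mulrDr.
apply: cvgD; first exact: one.
by rewrite -(subr_gt0 b); apply: one; rewrite subr_ge0.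
Qed.

(** The additive error of the sandwich is killed by x^(s - 1/q), so that the
    rescaled integral lies asymptotically between the values at (1 + dl) c and
    (1 - dl) c of a function continuous in c. *)
Lemma qint_cvg s I : 1 < q * s -> mint q s 1 1 Y @[Y --> +oo] --> I ->
  x `^ (s - q^-1) * qint s x @[x --> 0^'+] --> nsides * (c `^ (- q^-1) * I).
Proof.
move=> qs cvI.
have p0 : 0 < s - q^-1 by rewrite subr_gt0 -[q^-1]mul1r ltr_pdivrMr// mulrC.
have s0 : 0 <= s by rewrite ltW// (lt_trans _ (_ : q^-1 < s)) ?invr_gt0// -subr_gt0.
pose G (dl : R) : R := nsides * (((1 + dl) * c) `^ (- q^-1) * I).
have G0 : G 0 = nsides * (c `^ (- q^-1) * I) by rewrite /G addr0 mul1r.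
have cG : {for 0, continuous G}.
  have i0 : 0 < (fun dl : R => (1 + dl) * c) 0 by rewrite addr0 mul1r.
  have D1 := derM (derD (der_cst 1 0) (der_id 0)) (der_cst c 0).
  have D2 := @der_comp _ (@powR R ^~ (- q^-1)) (fun dl : R => (1 + dl) * c) 0 _ _ (is_derive1_powR (- q^-1) i0) D1.
  exact: der_continuous (derM (der_cst nsides 0) (derM D2 (der_cst I 0))).
apply/cvgrPdist_lt => e e0; rewrite -G0.
have e20 : 0 < e / 2 by rewrite divr_gt0.
have := cG; move/cvgrPdist_lt => /(_ _ e20) [r /= r0 hr].
pose dl := Num.min (r / 2) (1 / 2).
have dl0 : 0 < dl by rewrite lt_min !divr_gt0.
have dlr : dl < r by rewrite gt_min ltr_pdivrMr// ltr_pMr// ltr1n.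
have half1 : 1 / 2 < 1 :> R by rewrite ltr_pdivrMr// mul1r ltr1n.
have dl1 : dl < 1 by rewrite gt_min half1 orbT.
have Gp : `|G 0 - G dl| < e / 2 by apply: hr; rewrite /= sub0r normrN gtr0_norm.
have Gm : `|G 0 - G (- dl)| < e / 2 by apply: hr; rewrite /= sub0r opprK gtr0_norm.
have dl01 : 0 < dl < 1 by rewrite dl0.
have [A A0 hA] := qint_sandwich s0 dl01.
have cm : 0 < (1 + - dl) * c by rewrite mulr_gt0// subr_gt0.
have cp : 0 < (1 + dl) * c by rewrite mulr_gt0// addr_gt0.
have pA : x `^ (s - q^-1) * A @[x --> 0^'+] --> (0 : R).
  rewrite -[X in _ --> X](mul0r A); apply: cvgM; last exact: cvg_cst.
  exact: powR_cvg0.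
have : x `^ (s - q^-1) * mtot s x ((1 + dl) * c) - x `^ (s - q^-1) * A @[x --> 0^'+] --> G dl.
  by rewrite -[G dl]subr0; apply: cvgB pA; exact: mtot_cvg.
move=> /cvgrPdist_lt/(_ _ e20) cvp.
have : x `^ (s - q^-1) * mtot s x ((1 + - dl) * c) + x `^ (s - q^-1) * A @[x --> 0^'+] --> G (- dl).
  by rewrite -[G (- dl)]addr0; apply: cvgD pA; exact: mtot_cvg.
move=> /cvgrPdist_lt/(_ _ e20) cvm.
near=> x.
have x0 : 0 < x by near: x; exact: nbhs_right_gt.
have h1 : `|G dl - (x `^ (s - q^-1) * mtot s x ((1 + dl) * c) - x `^ (s - q^-1) * A)| < e / 2.
  by near: x; exact: cvp.
have h2 : `|G (- dl) - (x `^ (s - q^-1) * mtot s x ((1 + - dl) * c) + x `^ (s - q^-1) * A)| < e / 2.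
  by near: x; exact: cvm.
have /andP[h3 h4] := hA x x0.
have xp : 0 < x `^ (s - q^-1) by rewrite powR_gt0.
rewrite -(ler_pM2l xp) mulrBr in h3; rewrite -(ler_pM2l xp) mulrDr in h4.
exact: (squeeze_dist h1 h2 Gp Gm h3 h4).
Unshelve. all: by end_near. Qed.

Lemma qint_bounded s : 0 <= s -> q * s < 1 ->
  exists C : R, forall x, 0 < x <= 1 -> qint s x <= C.
Proof.
move=> s0 qs.
have dl01 : 0 < (1 / 2 : R) < 1 by apply/andP; split; lra.
have [A A0 hA] := qint_sandwich s0 dl01.
set cc := (1 - 1 / 2) * c in hA.
have cc0 : 0 < cc by rewrite mulr_gt0//; lra.
suff [C hC] : exists C : R, forall x, 0 < x <= 1 -> mtot s x cc <= C.
  exists (C + A) => x x01; have /andP[x0 _] := x01.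
  by have /andP[_ h] := hA x x0; rewrite (le_trans h)// lerD2r hC.
rewrite /mtot; move: S_itv; elim: S => [|b S' IH] hS.
  by exists 0 => x _; rewrite big_nil.
have [|C hC] := IH; first by move=> b' b'S; apply: hS; rewrite inE b'S orbT.
have /andP[b0 b1] := hS b (mem_head _ _).
have [C1 hC1] := mint_bounded q_gt0 s0 qs cc0 b0.
have b1' : 0 <= 1 - b by rewrite subr_ge0.
have [C2 hC2] := mint_bounded q_gt0 s0 qs cc0 b1'.
exists (C1 + C2 + C) => x x01; rewrite big_cons.
by rewrite lerD ?hC// lerD ?hC1 ?hC2.
Qed.

Lemma qint_lower s : 0 <= s -> exists2 k : R, 0 < k &
  forall x, 0 < x <= 1 -> k <= qint s x.
Proof.
move=> s0; have B0 : 0 <= B by have /andP[h1 h2] := E_bnd 0; apply: le_trans h2.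
have k0 : 0 < (1 + B) `^ (- s) by rewrite powR_gt0// ltr_wpDr.
exists ((1 + B) `^ (- s)) => // x /andP[x0 x1].
rewrite -[leLHS]mulr1 -[X in _ * X <= _]subr0.
apply: (@Rintegral_lower _ (fun a => (x + E a) `^ (- s)) 0 1 0 1 _ (x `^ (- s))) => //.
- exact: measurable_qker.
- move=> y; rewrite powR_ge0/=; apply: powR_le_neg => //.
  by rewrite lerDl; have /andP[] := E_bnd y.
- move=> y _; apply: powR_le_neg => //; have /andP[E0 EB] := E_bnd y.
    by rewrite ltr_wpDr.
  exact: lerD.
Qed.

End Sandwich.

(** * The clock *)

(** The quantities evolving in time are only known to be continuous at 0 from
    the right, which is what the mean value theorem asks for. *)
Lemma MVT_from_right (R : realType) (f df : R -> R) (t : R) : 0 < t ->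
  f s @[s --> 0^'+] --> f 0 ->
  (forall s, 0 < s <= t -> is_derive s 1 f (df s)) ->
  exists2 c, 0 < c < t & f t - f 0 = df c * t.
Proof.
move=> t0 f0 dF.
have dF' s : s \in `]0, t[ -> is_derive s 1 f (df s).
  by rewrite in_itv/= => /andP[s0 st]; apply: dF; rewrite s0 ltW.
have [|c] := MVT t0 dF'; last by rewrite in_itv/= subr0; exists c.
apply/continuous_within_itvP => //; split => //.
  by move=> s /dF'; exact: der_continuous.
apply: cvg_at_left_filter; apply: (@der_continuous _ _ _ (df t)).
by apply: dF; rewrite t0 lexx.
Qed.

Section TimeChange.
Variables (R : realType) (rho : R -> R) (E : R).
Hypothesis E_gt0 : 0 < E.
Hypothesis rho_gt0 : forall e, 0 <= e < E -> 0 < rho e.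
Hypothesis rho_cont : forall e, 0 <= e < E -> {for e, continuous rho}.

(** If d eta / dt = 1 / rho(eta), then tclock e is the time at which eta reaches
    e. *)
Definition tclock (e : R) : R := \int[leb]_(s in `[0%R, e]) rho s.

Lemma rho_within (b : R) : b < E -> {within `[0, b], continuous rho}.
Proof.
move=> bE; apply: continuous_in_subspaceT => e /set_mem /=.
by rewrite in_itv/= => /andP[e0 eb]; apply: rho_cont; rewrite e0 (le_lt_trans eb).
Qed.

Lemma rho_integrable (b : R) : b < E ->
  (@lebesgue_measure R).-integrable `[0%R, b] (EFin \o rho).
Proof.
by move=> bE; apply: continuous_compact_integrable; [exact: segment_compact|exact: rho_within].
Qed.

Lemma tclock0 : tclock 0 = 0. Proof. exact: Rintegral_itv0. Qed.

Lemma der_tclock e : 0 < e < E -> is_derive e 1 tclock (rho e).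
Proof.
move=> /andP[e0 eE]; pose u := (e + E) / 2.
have eu : e < u by rewrite midf_lt.
have uE : u < E by rewrite midf_lt.
have ce : {for e, continuous rho} by apply: rho_cont; rewrite ltW.
have [d1 d2] := continuous_FTC1_closed eu (rho_integrable uE) e0 ce.
by constructor; [exact: d1|exact: (etrans (esym (derive1E _ _)) d2)].
Qed.

Lemma tclock_within (b : R) : 0 <= b -> b < E -> {within `[0, b], continuous tclock}.
Proof.
by move=> b0 bE; apply: (parameterized_integral_continuous b0); exact: rho_integrable.
Qed.

Lemma tclock_right0 : tclock e @[e --> 0^'+] --> tclock 0.
Proof.
have h0 : 0 < E / 2 by rewrite divr_gt0.
have hE : E / 2 < E by rewrite ltr_pdivrMr// ltr_pMr// ltr1n.
by have /(continuous_within_itvP _ h0)[] := tclock_within (ltW h0) hE.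
Qed.

Lemma tclock_lt a b : 0 <= a -> a < b -> b < E -> tclock a < tclock b.
Proof.
move=> a0 ab bE.
have dF s : s \in `]a, b[ -> is_derive s 1 tclock (rho s).
  by rewrite in_itv/= => /andP[sa sb]; apply: der_tclock; rewrite (le_lt_trans a0 sa) (lt_trans sb).
have [|c] := MVT ab dF.
  apply: continuous_subspaceW (tclock_within (le_trans a0 (ltW ab)) bE).
  by move=> s /=; rewrite !in_itv/= => /andP[as_ ->]; rewrite (le_trans a0 as_).
rewrite in_itv/= => /andP[ac cb] eq; rewrite -subr_gt0 eq mulr_gt0 ?subr_gt0//.
by apply: rho_gt0; rewrite (le_trans a0 (ltW ac)) (lt_trans cb).
Qed.

Lemma tclock_le a b : 0 <= a -> a <= b -> b < E -> tclock a <= tclock b.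
Proof.
by move=> a0; rewrite le_eqVlt => /predU1P[->//|ab] bE; apply/ltW/tclock_lt.
Qed.

Definition tfinal : \bar R := lim ((tclock e)%:E @[e --> E^'-]).

(** The clock is increasing, so its limit exists in the extended reals. *)
Lemma tfinal_sup : tfinal = ereal_sup [set (tclock e)%:E | e in `]0%R, E[].
Proof.
apply/cvg_lim => //; apply/cvg_at_leftNP.
have NE : - E < 0 by rewrite oppr_lt0.
have := @nonincreasing_at_right_cvge R (fun e => (tclock (- e))%:E) (- E) (BLeft 0).
rewrite bnd_simp => /(_ NE) h.
have -> : [set (tclock e)%:E | e in `]0, E[] = [set (tclock (- e))%:E | e in [set` Interval (BRight (- E)) (BLeft 0)]].
  apply/seteqP; split => _ [e + <-]; rewrite /= in_itv/= => /andP[e0 eE].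
    by exists (- e); rewrite ?opprK//= in_itv/= oppr_lt0 e0 ltrN2 eE.
  by exists (- e); rewrite ?opprK//= in_itv/= oppr_gt0 eE ltrNl e0.
apply: h => a b; rewrite !in_itv/= => /andP[a1 a2] /andP[b1 b2] ab.
by rewrite lee_fin tclock_le// ?lerN2// ?oppr_ge0 ?(ltW b2)// ltrNl.
Qed.

Lemma tclock_lt_tfinal e : 0 <= e < E -> ((tclock e)%:E < tfinal)%E.
Proof.
move=> /andP[e0 eE]; pose u := (e + E) / 2.
have eu : e < u by rewrite midf_lt.
have uE : u < E by rewrite midf_lt.
apply: (@lt_le_trans _ _ (tclock u)%:E); first by rewrite lte_fin tclock_lt.
rewrite tfinal_sup; apply: ereal_sup_ubound; exists u => //=.
by rewrite in_itv/= uE (le_lt_trans e0 eu).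
Qed.

Lemma tfinal_gt0 : (0 < tfinal)%E.
Proof. by have := @tclock_lt_tfinal 0; rewrite tclock0; apply; rewrite lexx. Qed.

Lemma tclock_surj t : 0 <= t -> (t%:E < tfinal)%E -> exists2 e, 0 <= e < E & tclock e = t.
Proof.
move=> t0; rewrite tfinal_sup => /ereal_sup_gt[_ [b + <-]].
rewrite /= in_itv/= lte_fin => /andP[b0 bE] tb.
have [||e + et] := @IVT R tclock 0 b t (ltW b0).
- exact: tclock_within (ltW b0) bE.
- by rewrite ge_min tclock0 t0 le_max (ltW tb) orbT.
rewrite in_itv/= => /andP[e0 eb]; exists e => //.
by rewrite e0 (le_lt_trans eb).
Qed.

Definition tinv (t : R) : R := xget 0 [set e | 0 <= e < E /\ tclock e = t].

Lemma tinvP t : 0 <= t -> (t%:E < tfinal)%E -> 0 <= tinv t < E /\ tclock (tinv t) = t.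
Proof.
move=> t0 tT; have [e eE et] := tclock_surj t0 tT.
by apply: (@xgetPex _ 0 [set e | 0 <= e < E /\ tclock e = t]); exists e.
Qed.

Lemma tclock_inj a b : 0 <= a < E -> 0 <= b < E -> tclock a = tclock b -> a = b.
Proof.
move=> /andP[a0 aE] /andP[b0 bE] ab; case: (ltgtP a b) => // h.
  by have := tclock_lt a0 h bE; rewrite ab ltxx.
by have := tclock_lt b0 h aE; rewrite ab ltxx.
Qed.

Lemma tinvK e : 0 <= e < E -> tinv (tclock e) = e.
Proof.
move=> eE; have t0 : 0 <= tclock e.
  by rewrite -tclock0 tclock_le//; case/andP: eE.
have [h1 h2] := tinvP t0 (tclock_lt_tfinal eE).
exact: tclock_inj.
Qed.

Lemma tinv0 : tinv 0 = 0.
Proof. by rewrite -{1}tclock0 tinvK// lexx. Qed.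

Lemma tinv_evolves : evolves tfinal tinv (fun t => (rho (tinv t))^-1).
Proof.
split.
  rewrite tinv0; apply/cvgrPdist_lt => r r0.
  pose b := Num.min r (E / 2).
  have b0 : 0 < b by rewrite lt_min r0 divr_gt0.
  have bE : b < E by rewrite gt_min ltr_pdivrMr// ltr_pMr// ltr1n orbT.
  have Pb : 0 < tclock b by rewrite -tclock0 tclock_lt.
  near=> t.
  have t0 : 0 < t by near: t; exact: nbhs_right_gt.
  have tb : t < tclock b by near: t; exact: nbhs_right_lt.
  have tT : (t%:E < tfinal)%E.
    by apply: lt_trans (tclock_lt_tfinal (_ : 0 <= b < E)); rewrite ?lte_fin// ltW.
  have [/andP[i0 iE] it] := tinvP (ltW t0) tT.
  rewrite sub0r normrN ger0_norm//; apply: (@lt_le_trans _ _ b); last by rewrite ge_min lexx.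
  rewrite ltNge; apply/negP => bi; have := tclock_le (ltW b0) bi iE.
  by rewrite it leNgt tb.
move=> t t0 tT; have [/andP[i0 iE] it] := tinvP (ltW t0) tT.
have i0' : 0 < tinv t.
  rewrite lt_neqAle i0 andbT; apply/eqP => i00.
  by move: it; rewrite -i00 tclock0 => t00; rewrite -t00 ltxx in t0.
have nE : \forall e \near tinv t, 0 < e < E.
  near=> e; apply/andP; split; near: e; [exact: lt_nbhsr|exact: lt_nbhsl].
have := @is_derive_inverse R tclock tinv (rho (tinv t)) (tinv t).
rewrite it; apply.
- by apply: filterS nE => e /andP[e0 eE]; apply: tinvK; rewrite ltW.
- by apply: filterS nE => e eE; exact: der_continuous (der_tclock eE).
- by apply: der_tclock; rewrite i0'.
- by rewrite gt_eqF// rho_gt0// i0.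
Unshelve. all: by end_near. Qed.

Lemma near_leftP (P : set R) : (\forall e \near E^'-, P e) ->
  exists2 e0, 0 <= e0 < E & forall e, e0 < e < E -> P e.
Proof.
move=> [r /= r0 hr]; exists (Num.max 0 (E - r)).
  by rewrite le_max lexx gt_max E_gt0 ltrBlDr ltrDl r0.
move=> e /andP[]; rewrite gt_max => /andP[e0 er] eE; apply: hr => //=.
by rewrite gtr0_norm ?subr_gt0// ltrBlDr addrC -ltrBlDr.
Qed.

Section Uniqueness.
Variable eta : R -> R.
Hypothesis eta0 : eta 0 = 0.
Hypothesis eta_itv : forall t, 0 <= t -> (t%:E < tfinal)%E -> 0 <= eta t < E.
Hypothesis eta_ev : evolves tfinal eta (fun t => (rho (eta t))^-1).

Lemma eta_gt0 t : 0 < t -> (t%:E < tfinal)%E -> 0 < eta t.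
Proof.
move=> t0 tT; have [c0 dE] := eta_ev.
have lt s : s <= t -> (s%:E < tfinal)%E by move=> st; apply: le_lt_trans tT; rewrite lee_fin.
have [|c /andP[c1 c2]] := MVT_from_right t0 c0 (df := fun t => (rho (eta t))^-1).
  by move=> s /andP[s0 st]; apply: dE => //; exact: lt.
rewrite eta0 subr0 => ->; rewrite mulr_gt0// invr_gt0 rho_gt0//.
by apply: eta_itv; [exact: ltW|exact/lt/ltW].
Qed.

Lemma eta_right0 : eta s @[s --> 0^'+] --> 0^'+.
Proof.
have [c0 _] := eta_ev; rewrite eta0 in c0.
move=> A /= [r /= r0 rA]; have := c0; move/cvgrPdist_lt => /(_ _ r0) h.
rewrite /nbhs/=; near=> s.
have s0 : 0 < s by near: s; exact: nbhs_right_gt.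
apply: rA; first by rewrite /=; near: s; exact: h.
apply: eta_gt0 => //; near: s; apply: near_right_lt_ereal; exact: tfinal_gt0.
Unshelve. all: by end_near. Qed.

(** tclock o eta - id has zero derivative: whatever the solution of the
    differential equation, it is the inverse of the clock. *)
Lemma tclock_eta t : 0 <= t -> (t%:E < tfinal)%E -> tclock (eta t) = t.
Proof.
rewrite le_eqVlt => /predU1P[<- _|t0 tT]; first by rewrite eta0 tclock0.
have [c0 dE] := eta_ev.
have lt s : s <= t -> (s%:E < tfinal)%E by move=> st; apply: le_lt_trans tT; rewrite lee_fin.
pose f s := tclock (eta s) - s.
have f0 : f 0 = 0 by rewrite /f eta0 tclock0 subr0.
have [||c _] := @MVT_from_right R f (fun=> 0) t t0.
- rewrite /f eta0; apply: cvgB; last exact: cvg_at_right_filter cvg_id.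
  exact: (cvg_comp _ _ eta_right0 tclock_right0).
- move=> s /andP[s0 st]; have sT := lt _ st.
  have /andP[_ eE] := eta_itv (ltW s0) sT.
  have dc : is_derive (eta s) 1 tclock (rho (eta s)).
    by apply: der_tclock; rewrite eta_gt0.
  have D := derB (der_comp dc (dE s s0 sT)) (der_id s).
  by apply: (der_eq D); rewrite divff ?subrr// gt_eqF// rho_gt0// eE ltW// eta_gt0.
by rewrite mul0r f0 subr0 => /eqP; rewrite subr_eq0 => /eqP.
Qed.

Lemma eta_gt t e : 0 <= e < E -> tclock e < t -> (t%:E < tfinal)%E -> e < eta t < E.
Proof.
move=> /andP[e0 eE] et tT.
have t0 : 0 <= t.
  by apply: le_trans (ltW et); rewrite -tclock0 tclock_le.
have /andP[i0 iE] := eta_itv t0 tT; rewrite iE andbT ltNge; apply/negP => ie.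
by have := tclock_le i0 ie eE; rewrite tclock_eta// leNgt et.
Qed.

Lemma eta_cvg_left ts : tfinal = ts%:E -> eta t @[t --> ts^'-] --> E^'-.
Proof.
move=> Tts A /near_leftP[e0 e0E hA]; rewrite /nbhs/=.
have : tclock e0 < ts by rewrite -lte_fin -Tts tclock_lt_tfinal.
move=> h; near=> t; apply: hA.
have h1 : tclock e0 < t by near: t; exact: nbhs_left_gt.
have h2 : (t%:E < tfinal)%E by rewrite Tts lte_fin; near: t; exact: nbhs_left_lt.
exact: eta_gt.
Unshelve. all: by end_near. Qed.

Lemma eta_cvg_pinfty : tfinal = +oo%E -> eta t @[t --> +oo] --> E^'-.
Proof.
move=> Tts A /near_leftP[e0 e0E hA]; rewrite /nbhs/=.
near=> t; apply: hA.
have h1 : tclock e0 < t by near: t; apply: nbhs_pinfty_gt; exact: num_real.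
by apply: eta_gt => //; rewrite Tts ltry.
Unshelve. all: by end_near. Qed.
End Uniqueness.

Lemma tclock_MVT (G dG : R -> R) a b : 0 < a -> a < b -> b < E ->
  (forall e, a <= e <= b -> is_derive e 1 G (dG e)) ->
  exists2 c, a < c < b & (tclock b + G b) - (tclock a + G a) = (rho c + dG c) * (b - a).
Proof.
move=> a0 ab bE dF.
have dT s : a <= s <= b -> is_derive s 1 (fun s => tclock s + G s) (rho s + dG s).
  move=> /andP[as_ sb]; apply: derD; last by apply: dF; rewrite as_.
  by apply: der_tclock; rewrite (lt_le_trans a0 as_) (le_lt_trans sb).
have dT' s : s \in `]a, b[ -> is_derive s 1 (fun s => tclock s + G s) (rho s + dG s).
  by rewrite in_itv/= => /andP[as_ sb]; apply: dT; rewrite !ltW.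
have [|c] := MVT ab dT'; last by rewrite in_itv/=; exists c.
apply: continuous_in_subspaceT => s /set_mem /=; rewrite in_itv/= => sab.
exact: der_continuous (dT s sab).
Qed.

(** tclock e + C ln (E - e) is nondecreasing near E, and the logarithm tends to
    - oo. *)
Lemma tfinal_pinfty (C : R) : 0 < C ->
  (\forall e \near E^'-, C / (E - e) <= rho e) -> tfinal = +oo%E.
Proof.
move=> C0 /near_leftP[e0 /andP[e00 e0E] he0].
case: (eqVneq tfinal +oo%E) => // Tfin; exfalso.
have [r Tr] : exists r, tfinal = r%:E.
  by move: Tfin tfinal_gt0; case: tfinal => [r| |]// _ _; exists r.
pose a := (e0 + E) / 2; have ea : e0 < a by rewrite midf_lt.
have aE : a < E by rewrite midf_lt.
have a0 : 0 < a by apply: le_lt_trans ea.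
pose G e := C * ln (E - e).
pose k := tclock a + G a.
(* The choice gives C ln y <= k - r - 1, so the clock exceeds r at E - y. *)
pose y := Num.min ((E - a) / 2) (expR ((k - r - 1) / C)).
have Ea : 0 < E - a by rewrite subr_gt0.
have y0 : 0 < y by rewrite lt_min divr_gt0// expR_gt0.
have ya : y < E - a by rewrite gt_min ltr_pdivrMr// ltr_pMr// ltr1n.
pose b := E - y.
have ab : a < b by rewrite /b ltrBrDr addrC -ltrBrDr.
have bE : b < E by rewrite /b ltrBlDr ltrDl.
have dG e : a <= e <= b -> is_derive e 1 G (- (C / (E - e))).
  move=> /andP[ae eb]; have Ee : 0 < E - e by rewrite subr_gt0 (le_lt_trans eb).
  have D := derM (der_cst C e) (@der_comp _ (@ln R) (fun e => E - e) _ _ _ (is_derive1_ln Ee) (derB (der_cst E e) (der_id e))).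
  by apply: (der_eq D); rewrite mul0r add0r sub0r mulrN1 mulrN.
have [c /andP[ac cb] eq] := tclock_MVT a0 ab bE dG.
have kb : k <= tclock b + G b.
  rewrite -subr_ge0 eq mulr_ge0// ?subr_ge0 ?(ltW ab)// he0//.
  by rewrite (lt_trans ea ac) (lt_trans cb bE).
have Gb : G b <= k - r - 1.
  rewrite /G /b opprB addrC subrK.
  apply: (@le_trans _ _ (C * ((k - r - 1) / C))); last by rewrite mulrC divfK ?gt_eqF.
  rewrite ler_pM2l// -[leRHS](expRK) ler_ln ?posrE ?expR_gt0//.
  by rewrite ge_min lexx orbT.
have := tclock_lt_tfinal (_ : 0 <= b < E); rewrite bE (ltW (lt_trans a0 ab)) => /(_ isT).
by rewrite Tr lte_fin ltNge => /negP; apply; lra.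
Qed.

(** tclock e + C / (1 - p) (E - e)^(1 - p) is nonincreasing near E, which bounds
    the clock. *)
Lemma tfinal_finite (C p : R) : 0 <= p < 1 ->
  (\forall e \near E^'-, rho e <= C * (E - e) `^ (- p)) ->
  exists2 ts, 0 < ts & tfinal = ts%:E.
Proof.
move=> /andP[p0 p1] /near_leftP[e0 /andP[e00 e0E] he0].
pose a := (e0 + E) / 2; have ea : e0 < a by rewrite midf_lt.
have aE : a < E by rewrite midf_lt.
have a0 : 0 < a by apply: le_lt_trans ea.
have q0 : 0 < 1 - p by rewrite subr_gt0.
have C0 : 0 < C.
  have h : rho a <= C * (E - a) `^ (- p) by apply: he0; rewrite ea.
  have ra : 0 < rho a by apply: rho_gt0; rewrite aE ltW.
  have := lt_le_trans ra h; rewrite pmulr_lgt0// powR_gt0// subr_gt0//.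
pose G e := C / (1 - p) * (E - e) `^ (1 - p).
pose k := tclock a + G a.
have bound b : a < b -> b < E -> tclock b <= k.
  move=> ab bE.
  have dG e : a <= e <= b -> is_derive e 1 G (- (C * (E - e) `^ (- p))).
    move=> /andP[ae eb]; have Ee : 0 < E - e by rewrite subr_gt0 (le_lt_trans eb).
    have D := derM (der_cst (C / (1 - p)) e) (@der_comp _ (@powR R ^~ (1 - p)) (fun e => E - e) _ _ _
      (is_derive1_powR (1 - p) Ee) (derB (der_cst E e) (der_id e))).
    apply: (der_eq D); rewrite mul0r add0r sub0r mulrN1.
    rewrite (_ : 1 - p - 1 = - p); last by ring.
    by field; rewrite gt_eqF.
  have [c /andP[ac cb] eq] := tclock_MVT a0 ab bE dG.
  apply: (@le_trans _ _ (tclock b + G b)).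
    by rewrite lerDl mulr_ge0 ?powR_ge0// divr_ge0// ltW.
  rewrite -subr_le0 -/k eq mulr_le0_ge0// ?subr_ge0 ?(ltW ab)// subr_le0 he0//.
  by rewrite (lt_trans ea ac) (lt_trans cb bE).
have Tk : (tfinal <= k%:E)%E.
  rewrite tfinal_sup; apply: ge_ereal_sup => _ [e + <-].
  rewrite /= in_itv/= lee_fin => /andP[e0' eE].
  pose b := (Num.max a e + E) / 2.
  have mE : Num.max a e < E by rewrite gt_max aE.
  have bE : b < E by rewrite midf_lt.
  have mb : Num.max a e < b by rewrite midf_lt.
  have [ab eb] : a < b /\ e < b by move: mb; rewrite gt_max => /andP.
  by apply: le_trans (bound b ab bE); apply: tclock_le => //; exact: ltW.
have := tfinal_gt0; move: Tk; case: tfinal => [r| |]//.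
by rewrite lte_fin => _ r0; exists r.
Qed.

End TimeChange.

(** * The maximum points of the datum *)

Section Data.
Variables (R : realType) (u0 du0 : R -> R) (M0 m0 q C1 : R).
Hypothesis hdata : initial_data u0 du0 M0 m0.
Hypothesis q_gt0 : 0 < q.
Hypothesis C1_lt0 : C1 < 0.
Hypothesis hprofile : max_profile du0 M0 q C1.

Definition depth (a : R) : R := M0 - du0 a.

Lemma depth_ge0 a : 0 <= depth a.
Proof. by rewrite subr_ge0; exact: id_max hdata a. Qed.

Lemma maxpoints : exists S : seq R, [/\ uniq S,
  forall b, b \in S <-> attained_at du0 M0 b & exists b, b \in S].
Proof.
have /finite_seqP[S hS] := id_max_fin hdata.
exists (undup S); have E b : b \in undup S <-> attained_at du0 M0 b.
  by rewrite hS mem_undup.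
split => //; first exact: undup_uniq.
by have [b hb] := id_max_att hdata; exists b; apply/E.
Qed.

Lemma normC1_gt0 : 0 < `|C1|.
Proof. by rewrite normr_gt0 lt_eqF. Qed.

Lemma profile_near dl b : 0 < dl -> attained_at du0 M0 b ->
  exists2 rho : R, 0 < rho & forall a, `|a - b| < rho ->
    (1 - dl) * `|C1| * absq q (a - b) <= depth a <= (1 + dl) * `|C1| * absq q (a - b).
Proof.
move=> dl0 hb; have /cvgrPdist_lt /(_ _ dl0) [r /= r0 hr] := hprofile hb.
exists r => // a ab; have [->|neq] := eqVneq a b.
  have -> : depth b = 0 by rewrite /depth (proj2 hb) subrr.
  by rewrite subrr absq0// !mulr0 lexx.
have := hr a; rewrite /= distrC => /(_ ab neq).
have k0 : 0 < `|C1| * absq q (a - b).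
  by rewrite mulr_gt0 ?normC1_gt0// absq_gt0// subr_eq0.
rewrite -/(depth a) -/(absq q (a - b)) ltr_norml => /andP[h1 h2].
rewrite -!mulrA -[depth a](divfK (lt0r_neq0 k0)) !ler_pM2r//.
by move: h1 h2; move: (depth a / _) => z *; apply/andP; split; lra.
Qed.

Lemma depth_near (S : seq R) : (forall b, b \in S -> attained_at du0 M0 b) ->
  forall dl : R, 0 < dl < 1 -> exists2 rho : R, 0 < rho &
  forall b a, b \in S -> `|a - b| < rho ->
    (1 - dl) * `|C1| * absq q (a - b) <= depth a <= (1 + dl) * `|C1| * absq q (a - b).
Proof.
move=> hS dl /andP[dl0 _]; elim: S hS => [|b0 S IH] hS; first by exists 1.
have [|r1 r10 h1] := IH; first by move=> b bS; apply: hS; rewrite inE bS orbT.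
have [r2 r20 h2] := profile_near dl0 (hS b0 (mem_head _ _)).
exists (Num.min r1 r2); first by rewrite lt_min r10.
move=> b a; rewrite inE lt_min => /orP[/eqP->|bS] /andP[ab1 ab2]; first exact: h2.
exact: h1.
Qed.

(** The zeros of the depth in R are the integer translates of those in [0, 1]. A
    radius smaller than the distances from the latter to the endpoints they
    differ from keeps the translates outside [0, 1] away from it. *)
Lemma endpoint_gap (S : seq R) rho : (forall b, b \in S -> 0 <= b <= 1) -> 0 < rho ->
  exists e : R, [/\ 0 < e, e <= rho, e <= 1 &
    forall b, b \in S -> (0 < b -> e <= b) /\ (b < 1 -> e <= 1 - b)].
Proof.
move=> hS r0; elim: S hS => [|b0 S IH] hS.
  by exists (Num.min rho 1); split => //; rewrite ?lt_min ?r0 ?ltr01// ge_min lexx ?orbT.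
have [|e [e0 er e1 he]] := IH; first by move=> b bS; apply: hS; rewrite inE bS orbT.
pose x := if 0 < b0 then b0 else 1; pose y := if b0 < 1 then 1 - b0 else 1.
have x0 : 0 < x by rewrite /x; case: ifP.
have y0 : 0 < y by rewrite /y; case: ifP => // h; rewrite subr_gt0.
exists (Num.min e (Num.min x y)); split.
- by rewrite !lt_min e0 x0.
- by rewrite ge_min er.
- by rewrite ge_min e1.
move=> b; rewrite inE => /orP[/eqP->|bS].
  by split => h; rewrite !ge_min /x /y h lexx ?orbT.
have [h1 h2] := he b bS.
by split => h; rewrite ge_min ?(h1 h) ?(h2 h).
Qed.

(** The hypothesis on the datum excludes neighbourhoods of the zeros on the whole
    line, whereas the integrals only see those of [0, 1]. An integer
    outside [0, 1] is at distance at least 1 from the interval; any other zero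
    is at least as far from it as its fractional part is from an endpoint. *)
Lemma depth_away (S : seq R) : (forall b, b \in S <-> attained_at du0 M0 b) ->
  forall rho : R, 0 < rho -> exists2 d : R, 0 < d &
  forall a : R, 0 <= a <= 1 -> (forall b, b \in S -> rho <= `|a - b|) -> d <= depth a.
Proof.
move=> hS rho r0.
have S01 b : b \in S -> 0 <= b <= 1 by move=> /hS[].
have [e [e0 er e1 he]] := endpoint_gap S01 r0.
have [d d0 hd] := id_max_away hdata e0.
exists d => // a a01 ha.
rewrite -[leRHS]ger0_norm ?depth_ge0// distrC; apply: hd => b fb.
have /andP[a0 a1] := a01.
have /andP[f0 f1] := fpart_bnd b.
have fS : fpart b \in S.
  apply/hS; split; first by rewrite f0 ltW.
  by rewrite (periodic_fpart (id_dper hdata)).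
have [h1 h2] := he _ fS.
have bE := ipart_fpart b.
have [b0|b0] := leP 0 b.
  have [b1|b1] := leP b 1.
    by apply: (le_trans er); apply: ha; apply/hS; split => //; rewrite b0 b1.
  rewrite distrC ger0_norm; last by rewrite subr_ge0 (le_trans a1)// ltW.
  suff : e <= b - 1 by lra.
  have n1 : 1 <= ipart b.
    have : 0 < ipart b by lra.
    by rewrite /ipart ltr0z -lez1D addr0 -(ler_int R).
  have [f00|/h1 ef] := leP (fpart b) 0; last by lra.
  have f00' : fpart b = 0 by apply: le_anti; rewrite f00.
  have n2 : 2 <= ipart b.
    have : 1 < ipart b by rewrite -(addr0 (ipart b)) -f00' bE.
    by rewrite /ipart ltr1z -lez1D -(ler_int R).
  by lra.
rewrite ger0_norm; last by rewrite subr_ge0 (le_trans (ltW b0)).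
suff : e <= - b by lra.
have n1 : ipart b <= -1.
  have : ipart b < 0 by lra.
  by rewrite /ipart -[0]/(0%:~R) ltr_int -[-1]/((-1)%:~R) ler_int.
by have := h2 f1; lra.
Qed.

End Data.

(** * Existence of the solution *)

Section Existence.
Variables (R : realType) (u0 du0 : R -> R) (M0 m0 lam : R) (h : R -> R).
Hypothesis hdata : initial_data u0 du0 M0 m0.
Hypothesis lam_ge0 : 0 <= lam.
Hypothesis mh : measurable_fun setT h.
Hypothesis hdu0 : {ae (@lebesgue_measure R), forall x, `[0%R, 1%R]%classic x -> h x = du0 x}.
Hypothesis hmM : forall x, m0 <= h x <= M0.

Lemma m0_lt0 : m0 < 0. Proof. by have /andP[] := id_sign hdata. Qed.
Lemma M0_gt0 : 0 < M0. Proof. by have /andP[] := id_sign hdata. Qed.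
Lemma du0_mM x : m0 <= du0 x <= M0.
Proof. by rewrite (id_min hdata) (id_max hdata). Qed.

Lemma ae_Rintegral01 (F : R -> R) :
  \int[leb]_(x in `[0%R, 1%R]) F (du0 x) = \int[leb]_(x in `[0%R, 1%R]) F (h x).
Proof.
apply: ae_eq_Rintegral_any.
have FF := ae_filter_ringOfSetsType (@lebesgue_measure R).
by apply: filterS hdu0 => x hx x01; rewrite hx.
Qed.

Lemma Kbar0_kint e : lam != 0 -> Kbar lam du0 0 e = kint0 lam h 1 e.
Proof.
move=> l0; rewrite /Kbar /Jac (ae_Rintegral01 (fun v => (1 - lam * e * v) `^ _)).
by apply: eq_Rintegral => x _; rewrite /jphi (negPf l0) oppr0 add0r.
Qed.

(** 1 / J = 1 + lam e jrat. *)
Lemma Kbar1_kint e : lam != 0 -> jdom lam m0 M0 e ->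
  Kbar lam du0 1 e = lam * e * kint1 lam h 1 e + kint0 lam h 1 e.
Proof.
move=> l0 de; rewrite -[X in _ + X]mul1r.
rewrite -(integral_linear lam_ge0 m0_lt0 M0_gt0 mh hmM)//.
rewrite /Kbar /Jac (ae_Rintegral01 (fun v => (1 - lam * e * v) `^ _)).
apply: eq_Rintegral => x _; have J0 := jac_gt0 de (hmM x).
rewrite mulr1n /jphi (negPf l0) powRD ?(gt_eqF J0) ?implybT// powR_inv1 ?ltW//.
by congr (_ * _); rewrite /jrat; field; rewrite gt_eqF.
Qed.

Lemma dom_below_eta_star e : 0 < lam -> 0 <= e < eta_star lam M0 -> jdom lam m0 M0 e.
Proof.
move=> l0 /andP[e0]; have M00 := M0_gt0; have m00 := m0_lt0.
rewrite /eta_star -[X in _ < X]mul1r ltr_pdivlMr ?mulr_gt0// => eE.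
have le0 : 0 <= lam * e by rewrite mulr_ge0// ltW.
split; first by move: eE; lra.
by have := mulr_ge0_le0 le0 (ltW m00); lra.
Qed.

Lemma eta_star_gt0 : 0 < lam -> 0 < eta_star lam M0.
Proof. by move=> l0; rewrite invr_gt0 mulr_gt0// M0_gt0. Qed.

(** The rate dt / d eta, whose integral defines the lifespan. *)
Definition clock_speed (e : R) : R := Kbar lam du0 0 e `^ (2 * lam).

Lemma Kbar0_gt0 e : 0 < lam -> 0 <= e < eta_star lam M0 -> 0 < Kbar lam du0 0 e.
Proof.
move=> l0 eE; rewrite Kbar0_kint ?gt_eqF//.
exact: (kint0_gt0 lam_ge0 m0_lt0 M0_gt0 mh hmM ltr01 (dom_below_eta_star l0 eE)).
Qed.

Lemma clock_speed_gt0 e : 0 < lam -> 0 <= e < eta_star lam M0 -> 0 < clock_speed e.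
Proof. by move=> l0 eE; rewrite powR_gt0// Kbar0_gt0. Qed.

Lemma clock_speed_continuous e : 0 < lam -> 0 <= e < eta_star lam M0 ->
  {for e, continuous clock_speed}.
Proof.
move=> l0 eE; have de := dom_below_eta_star l0 eE.
have K0 := Kbar0_gt0 l0 eE; rewrite Kbar0_kint ?gt_eqF// in K0.
have -> : clock_speed = fun e => kint0 lam h 1 e `^ (2 * lam).
  by apply/funext => e'; rewrite /clock_speed Kbar0_kint ?gt_eqF.
apply: der_continuous.
exact: (@der_comp _ (@powR R ^~ (2 * lam)) _ e _ _ (is_derive1_powR (2 * lam) K0)
  (der_kint0 lam_ge0 m0_lt0 M0_gt0 mh hmM 1 de)).
Qed.

Lemma tstar_tfinal : 0 < lam -> tstar lam du0 M0 = tfinal clock_speed (eta_star lam M0).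
Proof. by move=> l0; rewrite /tstar gt_eqF. Qed.

Lemma clock_speedV e : (clock_speed e)^-1 = Kbar lam du0 0 e `^ (- (2 * lam)).
Proof. by rewrite /clock_speed powRN. Qed.

Lemma eta_ode_tinv : 0 < lam ->
  eta_ode lam du0 M0 (tinv clock_speed (eta_star lam M0)).
Proof.
move=> l0; have E0 := eta_star_gt0 l0.
have rho0 e := @clock_speed_gt0 e l0; have rhoc e := @clock_speed_continuous e l0.
split; rewrite ?tstar_tfinal//.
- exact: tinv0.
- by move=> t t0 tT; have [] := tinvP E0 rho0 rhoc t0 tT.
- have := tinv_evolves E0 rho0 rhoc.
  by under eq_fun do rewrite clock_speedV.
Qed.

Lemma exists_solution_pos : 0 < lam -> exists u ux g : R -> R -> R,
  the_solution lam u0 du0 M0 u ux g.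
Proof.
move=> l0; have l_neq0 : lam != 0 by rewrite gt_eqF.
have [eta0 eta_itv eta_ev] := eta_ode_tinv l0.
set eta := tinv _ _ in eta0 eta_itv eta_ev.
have eta_dom t : 0 <= t -> (t%:E < tstar lam du0 M0)%E -> jdom lam m0 M0 (eta t).
  by move=> t0 tT; apply: dom_below_eta_star => //; exact: eta_itv.
have T0 : (0 < tstar lam du0 M0)%E.
  rewrite tstar_tfinal//; apply: tfinal_gt0.
  - exact: eta_star_gt0.
  - by move=> e; exact: clock_speed_gt0.
  - by move=> e; exact: clock_speed_continuous.
have ev : evolves (tstar lam du0 M0) eta (fun t => kint0 lam h 1 (eta t) `^ (- (2 * lam))).
  by under eq_fun do rewrite -Kbar0_kint//.
exists (flow_u lam u0 du0 h eta), (flow_ux lam du0 h eta), (flow_char lam h eta); split.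
  exact: (flow_ibvp lam_ge0 m0_lt0 M0_gt0 mh hmM du0_mM hdu0 (id_per hdata) (id_dper hdata) (id_prim hdata) T0 eta0 eta_dom ev).
rewrite (negPf l_neq0); exists eta; first by split.
have rep := flow_represented lam_ge0 m0_lt0 M0_gt0 mh hmM hdu0 eta_dom.
move=> t t0 tT; have [r1 r2 r3] := rep t t0 tT; split; first exact: r1.
  rewrite (_ : ga_formula lam du0 eta ^~ t = fun a => jphi lam (eta t) (du0 a) / kint0 lam h 1 (eta t))//.
  by apply/funext => a; rewrite /ga_formula /jphi (negPf l_neq0) Kbar0_kint.
move=> a; rewrite r3 /ux_formula; case: ifPn => [/eqP->|t_neq0].
  rewrite eta0; exact: (flow_strain_at0 lam hdu0 (id_per hdata) (id_prim hdata)).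
have t_gt0 : 0 < t by rewrite lt_def t_neq0.
have e_gt0 : 0 < eta t.
  have rho0 e := @clock_speed_gt0 e l0; have rhoc e := @clock_speed_continuous e l0.
  apply: (@eta_gt0 _ clock_speed (eta_star lam M0)) => //; rewrite -?tstar_tfinal//.
  by under eq_fun do rewrite clock_speedV.
have de := eta_dom t t0 tT.
have J0 := jac_gt0 de (du0_mM a).
have K0 : 0 < kint0 lam h 1 (eta t) by rewrite -Kbar0_kint// Kbar0_gt0// eta_itv.
rewrite /flow_strain /flow_scale Kbar0_kint// Kbar1_kint// /Jac /jrat powRN.
have P0 : 0 < kint0 lam h 1 (eta t) `^ (2 * lam) by rewrite powR_gt0.
move: (_ `^ _) P0 => P P0; field.
by rewrite l_neq0 !gt_eqF.
Qed.

(** Here the flow is run with eta t = t, and kappa = 1. *)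
Lemma exists_solution0 : lam = 0 -> exists u ux g : R -> R -> R,
  the_solution lam u0 du0 M0 u ux g.
Proof.
move=> l0; have l_eq0 : lam == 0 by rewrite l0.
have TE : tstar lam du0 M0 = +oo%E by rewrite /tstar l_eq0.
pose eta (t : R) := t.
have eta_dom t : 0 <= t -> (t%:E < tstar lam du0 M0)%E -> jdom lam m0 M0 (eta t).
  by move=> _ _; rewrite /jdom l0 !mul0r subr0.
have T0 : (0 < tstar lam du0 M0)%E by rewrite TE ltry.
have ev : evolves (tstar lam du0 M0) eta (fun t => kint0 lam h 1 (eta t) `^ (- (2 * lam))).
  split; first exact: cvg_at_right_filter cvg_id.
  by move=> t _ _; rewrite l0 mulr0 oppr0 powRr0; exact: der_id.
exists (flow_u lam u0 du0 h eta), (flow_ux lam du0 h eta), (flow_char lam h eta); split.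
  exact: (flow_ibvp lam_ge0 m0_lt0 M0_gt0 mh hmM du0_mM hdu0 (id_per hdata) (id_dper hdata) (id_prim hdata) T0 (erefl : eta 0 = 0) eta_dom ev).
rewrite l_eq0.
have rep := flow_represented lam_ge0 m0_lt0 M0_gt0 mh hmM hdu0 eta_dom.
have KE t : \int[leb]_(b in `[0%R, 1%R]) expR (t * du0 b) = kint0 lam h 1 t.
  rewrite (ae_Rintegral01 (fun v => expR (t * v))).
  by apply: eq_Rintegral => x _; rewrite /jphi l_eq0.
move=> t t0 tT; have [r1 r2 r3] := rep t t0 tT; split; first exact: r1.
  rewrite (_ : ga_formula0 du0 ^~ t = fun a => jphi lam (eta t) (du0 a) / kint0 lam h 1 (eta t))//.
  by apply/funext => a; rewrite /ga_formula0 /jphi l_eq0 KE.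
move=> a; rewrite r3 /ux_formula0 KE (ae_Rintegral01 (fun v => v * expR (t * v))).
rewrite /flow_strain /flow_scale /jrat l0 mulr0 oppr0 powRr0 !mul0r subr0 divr1 mul1r.
congr (_ - _ / _); apply: eq_Rintegral => x _.
by rewrite /jrat /jphi eqxx !mul0r subr0 divr1.
Qed.

Lemma exists_solution : exists u ux g : R -> R -> R, the_solution lam u0 du0 M0 u ux g.
Proof.
have [l0|l0] := eqVneq lam 0; first exact: exists_solution0.
by apply: exists_solution_pos; rewrite lt_def l0.
Qed.

End Existence.

(** * Limits of the rescaled velocity gradient *)

Lemma cvg_right0 (R : realType) : x @[x --> (0 : R)^'+] --> (0 : R).
Proof. exact: cvg_at_right_filter cvg_id. Qed.

Lemma cvg_inv_right0 (R : realType) : x^-1 @[x --> (0 : R)^'+] --> +oo.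
Proof.
apply/cvgryPge => A; near=> x.
have x0 : 0 < x by near: x; exact: nbhs_right_gt.
have hx : x < (`|A| + 1)^-1.
  by near: x; apply: nbhs_right_lt; rewrite invr_gt0 ltr_wpDl.
apply: (@le_trans _ _ (`|A| + 1)); first by rewrite (le_trans (ler_norm A))// lerDl.
by rewrite -[leLHS]invrK lef_pV2 ?posrE ?invr_gt0 ?ltr_wpDl// ltW.
Unshelve. all: by end_near. Qed.

Lemma cvg_pinfty_scaled (R : realType) (T : Type) (F : set_system T) (FF : ProperFilter F)
    (f g : T -> R) (l : R) : 0 < l ->
  f x @[x --> F] --> +oo -> g x @[x --> F] --> l -> f x * g x @[x --> F] --> +oo.
Proof.
move=> l0 /cvgryPge fy gl; apply/cvgryPge => A.
have l20 : 0 < l / 2 by rewrite divr_gt0.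
have ll : l / 2 < l by rewrite ltr_pdivrMr// ltr_pMr// ltr1n.
near=> x.
have h1 : `|A| / (l / 2) <= f x by near: x; exact: fy.
have h2 : l / 2 < g x by near: x; exact: cvgr_gt gl _ ll.
apply: (le_trans (ler_norm A)); rewrite -[leLHS](divfK (lt0r_neq0 l20)).
by apply: ler_pM => //; [rewrite divr_ge0// ltW|exact: ltW|exact: ltW].
Unshelve. all: by end_near. Qed.

Lemma cvg_ninfty_scaled (R : realType) (T : Type) (F : set_system T) (FF : ProperFilter F)
    (f g : T -> R) (l : R) : l < 0 ->
  f x @[x --> F] --> +oo -> g x @[x --> F] --> l -> f x * g x @[x --> F] --> -oo.
Proof.
move=> l0 fy gl; apply/cvgNry.
have : f x * - g x @[x --> F] --> +oo.
  by apply: (@cvg_pinfty_scaled _ _ _ _ _ _ (- l)) => //; [rewrite oppr_gt0|exact: cvgN].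
by under eq_fun do rewrite mulrN.
Qed.

Section RescaledVelocity.
Variables (R : realType) (lam : R) (Q0 Q1 : R -> R).
Hypothesis lam_gt0 : 0 < lam.

(** The value of u_x on a characteristic whose label has depth D, when the excess
    is x; Q0 and Q1 stand for the integrals over all labels of
    (x + depth)^(- 1/lam) and (x + depth)^(- 1/lam - 1). *)
Definition resvel (D x : R) : R :=
  Q0 x `^ (- (2 * lam)) * ((x + D)^-1 - Q1 x / Q0 x).

Lemma resvel_decr x D D' : 0 < x -> 0 <= D -> D <= D' -> resvel D' x <= resvel D x.
Proof.
move=> x0 D0 DD; rewrite ler_wpM2l ?powR_ge0// lerD2r.
by rewrite lef_pV2 ?posrE ?ltr_wpDr ?(le_trans D0)// lerD2l.
Qed.

Lemma cvg_indicator D : 0 <= D -> x / (x + D) @[x --> 0^'+] --> ((D == 0)%:R : R).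
Proof.
rewrite le_eqVlt => /predU1P[<-|D0].
  have e : \forall x \near (0 : R)^'+, 1 = x / (x + 0).
    near=> x; have x0 : 0 < x by near: x; exact: nbhs_right_gt.
    by rewrite addr0 divff// gt_eqF.
  by rewrite eqxx; apply: (cvg_trans (near_eq_cvg e)); exact: cvg_cst.
rewrite gt_eqF//= -[X in _ --> X](mul0r (0 + D)^-1); apply: cvgM; first exact: cvg_right0.
apply: cvgV; first by rewrite add0r gt_eqF.
by apply: cvgD; [exact: cvg_right0|exact: cvg_cst].
Unshelve. all: by end_near. Qed.

Section BothSingular.
Variables (p L0 L1 : R).
Hypothesis L1_gt0 : 0 < L1.
Hypothesis L1_lt_L0 : L1 < L0.
Hypothesis Q0_cvg : x `^ (lam^-1 - p) * Q0 x @[x --> 0^'+] --> L0.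
Hypothesis Q1_cvg : x `^ (lam^-1 + 1 - p) * Q1 x @[x --> 0^'+] --> L1.

Definition sing_limit (D : R) : R := L0 `^ (- (2 * lam)) * ((D == 0)%:R - L1 / L0).

Lemma L0_gt0 : 0 < L0. Proof. exact: lt_trans L1_lt_L0. Qed.

Lemma sing_limit0_gt0 : 0 < sing_limit 0.
Proof.
have L00 := L0_gt0.
by rewrite mulr_gt0 ?powR_gt0// eqxx subr_gt0 ltr_pdivrMr// mul1r.
Qed.

Lemma sing_limit_lt0 D : 0 < D -> sing_limit D < 0.
Proof.
have L00 := L0_gt0.
by move=> D0; rewrite /sing_limit gt_eqF// sub0r pmulr_rlt0 ?powR_gt0// oppr_lt0 divr_gt0.
Qed.

(** Multiplying numerators and denominators by the powers of x that make Q0 and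
    Q1 converge leaves the single power x^(1 - 2 lam p), whose exponent changes
    sign at lam = 1 / (2 p). *)
Lemma resvel_factor D : 0 <= D ->
  exists2 W : R -> R, W x @[x --> 0^'+] --> sing_limit D &
    forall x : R, 0 < x -> 0 < x `^ (lam^-1 - p) * Q0 x ->
      resvel D x = x `^ (1 - 2 * lam * p) * W x.
Proof.
move=> D0; pose A x := x `^ (lam^-1 - p) * Q0 x; pose B x := x `^ (lam^-1 + 1 - p) * Q1 x.
exists (fun x => A x `^ (- (2 * lam)) * (x / (x + D) - B x / A x)).
  apply: cvgM.
    have L00 := L0_gt0.
    apply: (@cvg_comp _ _ _ A (@powR R ^~ (- (2 * lam))) _ (nbhs L0)) => //.
    exact: der_continuous (is_derive1_powR (- (2 * lam)) L00).
  apply: cvgB; first exact: cvg_indicator.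
  by apply: cvgM => //; apply: cvgV => //; rewrite gt_eqF// L0_gt0.
move=> x x0 A0.
have xp r : 0 < x `^ r by rewrite powR_gt0.
have Q00 : 0 < Q0 x by rewrite -(pmulr_rgt0 _ (xp (lam^-1 - p))).
have -> : B x / A x = x * (Q1 x / Q0 x).
  rewrite /A /B (_ : lam^-1 + 1 - p = (lam^-1 - p) + 1); last by ring.
  rewrite powRD ?(gt_eqF x0) ?implybT// powRr1 ?ltW//.
  by field; rewrite !gt_eqF.
rewrite /A powRM ?ltW// -powRrM mulrA mulrA -powRD ?(gt_eqF x0) ?implybT//.
have -> : 1 - 2 * lam * p + (lam^-1 - p) * - (2 * lam) = - 1.
  by field; rewrite gt_eqF.
rewrite powR_inv1 ?ltW// /resvel.
by field; rewrite !gt_eqF// ltr_wpDr.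
Qed.

Lemma near_Q0_gt0 : \forall x \near (0 : R)^'+, 0 < x `^ (lam^-1 - p) * Q0 x.
Proof. by apply: cvgr_gt Q0_cvg _ _; exact: L0_gt0. Qed.

Lemma resvel_vanish D : 0 <= D -> 2 * lam * p < 1 -> resvel D x @[x --> 0^'+] --> (0 : R).
Proof.
move=> D0 h; have [W Wc WE] := resvel_factor D0.
have : x `^ (1 - 2 * lam * p) * W x @[x --> 0^'+] --> (0 : R).
  rewrite -[X in _ --> X](mul0r (sing_limit D)); apply: cvgM => //.
  by apply: powR_cvg0; rewrite subr_gt0.
apply: cvg_trans; apply: near_eq_cvg; near=> x; apply/esym/WE.
  by near: x; exact: nbhs_right_gt.
by near: x; exact: near_Q0_gt0.
Unshelve. all: by end_near. Qed.

Lemma resvel_steady D : 0 <= D -> 2 * lam * p = 1 ->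
  resvel D x @[x --> 0^'+] --> sing_limit D.
Proof.
move=> D0 h; have [W Wc WE] := resvel_factor D0.
apply: cvg_trans Wc; apply: near_eq_cvg; near=> x.
have x0 : 0 < x by near: x; exact: nbhs_right_gt.
have A0 : 0 < x `^ (lam^-1 - p) * Q0 x by near: x; exact: near_Q0_gt0.
by rewrite WE// h subrr powRr0 mul1r.
Unshelve. all: by end_near. Qed.

Lemma cvg_powR_neg_right0 (r : R) : r < 0 -> x `^ r @[x --> 0^'+] --> +oo.
Proof.
rewrite -oppr_gt0 => /cvg_powR_right0_pinfty; apply: cvg_trans; apply: near_eq_cvg.
near=> x; have x0 : 0 < x by near: x; exact: nbhs_right_gt.
by rewrite -powR_inv1 ?ltW// -powRrM mulN1r opprK.
Unshelve. all: by end_near. Qed.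

Lemma resvel_blowup D : 0 <= D -> 1 < 2 * lam * p ->
  (D = 0 -> resvel D x @[x --> 0^'+] --> +oo) /\
  (0 < D -> resvel D x @[x --> 0^'+] --> -oo).
Proof.
move=> D0 h; have [W Wc WE] := resvel_factor D0.
have e0 : 1 - 2 * lam * p < 0 by rewrite subr_lt0.
have eqV : \forall x \near (0 : R)^'+, x `^ (1 - 2 * lam * p) * W x = resvel D x.
  near=> x; apply/esym/WE; first by near: x; exact: nbhs_right_gt.
  by near: x; exact: near_Q0_gt0.
split=> hD; apply: cvg_trans (near_eq_cvg eqV) _.
  apply: cvg_pinfty_scaled Wc; last exact: cvg_powR_neg_right0.
  by rewrite hD; exact: sing_limit0_gt0.
apply: cvg_ninfty_scaled Wc; last exact: cvg_powR_neg_right0.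
exact: sing_limit_lt0.
Unshelve. all: by end_near. Qed.
End BothSingular.

Section BoundedQ0.
Variables (k C : R).
Hypothesis k_gt0 : 0 < k.
Hypothesis Q0_bnd : forall x, 0 < x <= 1 -> k <= Q0 x <= C.
Hypothesis Q1_ge0 : forall x, 0 <= Q1 x.

Lemma Q0_upper_gt0 : 0 < C.
Proof.
have := @Q0_bnd 1; rewrite ltr01 lexx => /(_ isT)/andP[h1 h2].
exact: lt_le_trans k_gt0 (le_trans h1 h2).
Qed.

Lemma near_right_unit : \forall x \near (0 : R)^'+, 0 < x <= 1.
Proof.
near=> x; apply/andP; split; near: x; [exact: nbhs_right_gt|exact: nbhs_right_le].
Unshelve. all: by end_near. Qed.

Lemma pref_lower x : 0 < x <= 1 -> C `^ (- (2 * lam)) <= Q0 x `^ (- (2 * lam)).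
Proof.
move=> /Q0_bnd/andP[h1 h2]; apply: powR_le_neg => //; last by rewrite (lt_le_trans k_gt0).
by rewrite mulr_ge0// ltW.
Qed.

(** Q1 is negligible with respect to 1 / x, hence 1 / x dominates at depth 0. *)
Lemma resvel_max_blowup : x * Q1 x @[x --> 0^'+] --> (0 : R) ->
  resvel 0 x @[x --> 0^'+] --> +oo.
Proof.
move=> xQ1; have C0 : 0 < C `^ (- (2 * lam)) by rewrite powR_gt0// Q0_upper_gt0.
have : x^-1 * (C `^ (- (2 * lam)) * (1 / 2)) @[x --> 0^'+] --> +oo.
  apply: (@cvg_pinfty_scaled _ _ _ _ _ _ (C `^ (- (2 * lam)) * (1 / 2))); last exact: cvg_cst.
    by rewrite mulr_gt0.
  exact: cvg_inv_right0.
move=> /cvgryPge h; apply/cvgryPge => A; near=> x.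
have x01 : 0 < x <= 1 by near: x; exact: near_right_unit.
have /andP[x0 x1] := x01; have /andP[h1 h2] := Q0_bnd x01.
have Q00 : 0 < Q0 x by apply: lt_le_trans h1.
have hx : x * Q1 x < k / 2 by near: x; apply: cvgr_lt xQ1 _ _; rewrite divr_gt0.
apply: (@le_trans _ _ (x^-1 * (C `^ (- (2 * lam)) * (1 / 2)))); first by near: x; exact: h.
rewrite /resvel mulrCA addr0; apply: ler_pM.
- exact: ltW.
- by rewrite mulr_ge0// invr_ge0 ltW.
- exact: pref_lower.
rewrite (_ : x^-1 - Q1 x / Q0 x = x^-1 * (1 - x * Q1 x / Q0 x)); last by field; rewrite !gt_eqF.
rewrite ler_pM2l ?invr_gt0//.
suff : x * Q1 x / Q0 x <= 1 / 2 by lra.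
by rewrite ler_pdivrMr//; move: hx h1; lra.
Unshelve. all: by end_near. Qed.

(** At positive depth 1 / (x + D) stays bounded, so the mean Q1 / Q0 dominates. *)
Lemma resvel_min_blowup D : 0 < D -> Q1 x @[x --> 0^'+] --> +oo ->
  resvel D x @[x --> 0^'+] --> -oo.
Proof.
move=> D0 Q1y; have C0 := Q0_upper_gt0.
have P0 : 0 < C `^ (- (2 * lam)) by rewrite powR_gt0.
apply/cvgrNyPle => A; near=> x.
have x01 : 0 < x <= 1 by near: x; exact: near_right_unit.
have /andP[x0 x1] := x01; have /andP[h1 h2] := Q0_bnd x01.
have Q00 : 0 < Q0 x by apply: lt_le_trans h1.
pose N := `|A| / C `^ (- (2 * lam)).
have hx : (D^-1 + N) * C <= Q1 x by near: x; move/cvgryPge : Q1y; apply.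
have inner : (x + D)^-1 - Q1 x / Q0 x <= - N.
  have i1 : (x + D)^-1 <= D^-1 by rewrite lef_pV2 ?posrE ?addr_gt0// lerDr ltW.
  have i2 : D^-1 + N <= Q1 x / Q0 x.
    rewrite ler_pdivlMr//; apply: le_trans hx; rewrite ler_wpM2l//.
    by rewrite addr_ge0 ?invr_ge0 ?divr_ge0// ltW.
  by lra.
apply: (@le_trans _ _ (C `^ (- (2 * lam)) * - N)); last first.
  by rewrite /N mulrN mulrC divfK ?gt_eqF// lerNl -normrN ler_norm.
have N0 : 0 <= N by rewrite divr_ge0// ltW.
apply: (@le_trans _ _ (Q0 x `^ (- (2 * lam)) * - N)).
  by rewrite /resvel ler_wpM2l// powR_ge0.
by rewrite !mulrN lerN2 ler_wpM2r// pref_lower.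
Unshelve. all: by end_near. Qed.

Lemma resvel_bounded D C1 : 0 < D -> (forall x, 0 < x <= 1 -> Q1 x <= C1) ->
  exists B : R, \forall x \near (0 : R)^'+, `|resvel D x| <= B.
Proof.
move=> D0 Q1C; exists (k `^ (- (2 * lam)) * (D^-1 + C1 / k)); near=> x.
have x01 : 0 < x <= 1 by near: x; exact: near_right_unit.
have /andP[x0 x1] := x01; have /andP[h1 h2] := Q0_bnd x01.
have Q00 : 0 < Q0 x by apply: lt_le_trans h1.
rewrite normrM ger0_norm ?powR_ge0//; apply: ler_pM; rewrite ?powR_ge0//.
  by apply: powR_le_neg => //; rewrite mulr_ge0// ltW.
apply: (le_trans (ler_normB _ _)).
rewrite ger0_norm ?invr_ge0 ?addr_ge0 ?(ltW x0) ?(ltW D0)//.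
rewrite ger0_norm ?divr_ge0 ?(ltW Q00)// lerD//.
  by rewrite lef_pV2 ?posrE ?addr_gt0// lerDr ltW.
by apply: ler_pM => //; [rewrite invr_ge0 ltW|exact: Q1C|rewrite lef_pV2].
Unshelve. all: by end_near. Qed.
End BoundedQ0.
End RescaledVelocity.

(** * The solution as a function of the excess *)

Section ClockVariable.
Variables (R : realType) (u0 du0 : R -> R) (M0 m0 lam : R) (h : R -> R).
Hypothesis hdata : initial_data u0 du0 M0 m0.
Hypothesis lam_gt0 : 0 < lam.
Hypothesis mh : measurable_fun setT h.
Hypothesis hdu0 : {ae (@lebesgue_measure R), forall x, `[0%R, 1%R]%classic x -> h x = du0 x}.
Hypothesis hmM : forall x, m0 <= h x <= M0.

Local Notation Es := (eta_star lam M0).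
Local Notation dep := (fun a => M0 - h a).
Local Notation Q i := (qint (fun a => M0 - h a) (lam^-1 + i%:R)).

(** J = lam e (excess e + M0 - u0'), so the excess is the distance to the
    vanishing of J at the maximum points; it decreases to 0 as e increases to
    eta_star. *)
Definition excess (e : R) : R := (lam * e)^-1 - M0.

Lemma excess_gt0 e : 0 < e < Es -> 0 < excess e.
Proof.
move=> /andP[e0 eE]; have M00 := M0_gt0 hdata.
rewrite subr_gt0 -[M0]invrK ltf_pV2 ?posrE ?invr_gt0 ?mulr_gt0//.
by rewrite mulrC -ltr_pdivlMr// -invfM mulrC.
Qed.

Lemma excessE e : 0 < e -> excess e = M0 * (Es - e) / e.
Proof.
move=> e0; have M00 := M0_gt0 hdata; rewrite /excess /eta_star.
by field; rewrite !gt_eqF.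
Qed.

Lemma near_Es : \forall e \near Es^'-, Es / 2 < e < Es.
Proof.
have E0 : 0 < Es := eta_star_gt0 hdata lam_gt0.
near=> e; apply/andP; split; near: e; last exact: nbhs_left_lt.
by apply: nbhs_left_gt; rewrite ltr_pdivrMr// ltr_pMr// ltr1n.
Unshelve. all: by end_near. Qed.

Lemma excess_cvg : excess e @[e --> Es^'-] --> (0 : R)^'+.
Proof.
have E0 : 0 < Es := eta_star_gt0 hdata lam_gt0; have M00 := M0_gt0 hdata.
have c : excess e @[e --> Es^'-] --> excess Es.
  apply: cvg_at_left_filter; apply: der_continuous.
  have l0 : (fun e => lam * e) Es != 0 by rewrite mulf_neq0// gt_eqF.
  exact: (derB (derV (derM (der_cst lam Es) (der_id Es)) l0) (der_cst M0 Es)).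
have x0 : excess Es = 0 by rewrite excessE// subrr mulr0 mul0r.
rewrite x0 in c; move=> A /= [r /= r0 rA].
move/cvgrPdist_lt : c => /(_ _ r0) c; rewrite /nbhs/=; near=> e.
apply: rA; first by rewrite /=; near: e; exact: c.
have /andP[h1 h2] : Es / 2 < e < Es by near: e; exact: near_Es.
by apply: excess_gt0; rewrite h2 (lt_trans _ h1)// divr_gt0.
Unshelve. all: by end_near. Qed.

Lemma near_excess (P : R -> Prop) : (\forall x \near (0 : R)^'+, P x) ->
  \forall e \near Es^'-, P (excess e).
Proof. exact: excess_cvg. Qed.

Lemma hdepth_bnd a : 0 <= dep a <= M0 - m0.
Proof. by have /andP[h1 h2] := hmM a; rewrite subr_ge0 h2 lerD2l lerN2. Qed.

Lemma measurable_hdepth : measurable_fun setT dep.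
Proof. exact: measurable_funB. Qed.

Lemma hdepth_depth : {ae (@lebesgue_measure R), forall a,
  `[0%R, 1%R]%classic a -> dep a = depth du0 M0 a}.
Proof.
have FF := ae_filter_ringOfSetsType (@lebesgue_measure R).
by apply: filterS hdu0 => x hx x01; rewrite hx.
Qed.

Lemma Jac_excess e v : 0 < e -> 1 - lam * e * v = lam * e * (excess e + (M0 - v)).
Proof. by move=> e0; rewrite /excess; field; rewrite !gt_eqF. Qed.

Lemma Kbar_qint i e : 0 < e < Es ->
  Kbar lam du0 i e = (lam * e) `^ (- (lam^-1 + i%:R)) * Q i (excess e).
Proof.
move=> eE; have x0 := excess_gt0 eE; have /andP[e0 _] := eE.
have s0 : 0 <= lam^-1 + i%:R by rewrite addr_ge0 ?invr_ge0// ltW.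
rewrite /qint -RintegralZl//; last exact: (integrable_qker measurable_hdepth hdepth_bnd).
rewrite /Kbar /Jac (ae_Rintegral01 hdu0 (fun v => (1 - lam * e * v) `^ _)).
apply: eq_Rintegral => a _; rewrite Jac_excess// powRM ?mulr_ge0 ?(ltW e0) ?(ltW lam_gt0)//.
  by rewrite opprD (addrC (- lam^-1)).
by have /andP[h1 _] := hdepth_bnd a; rewrite addr_ge0// ltW.
Qed.

Lemma qint_ge0 i x : 0 <= Q i x.
Proof. by apply: Rintegral_ge0 => a _; exact: powR_ge0. Qed.

Lemma clock_speed_excess e : 0 < e < Es ->
  clock_speed du0 lam e = (lam * e) `^ (- 2) * Q 0%N (excess e) `^ (2 * lam).
Proof.
move=> eE; rewrite /clock_speed Kbar_qint// powRM ?powR_ge0 ?qint_ge0//.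
by rewrite -powRrM; congr (_ `^ _ * _); rewrite addr0; field; rewrite gt_eqF.
Qed.

(** The powers of lam eta cancel: K0^(2 lam) contributes (lam eta)^(-2), while 1 / J
    and K1 / K0 contribute (lam eta)^(-1) each. *)
Lemma ux_formula_resvel (eta : R -> R) a t : 0 < t -> 0 < eta t < Es ->
  ux_formula lam du0 eta a t =
  resvel lam (Q 0%N) (Q 1%N) (depth du0 M0 a) (excess (eta t)).
Proof.
move=> t0 eE; rewrite /ux_formula (gt_eqF t0); set e := eta t in eE *.
have x0 := excess_gt0 eE; have /andP[e0 _] := eE.
have le0 : 0 < lam * e by rewrite mulr_gt0.
have K0 : 0 < Kbar lam du0 0 e.
  by apply: (Kbar0_gt0 hdata (ltW lam_gt0) mh hdu0 hmM lam_gt0); case/andP: eE => /ltW-> ->.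
have Q0 : 0 < Q 0%N (excess e).
  by move: K0; rewrite Kbar_qint// pmulr_rgt0// powR_gt0.
have := clock_speed_excess eE; rewrite /clock_speed => ->.
rewrite !Kbar_qint// /Jac Jac_excess// /resvel -/(depth du0 M0 a) powRN.
have d0 := depth_ge0 hdata a.
have xd0 : 0 < excess e + depth du0 M0 a by rewrite ltr_wpDr.
have -> : (lam * e) `^ (- (lam^-1 + 1%:R)) = (lam * e) `^ (- (lam^-1 + 0%:R)) * (lam * e)^-1.
  by rewrite addr0 opprD powRD ?(gt_eqF le0) ?implybT// powR_inv1// ltW.
have -> : (lam * e) `^ (- 2) = (lam * e) ^- 2.
  by rewrite powRN (powR_mulrn 2)// ltW.
have P0 : 0 < (lam * e) `^ (- (lam^-1 + 0%:R)) by rewrite powR_gt0.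
have P1 : 0 < Q 0%N (excess e) `^ (2 * lam) by rewrite powR_gt0.
move: (_ `^ (- (lam^-1 + 0%:R))) P0 => a0 a0_gt0.
move: (_ `^ (2 * lam)) P1 => b0 b0_gt0.
move: (Q 0%N _) Q0 => q0 q0_gt0; move: (Q 1%N _) => q1.
by field; rewrite !gt_eqF.
Qed.

(** Everything that the blow-up statements need to know about a solution. *)
Lemma solution_clock u ux g : the_solution lam u0 du0 M0 u ux g ->
  exists x : R -> R, [/\
    forall t a, 0 < t -> (t%:E < tstar lam du0 M0)%E ->
      0 < x t /\ ux (g a t) t = resvel lam (Q 0%N) (Q 1%N) (depth du0 M0 a) (x t),
    forall ts, tstar lam du0 M0 = ts%:E -> x t @[t --> ts^'-] --> (0 : R)^'+ &
    tstar lam du0 M0 = +oo%E -> x t @[t --> +oo] --> (0 : R)^'+].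
Proof.
move=> [_]; rewrite gt_eqF// => -[eta [eta0 eta_itv eta_ev] rep].
have E0 : 0 < Es := eta_star_gt0 hdata lam_gt0.
have rho0 e := @clock_speed_gt0 _ _ _ _ _ _ _ hdata (ltW lam_gt0) mh hdu0 hmM e lam_gt0.
have rhoc e := @clock_speed_continuous _ _ _ _ _ _ _ hdata (ltW lam_gt0) mh hdu0 hmM e lam_gt0.
have TE := tstar_tfinal du0 M0 lam_gt0.
have ev : evolves (tfinal (clock_speed du0 lam) Es) eta (fun t => (clock_speed du0 lam (eta t))^-1).
  by under eq_fun do rewrite clock_speedV; rewrite -TE.
rewrite TE in eta_itv rep *.
exists (fun t => excess (eta t)); split.
- move=> t a t0 tT; have /andP[_ eE] := eta_itv t (ltW t0) tT.
  have e0 := eta_gt0 rho0 eta0 eta_itv ev t0 tT.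
  have eE' : 0 < eta t < Es by rewrite e0.
  split; first exact: excess_gt0.
  by have [_ _ ->] := rep t (ltW t0) tT; exact: ux_formula_resvel.
- move=> ts Tts; exact: (cvg_comp _ _ (eta_cvg_left E0 rho0 rhoc eta0 eta_itv ev Tts) excess_cvg).
- move=> Tts; exact: (cvg_comp _ _ (eta_cvg_pinfty E0 rho0 rhoc eta0 eta_itv ev Tts) excess_cvg).
Qed.

(** The clock speed is of order x^(2 lam p - 2), where x is comparable to
    E - e near E; for 2 lam p <= 1 this is at least of order 1 / (E - e). *)
Lemma tstar_pinfty (p L0 : R) : 2 * lam * p <= 1 -> 0 < L0 ->
  x `^ (lam^-1 - p) * Q 0%N x @[x --> 0^'+] --> L0 -> tstar lam du0 M0 = +oo%E.
Proof.
move=> lp L00 Q0c; rewrite tstar_tfinal//.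
have E0 : 0 < Es := eta_star_gt0 hdata lam_gt0; have M00 := M0_gt0 hdata.
have rho0 e := @clock_speed_gt0 _ _ _ _ _ _ _ hdata (ltW lam_gt0) mh hdu0 hmM e lam_gt0.
have rhoc e := @clock_speed_continuous _ _ _ _ _ _ _ hdata (ltW lam_gt0) mh hdu0 hmM e lam_gt0.
have L02 : 0 < L0 / 2 by rewrite divr_gt0.
have L0L : L0 / 2 < L0 by rewrite ltr_pdivrMr// ltr_pMr// ltr1n.
have h01 := near_excess (near_right_unit R).
have hL0 := near_excess (cvgr_gt _ Q0c _ L0L).
pose k := (lam * Es) `^ (- 2) * (L0 / 2) `^ (2 * lam) * (Es / 2 / M0).
apply: (tfinal_pinfty E0 rho0 rhoc (C := k)).
  apply: mulr_gt0; last by rewrite divr_gt0// divr_gt0.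
  by apply: mulr_gt0; apply: powR_gt0 => //; exact: mulr_gt0.
near=> e.
have /andP[h1 h2] : Es / 2 < e < Es by near: e; exact: near_Es.
have e0 : 0 < e by apply: lt_trans h1; rewrite divr_gt0.
have eE : 0 < e < Es by rewrite e0.
have /andP[x0 x1] : 0 < excess e <= 1 by near: e; exact: h01.
have hL : L0 / 2 < excess e `^ (lam^-1 - p) * Q 0%N (excess e) by near: e; exact: hL0.
have le0 : 0 < lam * e by rewrite mulr_gt0.
have Ee : 0 < Es - e by rewrite subr_gt0.
pose z := Es / 2 / M0 / (Es - e).
have z0 : 0 <= z by rewrite ltW// !divr_gt0.
have -> : k / (Es - e) = (lam * Es) `^ (- 2) * ((L0 / 2) `^ (2 * lam) * z).
  by rewrite /k /z !mulrA.
have zz0 : 0 <= (L0 / 2) `^ (2 * lam) * z by apply: mulr_ge0 => //; exact: powR_ge0.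
rewrite clock_speed_excess//; apply: ler_pM; rewrite ?powR_ge0//.
  by apply: powR_le_neg => //; rewrite ler_pM2l// ltW.
have xp : 0 < excess e `^ (lam^-1 - p) by rewrite powR_gt0.
have -> : Q 0%N (excess e) `^ (2 * lam) =
    (excess e `^ (lam^-1 - p) * Q 0%N (excess e)) `^ (2 * lam) * excess e `^ (- (2 - 2 * lam * p)).
  rewrite powRM ?powR_ge0 ?qint_ge0// -powRrM mulrAC -powRD ?(gt_eqF x0) ?implybT//.
  have -> : (lam^-1 - p) * (2 * lam) - (2 - 2 * lam * p) = 0 by field; rewrite gt_eqF.
  by rewrite powRr0 mul1r.
apply: ler_pM; [exact: powR_ge0|exact: z0| |].
  by apply: ge0_ler_powR; rewrite ?nnegrE ?mulr_ge0 ?powR_ge0 ?qint_ge0 ?(ltW lam_gt0) ?(ltW L02)// ltW.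
apply: (@le_trans _ _ (excess e)^-1).
  rewrite excessE// /z.
  have -> : (M0 * (Es - e) / e)^-1 = e / M0 / (Es - e) by field; rewrite !gt_eqF.
  by rewrite !ler_pM2r ?invr_gt0// ltW.
rewrite powRN lef_pV2 ?posrE ?powR_gt0// -[leRHS]powRr1 ?(ltW x0)//.
by rewrite ger_powR ?x0//; lra.
Unshelve. all: by end_near. Qed.

(** A bound x^(- r) on the integral bounds the clock speed by
    (E - e)^(- 2 lam r), which is integrable. *)
Lemma tstar_finite (r C : R) : 0 <= r -> 2 * lam * r < 1 ->
  (\forall x \near (0 : R)^'+, Q 0%N x <= C * x `^ (- r)) ->
  exists2 ts : R, 0 < ts & tstar lam du0 M0 = ts%:E.
Proof.
move=> r0 lr /near_excess hQ; rewrite tstar_tfinal//.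
have E0 : 0 < Es := eta_star_gt0 hdata lam_gt0; have M00 := M0_gt0 hdata.
have rho0 e := @clock_speed_gt0 _ _ _ _ _ _ _ hdata (ltW lam_gt0) mh hdu0 hmM e lam_gt0.
have rhoc e := @clock_speed_continuous _ _ _ _ _ _ _ hdata (ltW lam_gt0) mh hdu0 hmM e lam_gt0.
pose p := 2 * lam * r.
have p0 : 0 <= p by rewrite !mulr_ge0// ltW.
pose k := (lam * (Es / 2)) `^ (- 2) * (`|C| `^ (2 * lam) * (M0 / Es) `^ (- p)).
apply: (tfinal_finite E0 rho0 rhoc (C := k) (p := p)); first by rewrite p0.
near=> e.
have /andP[h1 h2] : Es / 2 < e < Es by near: e; exact: near_Es.
have E20 : 0 < Es / 2 by rewrite divr_gt0.
have e0 : 0 < e by apply: lt_trans h1.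
have eE : 0 < e < Es by rewrite e0.
have x0 := excess_gt0 eE.
have hq : Q 0%N (excess e) <= C * excess e `^ (- r) by near: e; exact: hQ.
have Ee : 0 < Es - e by rewrite subr_gt0.
have -> : k * (Es - e) `^ (- p) =
    (lam * (Es / 2)) `^ (- 2) * (`|C| `^ (2 * lam) * (M0 / Es * (Es - e)) `^ (- p)).
  have -> : (M0 / Es * (Es - e)) `^ (- p) = (M0 / Es) `^ (- p) * (Es - e) `^ (- p).
    by rewrite powRM// ltW// divr_gt0.
  by rewrite /k !mulrA.
rewrite clock_speed_excess//; apply: ler_pM; rewrite ?powR_ge0//.
  by apply: powR_le_neg => //; [exact: mulr_gt0|rewrite ler_pM2l// ltW].
apply: (@le_trans _ _ ((`|C| * excess e `^ (- r)) `^ (2 * lam))).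
  apply: ge0_ler_powR; rewrite ?nnegrE ?mulr_ge0 ?powR_ge0 ?qint_ge0 ?(ltW lam_gt0)//.
  by rewrite (le_trans hq)// ler_wpM2r ?powR_ge0// ler_norm.
have -> : (`|C| * excess e `^ (- r)) `^ (2 * lam) = `|C| `^ (2 * lam) * excess e `^ (- p).
  rewrite powRM ?powR_ge0// -powRrM; congr (_ * _ `^ _).
  by rewrite /p; ring.
rewrite ler_wpM2l ?powR_ge0//.
apply: powR_le_neg => //; first by rewrite mulr_gt0// divr_gt0.
rewrite excessE// mulrAC ler_pM2l ?mulr_gt0// lef_pV2 ?posrE// ltW.
Unshelve. all: by end_near. Qed.
End ClockVariable.

(** * From the rescaled velocity gradient to the solution *)

Section Transfer.
Variables (R : realType) (u0 du0 : R -> R) (M0 m0 lam : R).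
Variables (T : \bar R) (U : R -> R -> R) (Q0 Q1 x : R -> R).
Hypothesis hdata : initial_data u0 du0 M0 m0.
Local Notation V := (resvel lam Q0 Q1).
Hypothesis U_V : forall t a, 0 < t -> (t%:E < T)%E ->
  0 < x t /\ U a t = V (depth du0 M0 a) (x t).
Hypothesis x_left : forall ts, T = ts%:E -> x t @[t --> ts^'-] --> (0 : R)^'+.
Hypothesis x_pinfty : T = +oo%E -> x t @[t --> +oo] --> (0 : R)^'+.

Lemma depth_max b : attained_at du0 M0 b -> depth du0 M0 b = 0.
Proof. by move=> [_ e]; rewrite /depth e subrr. Qed.

Lemma depth_gt0 a : 0 <= a <= 1 -> ~ attained_at du0 M0 a -> 0 < depth du0 M0 a.
Proof.
move=> a01 na; rewrite lt_def (depth_ge0 hdata) andbT; apply/eqP => d0; apply: na.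
by split => //; apply/esym/eqP; rewrite -subr_eq0; apply/eqP.
Qed.

Lemma depth_le a : depth du0 M0 a <= M0 - m0.
Proof. by rewrite lerD2l lerN2; exact: id_min hdata a. Qed.

(** resvel is nonincreasing in the depth, so the extrema are reached at the
    extreme depths 0 and M0 - m0. *)
Lemma maxU_eq t : 0 < t -> (t%:E < T)%E -> maxU U t = V 0 (x t).
Proof.
move=> t0 tT; have [b hb] := id_max_att hdata.
have ub : ubound [set U a t | a in `[0%R, 1%R]] (V 0 (x t)).
  move=> _ [a _ <-]; have [x0 ->] := U_V a t0 tT.
  by apply: resvel_decr => //; exact: (depth_ge0 hdata).
have mem : [set U a t | a in `[0%R, 1%R]] (V 0 (x t)).
  exists b; first by rewrite /= in_itv/=; case: hb.
  by have [_ ->] := U_V b t0 tT; rewrite depth_max.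
apply/le_anti/andP; split; first by apply: ge_sup => //; exists (V 0 (x t)).
by apply: ub_le_sup => //; exists (V 0 (x t)).
Qed.

Lemma minU_eq t : 0 < t -> (t%:E < T)%E -> minU U t = V (M0 - m0) (x t).
Proof.
move=> t0 tT; have [b [b01 hb]] := id_min_att hdata.
have lb : lbound [set U a t | a in `[0%R, 1%R]] (V (M0 - m0) (x t)).
  move=> _ [a _ <-]; have [x0 ->] := U_V a t0 tT.
  apply: resvel_decr => //; first exact: (depth_ge0 hdata).
  exact: depth_le.
have mem : [set U a t | a in `[0%R, 1%R]] (V (M0 - m0) (x t)).
  exists b; first by rewrite /= in_itv/=.
  by have [_ ->] := U_V b t0 tT; rewrite /depth hb.
apply/le_anti/andP; split.
  by apply: ge_inf => //; exists (V (M0 - m0) (x t)).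
by apply: lb_le_inf => //; exists (V (M0 - m0) (x t)).
Qed.

Section FiniteTime.
Variable ts : R.
Hypothesis ts_gt0 : 0 < ts.
Hypothesis T_ts : T = ts%:E.

Lemma near_ts : \forall t \near ts^'-, 0 < t /\ (t%:E < T)%E.
Proof.
near=> t; split; first by near: t; exact: nbhs_left_gt.
by rewrite T_ts lte_fin; near: t; exact: nbhs_left_lt.
Unshelve. all: by end_near. Qed.

Lemma cvg_U_left (w : R -> R) (D : R) (F : set_system R) :
  (forall t, 0 < t -> (t%:E < T)%E -> w t = V D (x t)) ->
  V D y @[y --> 0^'+] --> F -> w t @[t --> ts^'-] --> F.
Proof.
move=> wV VF; have e : \forall t \near ts^'-, V D (x t) = w t.
  by apply: filterS near_ts => t [t0 tT]; rewrite wV.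
exact: (cvg_trans (near_eq_cvg e) (cvg_comp _ _ (x_left T_ts) VF)).
Qed.

Lemma bounded_U_left (w : R -> R) (D : R) :
  (forall t, 0 < t -> (t%:E < T)%E -> w t = V D (x t)) ->
  (exists B : R, \forall y \near (0 : R)^'+, `|V D y| <= B) ->
  exists B : R, \forall t \near ts^'-, `|w t| <= B.
Proof.
move=> wV [B hB]; exists B; have h := x_left T_ts hB.
by apply: filterS2 near_ts h => t [t0 tT] /= h; rewrite wV.
Qed.

Lemma min_depth_gt0 : 0 < M0 - m0.
Proof. by have /andP[h1 h2] := id_sign hdata; rewrite subr_gt0 (lt_trans h1). Qed.

Lemma two_sided_of_resvel :
  V 0 y @[y --> 0^'+] --> +oo ->
  (forall D, 0 < D -> V D y @[y --> 0^'+] --> -oo) ->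
  two_sided_blowup du0 M0 m0 T U.
Proof.
move=> V0 VD; exists ts; split => //.
- exact: cvg_U_left maxU_eq V0.
- exact: cvg_U_left minU_eq (VD _ min_depth_gt0).
move=> a a01 na; apply: (@cvg_U_left _ (depth du0 M0 a)).
  by move=> t t0 tT; have [_] := U_V a t0 tT.
by apply/VD/depth_gt0 => // ha; apply: na; left.
Qed.

Lemma one_sided_of_resvel :
  V 0 y @[y --> 0^'+] --> +oo ->
  (forall D, 0 < D -> exists B : R, \forall y \near (0 : R)^'+, `|V D y| <= B) ->
  one_sided_blowup du0 M0 T U.
Proof.
move=> V0 VD; exists ts; split => //.
- exact: cvg_U_left maxU_eq V0.
- move=> a ha; apply: (@cvg_U_left _ 0) V0 => t t0 tT.
  by have [_ ->] := U_V a t0 tT; rewrite depth_max.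
- move=> a a01 na; apply: (@bounded_U_left _ (depth du0 M0 a)).
    by move=> t t0 tT; have [_] := U_V a t0 tT.
  by apply/VD/depth_gt0.
- exact: bounded_U_left minU_eq (VD _ min_depth_gt0).
Qed.

End FiniteTime.

Lemma cvg_U_pinfty a (l : R) : T = +oo%E ->
  V (depth du0 M0 a) y @[y --> 0^'+] --> l -> U a t @[t --> +oo] --> l.
Proof.
move=> Ty Vl; have e : \forall t \near +oo, V (depth du0 M0 a) (x t) = U a t.
  near=> t; have t0 : 0 < t by near: t; apply: nbhs_pinfty_gt; exact: num_real.
  by have [|_ ->] := @U_V t a t0; rewrite ?Ty ?ltry.
exact: (cvg_trans (near_eq_cvg e) (cvg_comp _ _ (x_pinfty Ty) Vl)).
Unshelve. all: by end_near. Qed.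
End Transfer.

(** * The regimes of the parameter *)

Section Regimes.
Variables (R : realType) (u0 du0 : R -> R) (M0 m0 q C1 lam : R) (h : R -> R).
Hypothesis hdata : initial_data u0 du0 M0 m0.
Hypothesis q_gt0 : 0 < q.
Hypothesis C1_lt0 : C1 < 0.
Hypothesis hprofile : max_profile du0 M0 q C1.
Hypothesis lam_gt0 : 0 < lam.
Hypothesis mh : measurable_fun setT h.
Hypothesis hdu0 : {ae (@lebesgue_measure R), forall x, `[0%R, 1%R]%classic x -> h x = du0 x}.
Hypothesis hmM : forall x, m0 <= h x <= M0.

Local Notation E := (fun a => M0 - h a).
Local Notation Q i := (qint (fun a => M0 - h a) (lam^-1 + i%:R)).

Lemma qint_asym : exists2 N : R, 0 < N & forall s I : R, 1 < q * s ->
  mint q s 1 1 Y @[Y --> +oo] --> I ->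
  x `^ (s - q^-1) * qint E s x @[x --> 0^'+] --> N * I.
Proof.
have [S [uS hS [b bS]]] := maxpoints hdata.
have S01 b' : b' \in S -> 0 <= b' <= 1 by move=> /hS[].
exists (nsides S * `|C1| `^ (- q^-1)).
  by apply: mulr_gt0; [exact: nsides_gt0 uS S01 b bS|exact/powR_gt0/normC1_gt0].
move=> s I qs mI; rewrite -mulrA.
have near_ := depth_near q_gt0 C1_lt0 hprofile (fun b' => proj1 (hS b')).
exact: (qint_cvg q_gt0 (normC1_gt0 C1_lt0) uS S01 (depth_ge0 hdata) near_ (depth_away hdata hS)
  (measurable_hdepth M0 mh) (hdepth_bnd hmM) (hdepth_depth M0 hdu0) qs mI).
Qed.

Lemma qint_bnd s : 0 <= s -> q * s < 1 ->
  exists C : R, forall x, 0 < x <= 1 -> qint E s x <= C.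
Proof.
move=> s0 qs; have [S [uS hS [b bS]]] := maxpoints hdata.
have S01 b' : b' \in S -> 0 <= b' <= 1 by move=> /hS[].
have near_ := depth_near q_gt0 C1_lt0 hprofile (fun b' => proj1 (hS b')).
exact: (qint_bounded q_gt0 (normC1_gt0 C1_lt0) uS S01 (depth_ge0 hdata) near_ (depth_away hdata hS)
  (measurable_hdepth M0 mh) (hdepth_bnd hmM) (hdepth_depth M0 hdu0) s0 qs).
Qed.

Lemma mint_lim_gt s I0 I1 : 0 <= s -> mint q s 1 1 Y @[Y --> +oo] --> (I0 : R) ->
  mint q (s + 1) 1 1 Y @[Y --> +oo] --> (I1 : R) -> I1 < I0.
Proof.
move=> s0 c0 c1; have [k k0 hk] := mint1_gap q_gt0 s0.
apply: (@lt_le_trans _ _ (I1 + k)); first by rewrite ltrDl.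
have c1k : mint q (s + 1) 1 1 Y + k @[Y --> +oo] --> I1 + k.
  by apply: cvgD => //; exact: cvg_cst.
apply: (ler_cvg_to c1k c0); near=> Y; apply: hk.
by near: Y; apply: nbhs_pinfty_ge; exact: num_real.
Unshelve. all: by end_near. Qed.

Let s_gt0 : 0 < lam^-1. Proof. by rewrite invr_gt0. Qed.

Lemma both_singular : lam < q -> exists L0 L1 : R, [/\ 0 < L1, L1 < L0,
  x `^ (lam^-1 - q^-1) * Q 0%N x @[x --> 0^'+] --> L0 &
  x `^ (lam^-1 + 1 - q^-1) * Q 1%N x @[x --> 0^'+] --> L1].
Proof.
move=> lq; have [N N0 hN] := qint_asym.
have qs : 1 < q * lam^-1 by rewrite ltr_pdivlMr// mul1r.
have qs1 : 1 < q * (lam^-1 + 1) by rewrite mulrDr mulr1 (lt_trans qs)// ltrDl.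
have [I0 I00 c0] := mint1_cvg q_gt0 qs; have [I1 I10 c1] := mint1_cvg q_gt0 qs1.
exists (N * I0), (N * I1); split.
- exact: mulr_gt0.
- by rewrite ltr_pM2l//; exact: mint_lim_gt (ltW s_gt0) c0 c1.
- by rewrite addr0; exact: hN.
- exact: hN.
Qed.

Lemma first_bounded : q < lam -> exists k C : R,
  0 < k /\ forall x, 0 < x <= 1 -> k <= Q 0%N x <= C.
Proof.
move=> ql; have qs : q * lam^-1 < 1 by rewrite ltr_pdivrMr// mul1r.
have [C hC] := qint_bnd (ltW s_gt0) qs.
have [k k0 hk] := qint_lower (measurable_hdepth M0 mh) (hdepth_bnd hmM) (ltW s_gt0).
by exists k, C; split => // x x01; rewrite addr0 hk ?hC.
Qed.

(** Q1 is of order x^(- r) with r = 1/lam + 1 - 1/q, and q < lam means r < 1. *)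
Lemma second_singular : q < lam -> 1 < q * (lam^-1 + 1) ->
  Q 1%N x @[x --> 0^'+] --> +oo /\ x * Q 1%N x @[x --> 0^'+] --> (0 : R).
Proof.
move=> ql qs1; have [N N0 hN] := qint_asym.
have [I1 I10 c1] := mint1_cvg q_gt0 qs1.
have {hN} := hN _ _ qs1 c1; set r := lam^-1 + 1 - q^-1 => hQ.
have L0 : 0 < N * I1 by rewrite mulr_gt0.
have r0 : 0 < r by rewrite subr_gt0 -[q^-1]mul1r ltr_pdivrMr// mulrC.
have r1 : 0 < 1 - r by rewrite /r; have := ql; rewrite -(ltf_pV2 _ _) ?posrE//; lra.
split.
  have := cvg_pinfty_scaled _ L0 (@cvg_powR_neg_right0 _ (- r) _) hQ.
  rewrite oppr_lt0 => /(_ _ r0); apply: cvg_trans; apply: near_eq_cvg; near=> x.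
  have x0 : 0 < x by near: x; exact: nbhs_right_gt.
  by rewrite mulrA -powRD ?(gt_eqF x0) ?implybT// addNr powRr0 mul1r.
have : x `^ (1 - r) * (x `^ r * Q 1%N x) @[x --> 0^'+] --> 0 * (N * I1).
  by apply: cvgM => //; exact: powR_cvg0.
rewrite mul0r; apply: cvg_trans; apply: near_eq_cvg; near=> x.
have x0 : 0 < x by near: x; exact: nbhs_right_gt.
by rewrite mulrA -powRD ?(gt_eqF x0) ?implybT// subrK powRr1// ltW.
Unshelve. all: by end_near. Qed.

Lemma tstar_finite_bounded : q < lam -> exists2 ts : R, 0 < ts & tstar lam du0 M0 = ts%:E.
Proof.
move=> ql; have [k [C [k0 hC]]] := first_bounded ql.
apply: (tstar_finite hdata lam_gt0 mh hdu0 hmM (r := 0) (C := C)); rewrite ?mulr0//.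
apply: filterS (near_right_unit R) => x /hC/andP[_ h2].
by rewrite oppr0 powRr0 mulr1.
Qed.

Let has_solution : exists u ux g : R -> R -> R, the_solution lam u0 du0 M0 u ux g.
Proof. exact: exists_solution hdata (ltW lam_gt0) mh hdu0 hmM. Qed.

Lemma global_regime : lam <= q / 2 -> solution_satisfies lam u0 du0 M0 (fun T U =>
  [/\ T = +oo%E, lam < q / 2 -> vanishes U & lam = q / 2 -> nontrivial_steady_state U]).
Proof.
move=> lq2; have lq : lam < q by rewrite (le_lt_trans lq2)// ltr_pdivrMr// ltr_pMr// ltr1n.
have [L0 [L1 [L10 L1L0 c0 c1]]] := both_singular lq.
have lp : 2 * lam * q^-1 <= 1 by rewrite ler_pdivrMr// mul1r; move: lq2; lra.
have Ty : tstar lam du0 M0 = +oo%E.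
  by apply: (tstar_pinfty hdata lam_gt0 mh hdu0 hmM lp _ c0); exact: lt_trans L1L0.
split => // u ux g sol.
have [x [hU _ xy]] := solution_clock hdata lam_gt0 mh hdu0 hmM sol.
have d0 := depth_ge0 hdata.
split => // hl.
  move=> a _; apply: (cvg_U_pinfty hU xy Ty).
  apply: (resvel_vanish lam_gt0 L10 L1L0 c0 c1) => //.
  by rewrite ltr_pdivrMr// mul1r; move: hl; lra.
exists (fun a => sing_limit lam L0 L1 (depth du0 M0 a)); split.
  move=> a _; apply: (cvg_U_pinfty hU xy Ty).
  apply: (resvel_steady lam_gt0 L10 L1L0 c0 c1) => //.
  by rewrite hl; field; rewrite gt_eqF.
have [b hb] := id_max_att hdata; exists b; first by case: hb.
by rewrite depth_max// gt_eqF// sing_limit0_gt0.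
Qed.

(** Q0 being of order x^(- (1/lam - 1/q)), the lifespan is finite because
    2 lam (1/lam - 1/q) = 2 - 2 lam / q < 1. *)
Lemma both_singular_regime : q / 2 < lam -> lam < q ->
  solution_satisfies lam u0 du0 M0 (two_sided_blowup du0 M0 m0).
Proof.
move=> lq2 lq; have [L0 [L1 [L10 L1L0 c0 c1]]] := both_singular lq.
have lp : 1 < 2 * lam * q^-1 by rewrite ltr_pdivlMr// mul1r; move: lq2; lra.
have [ts ts0 Tts] : exists2 ts : R, 0 < ts & tstar lam du0 M0 = ts%:E.
  apply: (tstar_finite hdata lam_gt0 mh hdu0 hmM (r := lam^-1 - q^-1) (C := L0 + 1)).
  - by rewrite subr_ge0 lef_pV2 ?posrE// ltW.
  - rewrite (_ : 2 * lam * (lam^-1 - q^-1) = 2 - 2 * lam * q^-1); first by lra.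
    by field; rewrite !gt_eqF.
  have h1 : \forall x \near (0 : R)^'+, x `^ (lam^-1 - q^-1) * Q 0%N x < L0 + 1.
    by apply: (cvgr_lt _ c0); rewrite ltrDl.
  near=> x; have x0 : 0 < x by near: x; exact: nbhs_right_gt.
  rewrite powRN ler_pdivlMr ?powR_gt0// mulrC ltW//.
  by near: x; exact: h1.
split => // u ux g sol.
have [x [hU xl _]] := solution_clock hdata lam_gt0 mh hdu0 hmM sol.
have B D : 0 <= D -> _ := fun D0 => resvel_blowup lam_gt0 L10 L1L0 c0 c1 D0 lp.
apply: (two_sided_of_resvel hdata hU xl ts0 Tts).
  by apply: (proj1 (B 0 _)).
by move=> D D0; apply: (proj2 (B D (ltW D0))).
Unshelve. all: by end_near. Qed.

Lemma second_singular_regime : q < lam -> 1 < q * (lam^-1 + 1) ->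
  solution_satisfies lam u0 du0 M0 (two_sided_blowup du0 M0 m0).
Proof.
move=> ql qs1; have [k [C [k0 hC]]] := first_bounded ql.
have [Q1y xQ1] := second_singular ql qs1.
have [ts ts0 Tts] := tstar_finite_bounded ql.
split => // u ux g sol.
have [x [hU xl _]] := solution_clock hdata lam_gt0 mh hdu0 hmM sol.
apply: (two_sided_of_resvel hdata hU xl ts0 Tts).
  exact: (resvel_max_blowup lam_gt0 k0 hC xQ1).
by move=> D D0; exact: (resvel_min_blowup lam_gt0 k0 hC D0 Q1y).
Qed.

Lemma bounded_regime : q < lam -> q * (lam^-1 + 1) < 1 ->
  solution_satisfies lam u0 du0 M0 (one_sided_blowup du0 M0).
Proof.
move=> ql qs1; have [k [C [k0 hC]]] := first_bounded ql.
have [C' hC'] := qint_bnd (addr_ge0 (ltW s_gt0) ler01) qs1.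
have [ts ts0 Tts] := tstar_finite_bounded ql.
split => // u ux g sol.
have [x [hU xl _]] := solution_clock hdata lam_gt0 mh hdu0 hmM sol.
have Q1_0 y : 0 <= Q 1%N y by exact: qint_ge0.
apply: (one_sided_of_resvel hdata hU xl ts0 Tts).
  apply: (resvel_max_blowup lam_gt0 k0 hC).
  apply/cvgrPdist_le => e e0.
  have e1 : 0 < e / (`|C'| + 1) by rewrite divr_gt0// ltr_wpDl.
  near=> y; have y01 : 0 < y <= 1 by near: y; exact: near_right_unit.
  have /andP[y0 y1] := y01.
  have ye : y <= e / (`|C'| + 1) by near: y; exact: nbhs_right_le.
  rewrite sub0r normrN ger0_norm; last by rewrite mulr_ge0// ltW.
  rewrite -[leRHS](@divfK _ (`|C'| + 1)); last by rewrite gt_eqF// ltr_wpDl.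
  apply: ler_pM; [exact: ltW|exact: Q1_0|exact: ye|].
  by rewrite (le_trans (hC' _ y01))// (le_trans (ler_norm _))// lerDl.
move=> D D0; exact: (resvel_bounded lam_gt0 k0 hC Q1_0 D0 hC').
Unshelve. all: by end_near. Qed.
End Regimes.

Theorem theorem3p62 (R : realType) (u0 du0 : R -> R) (M0 m0 q C1 : R)
    (hdata : initial_data u0 du0 M0 m0)
    (hq : 0 < q) (hC1 : C1 < 0) (hprofile : max_profile du0 M0 q C1) :
  (forall lam : R, 0 <= lam <= q / 2 ->
     solution_satisfies lam u0 du0 M0 (fun T U =>
       [/\ T = +oo%E,
           0 < lam < q / 2 -> vanishes U &
           lam = q / 2 -> nontrivial_steady_state U])) /\
  (forall lam : R, q / 2 < lam < q ->
     solution_satisfies lam u0 du0 M0 (two_sided_blowup du0 M0 m0)) /\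
  ((forall lam : R, 0 < q < 1 / 2 -> 1 < lam ->
      (forall n : nat, (0 < n)%N ->
         q <> 1 / n%:R /\ lam <> q / (1 - n%:R * q)) ->
      solution_satisfies lam u0 du0 M0 (one_sided_blowup du0 M0)) /\
   (forall lam : R, 1 / 3 < q < 1 / 2 -> 1 / 2 < lam < q / (1 - q) ->
      solution_satisfies lam u0 du0 M0 (two_sided_blowup du0 M0 m0))) /\
  ((forall lam : R, 1 / 2 < q < 1 -> q < lam < q / (1 - q) ->
      solution_satisfies lam u0 du0 M0 (two_sided_blowup du0 M0 m0)) /\
   (forall lam : R, 1 / 2 < q < 1 -> q / (1 - q) < lam ->
      solution_satisfies lam u0 du0 M0 (one_sided_blowup du0 M0))) /\
  (forall lam : R, 1 < q -> q < lam ->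
     solution_satisfies lam u0 du0 M0 (two_sided_blowup du0 M0 m0)).
Proof.
have [h [mh hdu0 hmM]] := bounded_borel_version hdata.
(* For q < 1 the number q (1 / lam + 1) crosses 1 at lam = q / (1 - q). *)
have above (lam : R) : 0 < lam -> lam * (1 - q) < q -> 1 < q * (lam^-1 + 1).
  by move=> l0 hl; rewrite mulrDr mulr1 -ltrBlDr ltr_pdivlMr//; move: hl; lra.
have below (lam : R) : 0 < lam -> q < lam * (1 - q) -> q * (lam^-1 + 1) < 1.
  by move=> l0 hl; rewrite mulrDr mulr1 -ltrBrDr ltr_pdivrMr//; move: hl; lra.
split.
  move=> lam /andP[]; rewrite le_eqVlt => /predU1P[<- _|l0 lq].
    split; first exact: exists_solution hdata (lexx 0) mh hdu0 hmM.
    move=> u ux g _; split.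
    - by rewrite /tstar eqxx.
    - by rewrite ltxx.
    - by move=> e; move: hq; rewrite -(mulr0 2) e; lra.
  have [ex P] := global_regime hdata hq hC1 hprofile l0 mh hdu0 hmM lq.
  split => // u ux g sol; have [P1 P2 P3] := P _ _ _ sol.
  by split => // /andP[_]; exact: P2.
split.
  move=> lam /andP[l1 l2]; have l0 : 0 < lam by apply: lt_trans l1; rewrite divr_gt0.
  exact: (both_singular_regime hdata hq hC1 hprofile l0 mh hdu0 hmM).
have S2 lam : q < lam -> lam * (1 - q) < q ->
    solution_satisfies lam u0 du0 M0 (two_sided_blowup du0 M0 m0).
  move=> ql hl; have l0 := lt_trans hq ql.
  by apply: (second_singular_regime hdata hq hC1 hprofile l0 mh hdu0 hmM ql); exact: above.
have S1 lam : q < lam -> q < lam * (1 - q) ->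
    solution_satisfies lam u0 du0 M0 (one_sided_blowup du0 M0).
  move=> ql hl; have l0 := lt_trans hq ql.
  by apply: (bounded_regime hdata hq hC1 hprofile l0 mh hdu0 hmM ql); exact: below.
split; [split|split; [split|]].
- move=> lam /andP[_ q2] l1 _; apply: S1; first by lra.
  by rewrite (lt_trans (_ : q < 1 - q))//; [lra|rewrite ltr_pMl//; lra].
- move=> lam /andP[_ q2] /andP[l1 l2]; apply: S2; first by lra.
  by rewrite -ltr_pdivlMr//; lra.
- move=> lam /andP[_ q2] /andP[l1 l2]; apply: S2 => //.
  by rewrite -ltr_pdivlMr//; lra.
- move=> lam /andP[q2 q1] l1.
  have q1' : 0 < 1 - q by lra.
  have hl : q < lam * (1 - q) by rewrite -ltr_pdivrMr.
  apply: S1 => //; apply: lt_trans l1; rewrite ltr_pdivlMr//.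
  by rewrite gtr_pMr//; lra.
- move=> lam q1 ql; apply: S2 => //; apply: (lt_trans _ hq).
  by rewrite pmulr_rlt0 ?subr_lt0// (lt_trans hq).
Qed.
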